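(* Let $D=((a_n),(b_n))$ be a divisor with $a_n\neq0$, $b_n\neq0$ for all $n$, satisfying: (a) $\inf_{n,k}|a_n-b_k|>0$; (b) there is $C$ with ${\rm card}\{n:|a_n-c|\le 1\}+{\rm card}\{n:|b_n-c|\le1\}<C$ for all $c\in\mathbb{C}$; (d) there is $C$ with $\Big|\int_1^r\frac{{\rm card}\{n:|a_n-c|<t\}-{\rm card}\{n:|b_n-c|<t\}}{t}\,dt\Big|<C$ for all $c\in\mathbb{C}$, $r>1$; (e) there is $C$ with $\Big|\frac1r\int_1^r\Big(\sum_{n:|a_n-c|<t}(a_n-c)-\sum_{n:|b_n-c|<t}(b_n-c)\Big)\frac{dt}{t}\Big|<C$ for all $c\in\mathbb{C}$, $r>1$; (f) $\lim_{r\to\infty}\big(\sum_{1\le|a_n|<r}a_n^{-2}-\sum_{1\le|b_n|<r}b_n^{-2}\big)$ exists and is finite. Then $\alpha=\lim_{r\to\infty}\big(\sum_{|b_n|<r}(1/b_n-\overline{b_n}/r^2)-\sum_{|a_n|<r}(1/a_n-\overline{a_n}/r^2)\big)$ exists, the function $$f(z)=e^{\alpha z}\lim_{r\to\infty}\frac{\prod_{n:|a_n|<r}(1-z/a_n)e^{z/a_n}}{\prod_{n:|b_n|<r}(1-z/b_n)e^{z/b_n}}$$ is well defined and meromorphic on $\mathbb{C}$, it has divisor $D$, and it is a normal function.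
   Context: $\rho_S$ is the spherical metric. A meromorphic $f$ on $\mathbb{C}$ is normal if for every sequence $(h_n)\subset\mathbb{C}$ there is a subsequence $(h_{n'})$ with $\rho_S(f(z+h_{n'}),f(z+h_{m'}))\to0$ uniformly on compact subsets of $\mathbb{C}$. A divisor $D=((a_n),(b_n))$: a map $\mathbb{C}\to\mathbb{Z}$ with discrete support, $(a_n)$ listing the points with positive value (with multiplicity $D(a)$) and $(b_n)$ the points with negative value (with multiplicity $-D(b)$); it is the divisor of $f$ if the $a_n$ are the zeros and $b_n$ the poles of $f$ with multiplicities. *)

(* Defs.v *)
From Stdlib Require Import Reals Lra Lia ZArith Classical ClassicalEpsilon ClassicalDescription.
Open Scope R_scope.

Record Cx := mkCx { Re : R; Im : R }.

Definition Czero : Cx := mkCx 0 0.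
Definition Cone : Cx := mkCx 1 0.
Definition RtoC (x : R) : Cx := mkCx x 0.
Definition Cadd (z w : Cx) : Cx := mkCx (Re z + Re w) (Im z + Im w).
Definition Copp (z : Cx) : Cx := mkCx (- Re z) (- Im z).
Definition Csub (z w : Cx) : Cx := Cadd z (Copp w).
Definition Cmul (z w : Cx) : Cx :=
  mkCx (Re z * Re w - Im z * Im w) (Re z * Im w + Im z * Re w).
(* inverse; Cinv Czero = Czero by the usual total convention *)
Definition Cinv (z : Cx) : Cx :=
  mkCx (Re z / (Re z * Re z + Im z * Im z)) (- Im z / (Re z * Re z + Im z * Im z)).
Definition Cdiv (z w : Cx) : Cx := Cmul z (Cinv w).
Definition Cconj (z : Cx) : Cx := mkCx (Re z) (- Im z).
Definition Cnorm (z : Cx) : R := sqrt (Re z * Re z + Im z * Im z).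
Definition Cexp (z : Cx) : Cx := mkCx (exp (Re z) * cos (Im z)) (exp (Re z) * sin (Im z)).
Fixpoint Cpow (z : Cx) (n : nat) : Cx :=
  match n with O => Cone | S k => Cmul z (Cpow z k) end.
Definition Cpowz (z : Cx) (m : Z) : Cx :=
  match m with
  | Z0 => Cone
  | Zpos p => Cpow z (Pos.to_nat p)
  | Zneg p => Cinv (Cpow z (Pos.to_nat p))
  end.

Fixpoint ffold_upto {A : Type} (op : A -> A -> A) (e : A) (P : nat -> Prop) (F : nat -> A)
  (N : nat) : A :=
  match N with
  | O => e
  | S k => op (ffold_upto op e P F k)
              (if excluded_middle_informative (P k) then F k else e)
  end.

(* Fold of op over the finite set {n | P n}; (junk value e if that set is infinite). *)
Definition ffold {A : Type} (op : A -> A -> A) (e : A) (P : nat -> Prop) (F : nat -> A) : A :=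
  match excluded_middle_informative (exists N : nat, forall n, P n -> (n < N)%nat) with
  | left H => ffold_upto op e P F (proj1_sig (constructive_indefinite_description _ H))
  | right _ => e
  end.

Definition fcard (P : nat -> Prop) : nat := ffold Nat.add O P (fun _ => 1%nat).
Definition fsumC (P : nat -> Prop) (F : nat -> Cx) : Cx := ffold Cadd Czero P F.
Definition fprodC (P : nat -> Prop) (F : nat -> Cx) : Cx := ffold Cmul Cone P F.

Definition Clim_infty (F : R -> Cx) (L : Cx) : Prop :=
  forall eps, eps > 0 -> exists R0, forall r, r > R0 -> Cnorm (Csub (F r) L) < eps.

(* ---------- A (finite or infinite) sequence of points of C ----------
   A sequence is given by an index set I : nat -> Prop and values s : nat -> Cx;
   the points listed are s n for n with I n. *)
Definition locally_finite (I : nat -> Prop) (s : nat -> Cx) : Prop :=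
  forall r : R, exists N : nat, forall n, I n -> Cnorm (s n) <= r -> (n < N)%nat.

Definition divisor_of (Ia : nat -> Prop) (a : nat -> Cx) (Ib : nat -> Prop) (b : nat -> Cx)
  (z : Cx) : Z :=
  (Z.of_nat (fcard (fun n => Ia n /\ a n = z)) - Z.of_nat (fcard (fun n => Ib n /\ b n = z)))%Z.

Inductive Cext := Fin (w : Cx) | Inf.

Definition rhoS (u v : Cext) : R :=
  match u, v with
  | Fin w1, Fin w2 => 2 * Cnorm (Csub w1 w2) /
        sqrt ((1 + Cnorm w1 ^ 2) * (1 + Cnorm w2 ^ 2))
  | Fin w, Inf | Inf, Fin w => 2 / sqrt (1 + Cnorm w ^ 2)
  | Inf, Inf => 0
  end.

Definition C_differentiable_at (g : Cx -> Cx) (z : Cx) : Prop :=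
  exists d : Cx, forall eps, eps > 0 -> exists delta, delta > 0 /\
    forall h, 0 < Cnorm h < delta ->
      Cnorm (Csub (Cdiv (Csub (g (Cadd z h)) (g z)) h) d) < eps.

Definition holomorphic_on_disk (g : Cx -> Cx) (z0 : Cx) (delta : R) : Prop :=
  forall z, Cnorm (Csub z z0) < delta -> C_differentiable_at g z.

(* value of (z - z0)^m g(z) in the extended plane, with the value at z0 given by continuity *)
Definition local_value (m : Z) (z z0 : Cx) (gz : Cx) : Cext :=
  if excluded_middle_informative (z = z0) then
    match m with Z0 => Fin gz | Zpos _ => Fin Czero | Zneg _ => Inf end
  else Fin (Cmul (Cpowz (Csub z z0) m) gz).

Definition has_order_at (f : Cx -> Cext) (z0 : Cx) (m : Z) : Prop :=
  exists delta, delta > 0 /\ exists g : Cx -> Cx,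
    holomorphic_on_disk g z0 delta /\ g z0 <> Czero /\
    forall z, Cnorm (Csub z z0) < delta -> f z = local_value m z z0 (g z).

Definition meromorphic_on_C (f : Cx -> Cext) : Prop :=
  (forall z, f z = Fin Czero) \/ (forall z0, exists m : Z, has_order_at f z0 m).

Definition has_divisor (f : Cx -> Cext) (D : Cx -> Z) : Prop :=
  forall z0, has_order_at f z0 (D z0).

Definition normal_function (f : Cx -> Cext) : Prop :=
  forall h : nat -> Cx, exists phi : nat -> nat,
    (forall n, (phi n < phi (S n))%nat) /\
    forall Rad eps, Rad > 0 -> eps > 0 -> exists N : nat, forall n m, (N <= n)%nat -> (N <= m)%nat ->
      forall z, Cnorm z <= Rad ->
        rhoS (f (Cadd z (h (phi n)))) (f (Cadd z (h (phi m)))) < eps.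

(* Main.v *)
From Stdlib Require Import Reals Lra Lia ZArith List Classical ClassicalEpsilon ClassicalDescription FunctionalExtensionality.
From Coquelicot Require Import Rcomplements Rbar Hierarchy Lim_seq Series Derive RInt RInt_analysis Continuity AutoDerive.
Require Import Defs.
Open Scope R_scope.

(** Write mu for the signed measure sum_n delta_{a_n} - sum_n delta_{b_n}; every sum below is an integral against mu. By (b) an annulus of width O(1) and radius r carries O(r) points, so mu-sums over |z| < r and over |z - c| < r can be exchanged for kernels of size O(1/r^2) near the boundary, and sums of O(|z|^-3) converge absolutely.

By the definition of alpha and this exchange,
  f'/f (c) = - lim_r sum_{|z-c|<r} (1/(z-c) - conj(z-c)/r^2),
and an integration by parts in (e), centred at c, bounds the right-hand side by O(1) plus the contribution of the unit disc about c.

Similarly log |f(c)| = lim_r (K_r(0) - K_r(c)) with K_r(c) = sum_{|z-c|<r} (log(r/|z-c|) - (1 - |z-c|^2/r^2)/2): the terms of the two sides agree exactly up to |c|^2 mu(|z|<r)/(2 r^2) as long as z lies in both discs. K_r(c) is the average over the disc |w - c| < r of the Jensen integrals, so (d) bounds it up to the contribution of the unit disc about c.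

These two bounds and (a) show that, on discs of a fixed radius, f or 1/f has a bounded derivative, so f is Lipschitz into the sphere and the theorem of Arzela and Ascoli applies to its translates. *)

(** * Complex arithmetic *)

(** A logarithm of f has no continuous branch around the zeros and poles. [logF] adds up arbitrarily
    chosen branches; only its real part and its exponential are used, and weights 0, 1, -1 make the
    exponential independent of the choices. The product carries the linear Taylor terms z/a; the
    quadratic ones are not absolutely summable and are collected in a constant [B], which exists by
    (f).

    The integrals in (d) and (e) start at 1, so a point within distance 1 of c enters them as if at
    distance 1 ([rad]); the corrections are [log_dist_sum] and [inv_dist_sum]. The kernels vanish on
    the boundary circle, which makes the exchange of discs cheap. The leftover term mu(|z|<r)/r^2
    tends to 0 because comparing (d) at r and r + 1 gives mu(|z|<r) = O(r), where counting gives
    only O(r^2).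

    At a zero a the quotient f'/f grows like 1/|c-a|, but the bound for |f(c)| keeps the factor
    |c-a|, so f' stays bounded as long as the poles are at a definite distance. Near a pole the same
    argument is run for 1/f, that is for -mu, -[alpha], -[B]; (a) ensures that one of the two cases
    always applies. *)

Lemma Cx_eq (z w : Cx) : Re z = Re w -> Im z = Im w -> z = w.
Proof. destruct z, w; simpl; congruence. Qed.

Ltac cx := apply Cx_eq; simpl; try ring.

Lemma Cx_ring_theory :
  ring_theory Czero Cone Cadd Cmul Csub Copp (@eq Cx).
Proof. constructor; intros; unfold Csub; try reflexivity; cx. Qed.

Lemma Cx_sqnorm_pos (z : Cx) : z <> Czero -> 0 < Re z * Re z + Im z * Im z.
Proof.
intros Hz.
destruct (Req_dec (Re z) 0) as [H|H]; [destruct (Req_dec (Im z) 0) as [H'|H']|].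
- exfalso; apply Hz; apply Cx_eq; assumption.
- nra.
- nra.
Qed.

Lemma Cx_field_theory :
  field_theory Czero Cone Cadd Cmul Csub Copp Cdiv Cinv (@eq Cx).
Proof.
constructor.
- exact Cx_ring_theory.
- intros H. apply (f_equal Re) in H. simpl in H. lra.
- reflexivity.
- intros z Hz. assert (H := Cx_sqnorm_pos z Hz).
  apply Cx_eq; simpl; field; lra.
Qed.

Add Field Cx_field : Cx_field_theory.

Lemma Cnorm_ge0 (z : Cx) : 0 <= Cnorm z.
Proof. apply sqrt_pos. Qed.

Lemma Cnorm_sqr (z : Cx) : Cnorm z * Cnorm z = Re z * Re z + Im z * Im z.
Proof. unfold Cnorm. apply sqrt_sqrt. nra. Qed.

Lemma Cnorm_eq (z : Cx) (x : R) :
  0 <= x -> x * x = Re z * Re z + Im z * Im z -> Cnorm z = x.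
Proof. intros H0 H. unfold Cnorm. rewrite <- H. apply sqrt_square; exact H0. Qed.

Lemma Cnorm_0 : Cnorm Czero = 0.
Proof. apply Cnorm_eq; simpl; lra. Qed.

Lemma Cnorm_1 : Cnorm Cone = 1.
Proof. apply Cnorm_eq; simpl; lra. Qed.

Lemma Cnorm_eq0 (z : Cx) : Cnorm z = 0 -> z = Czero.
Proof.
intros H. destruct (classic (z = Czero)) as [|Hz]; [assumption|].
assert (H1 := Cx_sqnorm_pos z Hz). assert (H2 := Cnorm_sqr z). rewrite H in H2. lra.
Qed.

Lemma Cnorm_pos (z : Cx) : z <> Czero -> 0 < Cnorm z.
Proof.
intros H. destruct (Cnorm_ge0 z) as [|E]; [assumption|].
exfalso; apply H, Cnorm_eq0; symmetry; exact E.
Qed.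

Lemma Cnorm_neq0 (z : Cx) : 0 < Cnorm z -> z <> Czero.
Proof. intros H E. rewrite E, Cnorm_0 in H. lra. Qed.

Lemma Cnorm_mul (z w : Cx) : Cnorm (Cmul z w) = Cnorm z * Cnorm w.
Proof.
apply Cnorm_eq.
- apply Rmult_le_pos; apply Cnorm_ge0.
- replace (Cnorm z * Cnorm w * (Cnorm z * Cnorm w))
    with ((Cnorm z * Cnorm z) * (Cnorm w * Cnorm w)) by ring.
  rewrite !Cnorm_sqr. simpl. ring.
Qed.

Lemma Cnorm_opp (z : Cx) : Cnorm (Copp z) = Cnorm z.
Proof. unfold Cnorm; simpl; f_equal; ring. Qed.

Lemma Cnorm_conj (z : Cx) : Cnorm (Cconj z) = Cnorm z.
Proof. unfold Cnorm; simpl; f_equal; ring. Qed.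

Lemma Cnorm_sub_sym (z w : Cx) : Cnorm (Csub z w) = Cnorm (Csub w z).
Proof. unfold Cnorm; simpl; f_equal; ring. Qed.

Lemma Cnorm_RtoC (x : R) : Cnorm (RtoC x) = Rabs x.
Proof.
apply Cnorm_eq; [apply Rabs_pos|]. simpl.
rewrite <- Rabs_mult, Rabs_right; nra.
Qed.

Lemma Cnorm_inv (z : Cx) : z <> Czero -> Cnorm (Cinv z) = / Cnorm z.
Proof.
intros H. assert (H0 := Cnorm_pos z H).
apply Rmult_eq_reg_l with (Cnorm z); [|lra].
rewrite <- Cnorm_mul, Rinv_r by lra.
replace (Cmul z (Cinv z)) with Cone by (field; exact H). apply Cnorm_1.
Qed.

Lemma Cnorm_div (z w : Cx) : w <> Czero -> Cnorm (Cdiv z w) = Cnorm z / Cnorm w.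
Proof. intros H. unfold Cdiv. rewrite Cnorm_mul, Cnorm_inv by exact H. reflexivity. Qed.

Lemma Re_le_Cnorm (z : Cx) : Rabs (Re z) <= Cnorm z.
Proof.
apply Rsqr_incr_0; [|apply Rabs_pos|apply Cnorm_ge0].
rewrite <- Rsqr_abs. unfold Rsqr. rewrite Cnorm_sqr. nra.
Qed.

Lemma Im_le_Cnorm (z : Cx) : Rabs (Im z) <= Cnorm z.
Proof.
apply Rsqr_incr_0; [|apply Rabs_pos|apply Cnorm_ge0].
rewrite <- Rsqr_abs. unfold Rsqr. rewrite Cnorm_sqr. nra.
Qed.

Lemma Cnorm_le_ReIm (z : Cx) : Cnorm z <= Rabs (Re z) + Rabs (Im z).
Proof.
apply Rsqr_incr_0; [|apply Cnorm_ge0|pose proof (Rabs_pos (Re z)); pose proof (Rabs_pos (Im z)); lra].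
unfold Rsqr. rewrite Cnorm_sqr.
pose proof (Rabs_pos (Re z)). pose proof (Rabs_pos (Im z)).
assert (E1 : Re z * Re z = Rabs (Re z) * Rabs (Re z)) by (rewrite <- Rabs_mult, Rabs_right; nra).
assert (E2 : Im z * Im z = Rabs (Im z) * Rabs (Im z)) by (rewrite <- Rabs_mult, Rabs_right; nra).
rewrite E1, E2. nra.
Qed.

Lemma Cnorm_add (z w : Cx) : Cnorm (Cadd z w) <= Cnorm z + Cnorm w.
Proof.
pose proof (Cnorm_ge0 z). pose proof (Cnorm_ge0 w).
apply Rsqr_incr_0; [|apply Cnorm_ge0|lra].
unfold Rsqr. rewrite Cnorm_sqr.
assert (E : Re (Cmul z (Cconj w)) <= Cnorm z * Cnorm w).
{ rewrite <- (Cnorm_conj w), <- Cnorm_mul.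
  eapply Rle_trans; [apply Rle_abs|apply Re_le_Cnorm]. }
simpl in E. pose proof (Cnorm_sqr z). pose proof (Cnorm_sqr w). simpl. nra.
Qed.

Lemma Cnorm_sub_le (z w : Cx) : Cnorm (Csub z w) <= Cnorm z + Cnorm w.
Proof. unfold Csub. rewrite <- (Cnorm_opp w). apply Cnorm_add. Qed.

Lemma Cnorm_triangle_sub (x y z : Cx) :
  Cnorm (Csub x z) <= Cnorm (Csub x y) + Cnorm (Csub y z).
Proof.
replace (Csub x z) with (Cadd (Csub x y) (Csub y z)) by ring. apply Cnorm_add.
Qed.

Lemma Cnorm_sub_ge (z w : Cx) : Cnorm z - Cnorm w <= Cnorm (Csub z w).
Proof.
assert (H := Cnorm_add (Csub z w) w).
replace (Cadd (Csub z w) w) with z in H by ring. lra.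
Qed.

Lemma Cmul_eq0 (z w : Cx) : Cmul z w = Czero -> z = Czero \/ w = Czero.
Proof.
intros H. apply (f_equal Cnorm) in H. rewrite Cnorm_mul, Cnorm_0 in H.
destruct (Rmult_integral _ _ H); [left|right]; apply Cnorm_eq0; assumption.
Qed.

Lemma Csub_eq0 (z w : Cx) : Csub z w = Czero -> z = w.
Proof. intros H. replace z with (Cadd (Csub z w) w) by ring. rewrite H. ring. Qed.

Lemma Csub_neq0 (z w : Cx) : z <> w -> Csub z w <> Czero.
Proof. intros H E. apply H, Csub_eq0, E. Qed.

Lemma Cinv_0 : Cinv Czero = Czero.
Proof. apply Cx_eq; simpl; unfold Rdiv; ring. Qed.

Lemma Cinv_mul (z w : Cx) : Cinv (Cmul z w) = Cmul (Cinv z) (Cinv w).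
Proof.
destruct (classic (z = Czero)) as [->|Hz].
{ replace (Cmul Czero w) with Czero by ring. rewrite Cinv_0. ring. }
destruct (classic (w = Czero)) as [->|Hw].
{ replace (Cmul z Czero) with Czero by ring. rewrite Cinv_0. ring. }
field. split; assumption.
Qed.

(** * The complex exponential and its first Taylor remainders *)

Lemma Cexp_0 : Cexp Czero = Cone.
Proof. apply Cx_eq; simpl; rewrite exp_0, ?cos_0, ?sin_0; ring. Qed.

Lemma Cexp_add (z w : Cx) : Cexp (Cadd z w) = Cmul (Cexp z) (Cexp w).
Proof. apply Cx_eq; simpl; rewrite exp_plus, ?cos_plus, ?sin_plus; ring. Qed.

Lemma Cnorm_Cexp (z : Cx) : Cnorm (Cexp z) = exp (Re z).
Proof.
apply Cnorm_eq; [apply Rlt_le, exp_pos|]. simpl.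
pose proof (sin2_cos2 (Im z)) as H. unfold Rsqr in H.
replace (exp (Re z) * cos (Im z) * (exp (Re z) * cos (Im z)) +
  exp (Re z) * sin (Im z) * (exp (Re z) * sin (Im z)))
 with (exp (Re z) * exp (Re z) * (sin (Im z) * sin (Im z) + cos (Im z) * cos (Im z))) by ring.
rewrite H; ring.
Qed.

Lemma Cexp_neq0 (z : Cx) : Cexp z <> Czero.
Proof. apply Cnorm_neq0. rewrite Cnorm_Cexp. apply exp_pos. Qed.

Lemma Cexp_opp (z : Cx) : Cexp (Copp z) = Cinv (Cexp z).
Proof.
assert (H := Cexp_add z (Copp z)).
replace (Cadd z (Copp z)) with Czero in H by ring. rewrite Cexp_0 in H.
pose proof (Cexp_neq0 z).
replace (Cexp (Copp z)) with (Cmul (Cinv (Cexp z)) (Cmul (Cexp z) (Cexp (Copp z)))) by (field; assumption).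
rewrite <- H. ring.
Qed.

(** The complex Taylor estimates come from this bound, applied to the real and imaginary parts of a
    function along the segment t u, t in [0, 1]. *)
Lemma mean_value_bound (phi dphi : R -> R) (M : R) :
  (forall t, 0 <= t <= 1 -> is_derive phi t (dphi t)) ->
  (forall t, 0 <= t <= 1 -> Rabs (dphi t) <= M) ->
  Rabs (phi 1 - phi 0) <= M.
Proof.
intros Hd Hb.
destruct (MVT_gen phi 0 1 dphi) as [c [Hc E]].
- intros x. rewrite Rmin_left, Rmax_right by lra. intros. apply Hd; lra.
- intros x. rewrite Rmin_left, Rmax_right by lra. intros Hx.
  apply continuity_pt_filterlim, @ex_derive_continuous.
  exists (dphi x). apply Hd; lra.
- rewrite Rmin_left, Rmax_right in Hc by lra.
  rewrite E, Rminus_0_r, Rmult_1_r. apply Hb; lra.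
Qed.

Lemma exp_le_3_of_le1 (x : R) : x <= 1 -> exp x <= 3.
Proof.
intros H. apply Rle_trans with (exp 1); [|apply exp_le_3].
destruct H as [H|H]; [left; apply exp_increasing; exact H|rewrite H; lra].
Qed.

Lemma Rabs_mul_add_le (x y c d : R) (u : R) :
  Rabs x <= u -> Rabs y <= u -> Rabs (x * c + y * d) <= u * (Rabs c + Rabs d).
Proof.
intros Hx Hy. eapply Rle_trans; [apply Rabs_triang|]. rewrite !Rabs_mult.
pose proof (Rabs_pos c). pose proof (Rabs_pos d). nra.
Qed.

Lemma Rabs_cos_le (x : R) : Rabs (cos x) <= 1.
Proof. apply Rabs_le, COS_bound. Qed.

Lemma Rabs_sin_le (x : R) : Rabs (sin x) <= 1.
Proof. apply Rabs_le, SIN_bound. Qed.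

(** Each component of e^(t u) has t-derivative at most 3 (|Re u| + |Im u|) <= 6 |u|; the factor 12
    adds the two components. *)
Lemma Cexp_sub1_bound (u : Cx) :
  Cnorm u <= 1 -> Cnorm (Csub (Cexp u) Cone) <= 12 * Cnorm u.
Proof.
intros Hu. set (x := Re u). set (y := Im u).
assert (Hx := Re_le_Cnorm u : Rabs x <= _). assert (Hy := Im_le_Cnorm u : Rabs y <= _).
assert (B : forall t c d, 0 <= t <= 1 -> Rabs c <= 1 -> Rabs d <= 1 ->
   Rabs (exp (t * x) * (x * c + y * d)) <= 6 * Cnorm u).
{ intros t c d Ht Hc Hd. rewrite Rabs_mult, (Rabs_right (exp _)) by (left; apply exp_pos).
  assert (E : exp (t * x) <= 3).
  { apply exp_le_3_of_le1. apply Rabs_le_between in Hx. nra. }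
  pose proof (exp_pos (t * x)). pose proof (Rabs_mul_add_le x y c d _ Hx Hy).
  pose proof (Rabs_pos (x * c + y * d)). pose proof (Cnorm_ge0 u). nra. }
eapply Rle_trans; [apply Cnorm_le_ReIm|].
assert (B1 : Rabs (exp x * cos y - 1) <= 6 * Cnorm u).
{ assert (H := mean_value_bound (fun t => exp (t * x) * cos (t * y))
     (fun t => exp (t * x) * (x * cos (t * y) + y * (- sin (t * y)))) (6 * Cnorm u)).
  simpl in H. rewrite !Rmult_1_l, !Rmult_0_l, exp_0, cos_0, Rmult_1_r in H. apply H.
  - intros t Ht. auto_derive; [trivial|]. ring.
  - intros t Ht. apply B; [exact Ht|apply Rabs_cos_le|rewrite Rabs_Ropp; apply Rabs_sin_le]. }
assert (B2 : Rabs (exp x * sin y) <= 6 * Cnorm u).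
{ assert (H := mean_value_bound (fun t => exp (t * x) * sin (t * y))
     (fun t => exp (t * x) * (x * sin (t * y) + y * cos (t * y))) (6 * Cnorm u)).
  simpl in H. rewrite !Rmult_1_l, !Rmult_0_l, exp_0, sin_0, Rmult_0_r, Rminus_0_r in H. apply H.
  - intros t Ht. auto_derive; [trivial|]. ring.
  - intros t Ht. apply B; [exact Ht|apply Rabs_sin_le|apply Rabs_cos_le]. }
simpl. fold x y. replace (exp x * cos y + - (1)) with (exp x * cos y - 1) by ring.
replace (exp x * sin y + - 0) with (exp x * sin y) by ring. lra.
Qed.

(** The t-derivative of e^(t u) - 1 - t u is u (e^(t u) - 1), so the previous bound applies to it:
    24 = 2 * 12 for each component, and two components. *)
Lemma Cexp_taylor1_bound (u : Cx) :
  Cnorm u <= 1 -> Cnorm (Csub (Csub (Cexp u) Cone) u) <= 48 * (Cnorm u * Cnorm u).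
Proof.
intros Hu. set (x := Re u). set (y := Im u).
assert (Hx := Re_le_Cnorm u : Rabs x <= _). assert (Hy := Im_le_Cnorm u : Rabs y <= _).
assert (B : forall t, 0 <= t <= 1 ->
   Rabs (exp (t * x) * cos (t * y) - 1) <= 12 * Cnorm u /\
   Rabs (exp (t * x) * sin (t * y)) <= 12 * Cnorm u).
{ intros t Ht. set (v := mkCx (t * x) (t * y)).
  assert (Ev : Cnorm v = t * Cnorm u).
  { apply Cnorm_eq; [pose proof (Cnorm_ge0 u); nra|]. simpl. unfold x, y.
    replace (t * Cnorm u * (t * Cnorm u)) with (t * t * (Cnorm u * Cnorm u)) by ring.
    rewrite Cnorm_sqr. ring. }
  pose proof (Cnorm_ge0 u).
  assert (H1 := Cexp_sub1_bound v ltac:(rewrite Ev; nra)). rewrite Ev in H1.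
  assert (H2 := Re_le_Cnorm (Csub (Cexp v) Cone)). assert (H3 := Im_le_Cnorm (Csub (Cexp v) Cone)).
  simpl in H2, H3.
  replace (exp (t * x) * cos (t * y) + - (1)) with (exp (t * x) * cos (t * y) - 1) in H2 by ring.
  replace (exp (t * x) * sin (t * y) + - 0) with (exp (t * x) * sin (t * y)) in H3 by ring.
  split; nra. }
assert (B' : forall t p q, 0 <= t <= 1 -> Rabs p <= 12 * Cnorm u -> Rabs q <= 12 * Cnorm u ->
   Rabs (x * p + y * q) <= 24 * (Cnorm u * Cnorm u)).
{ intros t p q Ht Hp Hq. pose proof (Rabs_mul_add_le x y p q _ Hx Hy). pose proof (Cnorm_ge0 u). nra. }
eapply Rle_trans; [apply Cnorm_le_ReIm|].
assert (B1 : Rabs (exp x * cos y - 1 - x) <= 24 * (Cnorm u * Cnorm u)).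
{ assert (H := mean_value_bound (fun t => exp (t * x) * cos (t * y) - t * x)
     (fun t => x * (exp (t * x) * cos (t * y) - 1) + y * (- (exp (t * x) * sin (t * y))))
     (24 * (Cnorm u * Cnorm u))).
  simpl in H. rewrite !Rmult_1_l, !Rmult_0_l, exp_0, cos_0, Rmult_1_r, Rminus_0_r in H.
  replace (exp x * cos y - 1 - x) with (exp x * cos y - x - 1) by ring. apply H.
  - intros t Ht. auto_derive; [trivial|]. ring.
  - intros t Ht. destruct (B t Ht). apply B' with t; trivial. rewrite Rabs_Ropp; trivial. }
assert (B2 : Rabs (exp x * sin y - y) <= 24 * (Cnorm u * Cnorm u)).
{ assert (H := mean_value_bound (fun t => exp (t * x) * sin (t * y) - t * y)
     (fun t => x * (exp (t * x) * sin (t * y)) + y * (exp (t * x) * cos (t * y) - 1))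
     (24 * (Cnorm u * Cnorm u))).
  simpl in H. rewrite !Rmult_1_l, !Rmult_0_l, exp_0, sin_0, Rmult_0_r in H.
  replace (exp x * sin y - y) with (exp x * sin y - y - (0 - 0)) by ring. apply H.
  - intros t Ht. auto_derive; [trivial|]. ring.
  - intros t Ht. destruct (B t Ht). apply B' with t; trivial. }
simpl. fold x y. replace (exp x * cos y + - (1) + - x) with (exp x * cos y - 1 - x) by ring.
replace (exp x * sin y + - 0 + - y) with (exp x * sin y - y) by ring. lra.
Qed.

(** * The logarithm and its Taylor remainder *)

Lemma polar_form (w : Cx) : exists theta, - PI <= theta <= PI /\
  Re w = Cnorm w * cos theta /\ Im w = Cnorm w * sin theta.
Proof.
destruct (classic (w = Czero)) as [->|Hw].
{ exists 0. rewrite Cnorm_0. pose proof PI_RGT_0. simpl. lra. }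
assert (H0 := Cnorm_pos w Hw). assert (H1 := Cnorm_sqr w).
set (c := Re w / Cnorm w).
assert (Ec : Re w = Cnorm w * c) by (unfold c; field; lra).
assert (Hc : -1 <= c <= 1).
{ apply Rabs_le_between. unfold c, Rdiv. rewrite Rabs_mult, Rabs_inv, (Rabs_right (Cnorm w)) by lra.
  apply Rmult_le_reg_r with (Cnorm w); [lra|]. rewrite Rmult_assoc, Rinv_l by lra.
  pose proof (Re_le_Cnorm w). lra. }
assert (Hs : sin (acos c) * Cnorm w = Rabs (Im w)).
{ rewrite sin_acos by exact Hc.
  rewrite <- (Rabs_right (Cnorm w)) by lra. rewrite <- (Rabs_right (sqrt _)) by (apply Rle_ge, sqrt_pos).
  rewrite <- Rabs_mult. apply Rsqr_eq_abs_0. unfold Rsqr.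
  replace (sqrt (1 - c * c) * Cnorm w * (sqrt (1 - c * c) * Cnorm w)) with
   ((sqrt (1 - c * c) * sqrt (1 - c * c)) * (Cnorm w * Cnorm w)) by ring.
  rewrite sqrt_sqrt by nra.
  replace ((1 - c * c) * (Cnorm w * Cnorm w)) with
     (Cnorm w * Cnorm w - (Cnorm w * c) * (Cnorm w * c)) by ring.
  rewrite <- Ec, H1. ring. }
assert (Hb := acos_bound c).
destruct (Rle_dec 0 (Im w)) as [Hi|Hi].
- exists (acos c). rewrite cos_acos by exact Hc. rewrite Rabs_right in Hs by lra.
  repeat split; lra.
- exists (- acos c). rewrite cos_neg, sin_neg, cos_acos by exact Hc.
  rewrite Rabs_left in Hs by lra. repeat split; lra.
Qed.

(* On the right half-plane the branch is fixed to be the principal one; elsewhere any argument will do, since only [Cexp (Clog w) = w] is used there. *)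
Definition Carg (w : Cx) : R :=
  if Rlt_dec 0 (Re w) then atan (Im w / Re w)
  else proj1_sig (constructive_indefinite_description _ (polar_form w)).

Definition Clog (w : Cx) : Cx := mkCx (ln (Cnorm w)) (Carg w).

Lemma Cexp_Clog (w : Cx) : w <> Czero -> Cexp (Clog w) = w.
Proof.
intros Hw. assert (H0 := Cnorm_pos w Hw).
assert (H : Re w = Cnorm w * cos (Carg w) /\ Im w = Cnorm w * sin (Carg w)).
{ unfold Carg. destruct (Rlt_dec 0 (Re w)) as [Hr|Hr].
  - rewrite cos_atan, sin_atan.
    assert (E : Cnorm w = Re w * sqrt (1 + (Im w / Re w)²)).
    { apply Cnorm_eq; [apply Rmult_le_pos; [lra|apply sqrt_pos]|].
      replace (Re w * sqrt (1 + (Im w / Re w)²) * (Re w * sqrt (1 + (Im w / Re w)²))) with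
       (Re w * Re w * (sqrt (1 + (Im w / Re w)²) * sqrt (1 + (Im w / Re w)²))) by ring.
      rewrite sqrt_sqrt by (unfold Rsqr; nra). unfold Rsqr. field. lra. }
    assert (0 < sqrt (1 + (Im w / Re w)²)) by (apply sqrt_lt_R0; unfold Rsqr; nra).
    rewrite E. split; field; lra.
  - exact (proj2 (proj2_sig (constructive_indefinite_description _ (polar_form w)))). }
destruct H as [H1 H2].
apply Cx_eq; simpl; rewrite exp_ln by exact H0; congruence.
Qed.

Definition Clog1m (x : Cx) : Cx := Clog (Csub Cone x).

Lemma Cexp_Clog1m (x : Cx) : x <> Cone -> Cexp (Clog1m x) = Csub Cone x.
Proof.
intros H. apply Cexp_Clog. intros E. apply H. symmetry. apply Csub_eq0, E.
Qed.

(** The logarithm of the Weierstrass primary factor of genus 2. The product of the theorem uses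
    genus 1; the extra quadratic term makes the sums converge absolutely and is compensated by the
    constant [B] in [logF]. *)
Definition Clog_rem (x : Cx) : Cx :=
  Cadd (Clog1m x) (Cadd x (Cmul (RtoC (1/2)) (Cmul x x))).

Lemma ln_sqrt_half (x : R) : 0 < x -> ln (sqrt x) = / 2 * ln x.
Proof.
intros H. assert (H' := sqrt_lt_R0 x H).
rewrite <- (sqrt_sqrt x) at 2 by lra. rewrite ln_mult by exact H'. lra.
Qed.

(* The derivative of t |-> Clog_rem (t x) is - t^2 x^3 / (1 - t x). *)
Lemma Clog_rem_bound (x : Cx) :
  Cnorm x <= 1/2 -> Cnorm (Clog_rem x) <= 4 * Cnorm x ^ 3.
Proof.
intros Hx. destruct x as [p q].
assert (Hp := Re_le_Cnorm (mkCx p q)). simpl in Hp.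
assert (Hp' : - (1/2) <= p <= 1/2) by (apply Rabs_le_between; lra).
set (d := fun t => Cdiv (Cmul (RtoC (- (t * t))) (Cpow (mkCx p q) 3)) (Csub Cone (mkCx (t * p) (t * q)))).
assert (Hd : forall t, 0 <= t <= 1 -> Cnorm (d t) <= 2 * Cnorm (mkCx p q) ^ 3).
{ intros t Ht.
  assert (Hn : Cnorm (Csub Cone (mkCx (t * p) (t * q))) >= 1/2).
  { apply Rle_ge. apply Rle_trans with (Rabs (Re (Csub Cone (mkCx (t * p) (t * q))))); [|apply Re_le_Cnorm].
    simpl. apply Rle_trans with (1 + - (t * p)); [nra|apply Rle_abs]. }
  unfold d. rewrite Cnorm_div by (apply Cnorm_neq0; lra).
  rewrite Cnorm_mul, Cnorm_RtoC. simpl Cpow. rewrite !Cnorm_mul, Cnorm_1.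
  rewrite Rabs_Ropp, Rabs_right by nra.
  set (N := Cnorm (mkCx p q)). assert (0 <= N) by apply Cnorm_ge0.
  assert (0 <= N * N * N) by (repeat apply Rmult_le_pos; assumption).
  apply Rle_div_l; [lra|].
  replace (t * t * (N * (N * (N * 1)))) with ((t * t) * (N * N * N)) by ring.
  replace (N ^ 3) with (N * N * N) by ring.
  apply Rle_trans with (N * N * N); [|nra].
  rewrite <- (Rmult_1_l (N * N * N)) at 2. apply Rmult_le_compat_r; nra. }
assert (Hre : Rabs (Re (Clog_rem (mkCx p q))) <= 2 * Cnorm (mkCx p q) ^ 3).
{ assert (H := mean_value_bound (fun t => / 2 * ln ((1 - t * p) * (1 - t * p) + (t * q) * (t * q)) + t * p
     + t * t / 2 * (p * p - q * q)) (fun t => Re (d t)) (2 * Cnorm (mkCx p q) ^ 3)).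
  cbv beta in H.
  replace (Re (Clog_rem (mkCx p q))) with
    (/ 2 * ln ((1 - 1 * p) * (1 - 1 * p) + 1 * q * (1 * q)) + 1 * p + 1 * 1 / 2 * (p * p - q * q) -
    (/ 2 * ln ((1 - 0 * p) * (1 - 0 * p) + 0 * q * (0 * q)) + 0 * p + 0 * 0 / 2 * (p * p - q * q))).
  - apply H.
    + intros t Ht. auto_derive; [nra|]. simpl. field. nra.
    + intros t Ht. eapply Rle_trans; [apply Re_le_Cnorm|apply Hd, Ht].
  - replace ((1 - 0 * p) * (1 - 0 * p) + 0 * q * (0 * q)) with 1 by ring. rewrite ln_1.
    simpl. unfold Cnorm. rewrite ln_sqrt_half by (simpl; nra). simpl.
    replace ((1 - 1 * p) * (1 - 1 * p) + 1 * q * (1 * q)) with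
      ((1 + - p) * (1 + - p) + (0 + - q) * (0 + - q)) by ring. field. }
assert (Him : Rabs (Im (Clog_rem (mkCx p q))) <= 2 * Cnorm (mkCx p q) ^ 3).
{ assert (H := mean_value_bound (fun t => atan (- (t * q) / (1 - t * p)) + t * q + t * t * p * q)
     (fun t => Im (d t)) (2 * Cnorm (mkCx p q) ^ 3)).
  cbv beta in H.
  replace (Im (Clog_rem (mkCx p q))) with
    (atan (- (1 * q) / (1 - 1 * p)) + 1 * q + 1 * 1 * p * q -
     (atan (- (0 * q) / (1 - 0 * p)) + 0 * q + 0 * 0 * p * q)).
  - apply H.
    + intros t Ht. auto_derive; [nra|]. simpl. unfold Rsqr. field. repeat split; nra.
    + intros t Ht. eapply Rle_trans; [apply Im_le_Cnorm|apply Hd, Ht].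
  - replace (- (0 * q) / (1 - 0 * p)) with 0 by (unfold Rdiv; ring). rewrite atan_0.
    unfold Clog_rem, Clog1m, Clog, Carg. simpl.
    (* |x| <= 1/2 keeps 1 - x in the right half-plane, where [Carg] is the arctangent that was
       differentiated above. *)
    destruct (Rlt_dec 0 (1 + - p)) as [_|E]; [|exfalso; lra].
    replace (- (1 * q) / (1 - 1 * p)) with ((0 + - q) / (1 + - p)) by (field; lra). field. }
eapply Rle_trans; [apply Cnorm_le_ReIm|]. lra.
Qed.

(** * Limits at infinity and integration against a discrete signed measure *)

Definition tends (f : R -> R) (l : R) : Prop :=
  forall eps, eps > 0 -> exists R0, forall r, r > R0 -> Rabs (f r - l) < eps.

Lemma tends_squeeze (f g : R -> R) (l R0 : R) :
  (forall r, r > R0 -> Rabs (f r - l) <= g r) -> tends g 0 -> tends f l.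
Proof.
intros H Hg eps He. destruct (Hg eps He) as [R1 H1].
exists (Rmax R0 R1). intros r Hr.
assert (H2 := H r (Rle_lt_trans _ _ _ (Rmax_l _ _) Hr)).
assert (H3 := H1 r (Rle_lt_trans _ _ _ (Rmax_r _ _) Hr)).
rewrite Rminus_0_r in H3. apply Rabs_def2 in H3. lra.
Qed.

Lemma tends_eventually_eq (f g : R -> R) (l R0 : R) :
  (forall r, r > R0 -> f r = g r) -> tends g l -> tends f l.
Proof.
intros H Hg eps He. destruct (Hg eps He) as [R1 H1].
exists (Rmax R0 R1). intros r Hr.
rewrite (H r (Rle_lt_trans _ _ _ (Rmax_l _ _) Hr)).
apply (H1 r (Rle_lt_trans _ _ _ (Rmax_r _ _) Hr)).
Qed.

Lemma tends_const (l : R) : tends (fun _ => l) l.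
Proof. intros eps He. exists 0. intros. rewrite Rminus_diag, Rabs_R0. exact He. Qed.

Lemma tends_plus (f g : R -> R) (l m : R) :
  tends f l -> tends g m -> tends (fun r => f r + g r) (l + m).
Proof.
intros Hf Hg eps He. destruct (Hf (eps / 2)) as [R0 H0]; [lra|]. destruct (Hg (eps / 2)) as [R1 H1]; [lra|].
exists (Rmax R0 R1). intros r Hr.
assert (H2 := H0 r (Rle_lt_trans _ _ _ (Rmax_l _ _) Hr)).
assert (H3 := H1 r (Rle_lt_trans _ _ _ (Rmax_r _ _) Hr)).
apply Rabs_def2 in H2. apply Rabs_def2 in H3. apply Rabs_def1; lra.
Qed.

Lemma tends_scal (f : R -> R) (l k : R) : tends f l -> tends (fun r => k * f r) (k * l).
Proof.
intros Hf eps He. destruct (Hf (eps / (Rabs k + 1))) as [R0 H0].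
{ apply Rdiv_lt_0_compat; [lra|]. pose proof (Rabs_pos k); lra. }
exists R0. intros r Hr. assert (H1 := H0 r Hr).
rewrite <- Rmult_minus_distr_l, Rabs_mult. pose proof (Rabs_pos k). pose proof (Rabs_pos (f r - l)).
apply Rlt_div_r in H1; [|lra]. nra.
Qed.

Lemma tends_minus (f g : R -> R) (l m : R) :
  tends f l -> tends g m -> tends (fun r => f r - g r) (l - m).
Proof.
intros Hf Hg. replace (l - m) with (l + (-1) * m) by ring.
apply (tends_eventually_eq _ (fun r => f r + (-1) * g r) _ 0); [intros; ring|].
apply tends_plus; [exact Hf|apply tends_scal, Hg].
Qed.

Lemma tends_div_r (k : R) : tends (fun r => k / r) 0.
Proof.
intros eps He. exists (Rabs k / eps). intros r Hr. rewrite Rminus_0_r.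
pose proof (Rabs_pos k).
assert (0 <= Rabs k / eps) by (apply Rdiv_le_0_compat; lra).
unfold Rdiv. rewrite Rabs_mult, Rabs_inv, (Rabs_right r) by lra.
apply Rlt_div_l; [lra|]. apply Rlt_div_l in Hr; [|lra]. lra.
Qed.

Lemma tends_unique (f : R -> R) (l m : R) : tends f l -> tends f m -> l = m.
Proof.
intros H1 H2. destruct (Req_dec l m) as [|E]; [assumption|exfalso].
assert (Hp : 0 < Rabs (l - m)) by (apply Rabs_pos_lt; lra).
destruct (H1 (Rabs (l - m) / 2)) as [R0 A]; [lra|]. destruct (H2 (Rabs (l - m) / 2)) as [R1 B]; [lra|].
assert (A' := A (Rmax R0 R1 + 1)). assert (B' := B (Rmax R0 R1 + 1)).
pose proof (Rmax_l R0 R1). pose proof (Rmax_r R0 R1).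
specialize (A' ltac:(lra)). specialize (B' ltac:(lra)).
set (y := f (Rmax R0 R1 + 1)) in *.
assert (Rabs (l - m) <= Rabs (y - m) + Rabs (y - l)); [|lra].
replace (l - m) with ((y - m) - (y - l)) by ring.
eapply Rle_trans; [apply Rabs_triang|]. rewrite Rabs_Ropp. lra.
Qed.

Lemma tends_le (f : R -> R) (l k R0 : R) :
  tends f l -> (forall r, r > R0 -> Rabs (f r) <= k) -> Rabs l <= k.
Proof.
intros Hf H. apply Rnot_lt_le. intros Hl.
destruct (Hf (Rabs l - k)) as [R1 H1]; [lra|].
pose proof (Rmax_l R0 R1). pose proof (Rmax_r R0 R1).
set (r := Rmax R0 R1 + 1). assert (A := H1 r ltac:(unfold r; lra)). assert (B := H r ltac:(unfold r; lra)).
assert (Rabs l <= Rabs (f r) + Rabs (f r - l)); [|lra].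
replace l with (f r - (f r - l)) at 1 by ring.
eapply Rle_trans; [apply Rabs_triang|]. rewrite Rabs_Ropp. lra.
Qed.

(** The limit is found along the integers, shifted by 1 so that the hypothesis applies from n = 0
    on; the rate K / r1 then carries it over to real r. *)
Lemma tends_cauchy (f : R -> R) (K : R) :
  (forall r1 r2, 1 <= r1 <= r2 -> Rabs (f r2 - f r1) <= K / r1) -> exists l, tends f l.
Proof.
intros H.
assert (HK : 0 <= K).
{ assert (A := H 1 1 ltac:(lra)). rewrite Rminus_diag, Rabs_R0 in A. lra. }
assert (HC : Cauchy_crit (fun n => f (INR n + 1))).
{ intros eps He. destruct (archimed_cor1 (eps / (K + 1))) as [N [HN HN0]]; [apply Rdiv_lt_0_compat; lra|].
  assert (HN1 : 0 < INR N) by (apply lt_0_INR; lia).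
  assert (HKN : K / INR N < eps).
  { apply Rlt_div_l; [exact HN1|]. apply Rlt_div_r in HN; [|lra].
    apply Rmult_lt_compat_r with (r := INR N) in HN; [|exact HN1].
    replace (/ INR N * (K + 1) * INR N) with (K + 1) in HN by (field; lra). lra. }
  assert (W : forall n m, (n <= m)%nat -> (N <= n)%nat -> Rabs (f (INR m + 1) - f (INR n + 1)) < eps).
  { intros n m Hnm HNn. apply le_INR in Hnm. apply le_INR in HNn.
    apply Rle_lt_trans with (K / (INR n + 1)); [apply H; lra|].
    apply Rle_lt_trans with (K / INR N); [|exact HKN].
    apply Rmult_le_compat_l; [exact HK|]. apply Rinv_le_contravar; lra. }
  exists N. intros n m Hn Hm. unfold Rdist.
  destruct (Nat.le_ge_cases n m); [rewrite Rabs_minus_sym|]; apply W; assumption. }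
destruct (Rcomplete.R_complete _ HC) as [l Hl].
exists l. intros eps He.
exists (Rmax 1 (2 * K / eps)). intros r Hr.
assert (H1 := Rle_lt_trans _ _ _ (Rmax_l _ _) Hr). assert (H2 := Rle_lt_trans _ _ _ (Rmax_r _ _) Hr).
destruct (Hl (eps / 2)) as [N HN]; [lra|].
destruct (INR_unbounded r) as [M HM].
set (n := Nat.max N M). assert (HNn := HN n ltac:(unfold n; lia)). unfold Rdist in HNn.
assert (HMn : INR M <= INR n) by (apply le_INR; unfold n; lia).
assert (A := H r (INR n + 1) ltac:(lra)).
assert (K / r < eps / 2).
{ apply Rlt_div_l; [lra|]. apply Rlt_div_l in H2; lra. }
apply Rabs_le_between in A. apply Rabs_def2 in HNn. apply Rabs_def1; lra.
Qed.

Lemma Clim_infty_iff (F : R -> Cx) (L : Cx) :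
  Clim_infty F L <-> tends (fun r => Re (F r)) (Re L) /\ tends (fun r => Im (F r)) (Im L).
Proof.
split.
- intros H. split; intros eps He; destruct (H eps He) as [R0 H0]; exists R0; intros r Hr;
    (eapply Rle_lt_trans; [|apply (H0 r Hr)]).
  + apply (Re_le_Cnorm (Csub (F r) L)).
  + apply (Im_le_Cnorm (Csub (F r) L)).
- intros [H1 H2] eps He. destruct (H1 (eps / 2)) as [R0 A]; [lra|]. destruct (H2 (eps / 2)) as [R1 B]; [lra|].
  exists (Rmax R0 R1). intros r Hr.
  assert (A' := A r (Rle_lt_trans _ _ _ (Rmax_l _ _) Hr)).
  assert (B' := B r (Rle_lt_trans _ _ _ (Rmax_r _ _) Hr)).
  eapply Rle_lt_trans; [apply Cnorm_le_ReIm|]. simpl. unfold Rminus in *. lra.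
Qed.

Lemma Clim_infty_add (F G : R -> Cx) (L M : Cx) :
  Clim_infty F L -> Clim_infty G M -> Clim_infty (fun r => Cadd (F r) (G r)) (Cadd L M).
Proof. rewrite !Clim_infty_iff. intros [] []; split; simpl; apply tends_plus; assumption. Qed.

Lemma Clim_infty_const (L : Cx) : Clim_infty (fun _ => L) L.
Proof. apply Clim_infty_iff; split; apply tends_const. Qed.

Lemma Clim_infty_mul_l (c : Cx) (F : R -> Cx) (L : Cx) :
  Clim_infty F L -> Clim_infty (fun r => Cmul c (F r)) (Cmul c L).
Proof.
rewrite !Clim_infty_iff. intros []; split; simpl.
- apply tends_minus; apply tends_scal; assumption.
- apply tends_plus; apply tends_scal; assumption.
Qed.

Lemma Clim_infty_eventually_eq (F G : R -> Cx) (L : Cx) (R0 : R) :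
  (forall r, r > R0 -> F r = G r) -> Clim_infty G L -> Clim_infty F L.
Proof.
rewrite !Clim_infty_iff. intros H [H1 H2].
split.
- apply (tends_eventually_eq _ (fun r => Re (G r)) _ R0); [intros r Hr; rewrite H; auto|exact H1].
- apply (tends_eventually_eq _ (fun r => Im (G r)) _ R0); [intros r Hr; rewrite H; auto|exact H2].
Qed.

Lemma Clim_infty_unique (F : R -> Cx) (L M : Cx) : Clim_infty F L -> Clim_infty F M -> L = M.
Proof.
rewrite !Clim_infty_iff. intros [] []. apply Cx_eq; eapply tends_unique; eassumption.
Qed.

Lemma Clim_infty_exp (F : R -> Cx) (L : Cx) :
  Clim_infty F L -> Clim_infty (fun r => Cexp (F r)) (Cexp L).
Proof.
intros H eps He.
assert (HL : 0 < Cnorm (Cexp L)) by (rewrite Cnorm_Cexp; apply exp_pos).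
destruct (H (Rmin 1 (eps / (12 * Cnorm (Cexp L))))) as [R0 H0].
{ apply Rmin_pos; [lra|]. apply Rdiv_lt_0_compat; lra. }
exists R0. intros r Hr. assert (H1 := H0 r Hr).
assert (A := Rlt_le_trans _ _ _ H1 (Rmin_l _ _)). assert (B := Rlt_le_trans _ _ _ H1 (Rmin_r _ _)).
replace (Csub (Cexp (F r)) (Cexp L)) with (Cmul (Cexp L) (Csub (Cexp (Csub (F r) L)) Cone)).
- rewrite Cnorm_mul. assert (E := Cexp_sub1_bound (Csub (F r) L) ltac:(lra)).
  apply Rlt_div_r in B; [|lra]. nra.
- replace (F r) with (Cadd L (Csub (F r) L)) at 2 by ring. rewrite Cexp_add. ring.
Qed.

(** * Indicators, finite partial sums and sums against a signed measure *)

Definition ind (P : Prop) : R := if excluded_middle_informative P then 1 else 0.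

Lemma ind_true (P : Prop) : P -> ind P = 1.
Proof. intros H. unfold ind. destruct excluded_middle_informative; tauto. Qed.

Lemma ind_false (P : Prop) : ~ P -> ind P = 0.
Proof. intros H. unfold ind. destruct excluded_middle_informative; tauto. Qed.

Lemma ind_iff (P Q : Prop) : (P <-> Q) -> ind P = ind Q.
Proof. intros H. unfold ind. do 2 destruct excluded_middle_informative; tauto. Qed.

Lemma ind_bounds (P : Prop) : 0 <= ind P <= 1.
Proof. unfold ind. destruct excluded_middle_informative; lra. Qed.

Fixpoint psum (x : nat -> R) (N : nat) : R :=
  match N with O => 0 | S k => psum x k + x k end.

Lemma psum_ext (x y : nat -> R) (N : nat) :
  (forall n, (n < N)%nat -> x n = y n) -> psum x N = psum y N.
Proof.
induction N as [|N IH]; intros H; simpl; [reflexivity|].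
rewrite IH, H; [reflexivity|lia|intros; apply H; lia].
Qed.

Lemma psum_scal (k : R) (x : nat -> R) (N : nat) : psum (fun n => k * x n) N = k * psum x N.
Proof. induction N as [|N IH]; simpl; [|rewrite IH]; ring. Qed.

Lemma psum_plus (x y : nat -> R) (N : nat) : psum (fun n => x n + y n) N = psum x N + psum y N.
Proof. induction N as [|N IH]; simpl; [|rewrite IH]; ring. Qed.

Lemma psum_le (x y : nat -> R) (N : nat) : (forall n, x n <= y n) -> psum x N <= psum y N.
Proof. intros H. induction N as [|N IH]; simpl; [lra|]. specialize (H N). lra. Qed.

Lemma psum_ge0 (x : nat -> R) (N : nat) : (forall n, 0 <= x n) -> 0 <= psum x N.
Proof. intros H. induction N as [|N IH]; simpl; [lra|]. specialize (H N). lra. Qed.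

Lemma psum_zero (N : nat) : psum (fun _ => 0) N = 0.
Proof. induction N as [|N IH]; simpl; [|rewrite IH]; ring. Qed.

Lemma psum_exchange (x : nat -> nat -> R) (N M : nat) :
  psum (fun n => psum (fun j => x n j) M) N = psum (fun j => psum (fun n => x n j) N) M.
Proof.
induction N as [|N IH]; simpl; [symmetry; apply psum_zero|].
rewrite IH, <- psum_plus. reflexivity.
Qed.

Lemma psum_sum_n (x : nat -> R) (N : nat) : sum_n x N = psum x (S N).
Proof.
induction N as [|N IH]; [rewrite sum_O; simpl; ring|].
rewrite sum_Sn, IH. reflexivity.
Qed.

Lemma is_series_psum (x : nat -> R) (l : R) : is_series x l -> is_lim_seq (fun n => psum x (S n)) l.
Proof.
intros H. apply (is_lim_seq_ext (sum_n x)); [apply psum_sum_n|]. exact H.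
Qed.

Lemma psum_stable (x : nat -> R) (N M : nat) :
  (N <= M)%nat -> (forall n, (N <= n)%nat -> x n = 0) -> psum x M = psum x N.
Proof.
intros HNM H. induction HNM as [|M HM IH]; [reflexivity|].
simpl. rewrite IH, H; [ring|exact HM].
Qed.

Lemma psum_term_le (x : nat -> R) (N n : nat) :
  (forall k, 0 <= x k) -> (n < N)%nat -> x n <= psum x N.
Proof.
intros H. induction N as [|N IH]; intros Hn; [lia|]. simpl.
destruct (Nat.eq_dec n N) as [->|E].
- pose proof (psum_ge0 x N H). lra.
- pose proof (H N). specialize (IH ltac:(lia)). lra.
Qed.

Lemma is_series_finite (x : nat -> R) (N : nat) :
  (forall n, (N <= n)%nat -> x n = 0) -> is_series x (psum x N).
Proof.
intros H. apply filterlim_ext_loc with (fun _ => psum x N).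
- exists N. intros n Hn. rewrite psum_sum_n. symmetry. apply psum_stable; [lia|exact H].
- apply filterlim_const.
Qed.

Lemma ex_series_nonneg_bounded (x : nat -> R) (M : R) :
  (forall n, 0 <= x n) -> (forall N, psum x N <= M) -> ex_series x.
Proof.
intros H0 HM.
destruct (ex_finite_lim_seq_incr (fun n => psum x (S n)) M) as [l Hl].
- intros n. simpl. specialize (H0 (S n)). lra.
- intros n. apply HM.
- exists l. apply (is_lim_seq_ext _ _ _ (fun n => eq_sym (psum_sum_n x n)) Hl).
Qed.

Lemma psum_le_Series (x : nat -> R) (N : nat) :
  (forall n, 0 <= x n) -> ex_series x -> psum x N <= Series x.
Proof.
intros H0 Hx. set (y := fun n => if Nat.ltb n N then x n else 0).
replace (psum x N) with (psum y N).
- assert (Hy : forall n, (N <= n)%nat -> y n = 0).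
  { intros n Hn. unfold y. destruct (Nat.ltb_spec n N); [lia|reflexivity]. }
  rewrite <- (is_series_unique _ _ (is_series_finite y N Hy)).
  apply Series_le; [|exact Hx]. intros n. unfold y. destruct (Nat.ltb n N); specialize (H0 n); lra.
- apply psum_ext. intros n Hn. unfold y. destruct (Nat.ltb_spec n N); [reflexivity|lia].
Qed.

(* (sigma, s) encodes the measure sum_n sigma_n delta_{s n}. *)
Definition sint (sigma : nat -> R) (s : nat -> Cx) (F : Cx -> R) : R :=
  Series (fun n => sigma n * F (s n)).

Definition sintC (sigma : nat -> R) (s : nat -> Cx) (F : Cx -> Cx) : Cx :=
  mkCx (sint sigma s (fun z => Re (F z))) (sint sigma s (fun z => Im (F z))).

(** [Series] returns a value even for a divergent series, so additivity of [sint] needs this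
    absolute convergence. *)
Definition integrable (sigma : nat -> R) (s : nat -> Cx) (F : Cx -> R) : Prop :=
  ex_series (fun n => Rabs (sigma n * F (s n))).

Definition absw (sigma : nat -> R) (n : nat) : R := Rabs (sigma n).

Lemma absw_ge0 (sigma : nat -> R) (n : nat) : 0 <= absw sigma n.
Proof. apply Rabs_pos. Qed.

Definition supp (sigma : nat -> R) (s : nat -> Cx) (z : Cx) : Prop :=
  exists n, sigma n <> 0 /\ s n = z.

(** Points of weight 0 may accumulate; this lets the weights absorb the index sets of the zeros and
    poles. *)
Definition loc_finite (sigma : nat -> R) (s : nat -> Cx) : Prop :=
  forall r, exists N, forall n, (N <= n)%nat -> Cnorm (s n) <= r -> sigma n = 0.

Lemma sint_ext (sigma : nat -> R) (s : nat -> Cx) (F G : Cx -> R) :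
  (forall z, supp sigma s z -> F z = G z) -> sint sigma s F = sint sigma s G.
Proof.
intros H. apply Series_ext. intros n.
destruct (Req_dec (sigma n) 0) as [->|E]; [ring|].
rewrite (H (s n)); [reflexivity|]. exists n; auto.
Qed.

Lemma integrable_le (sigma : nat -> R) (s : nat -> Cx) (F G : Cx -> R) :
  (forall z, supp sigma s z -> Rabs (F z) <= Rabs (G z)) ->
  integrable sigma s G -> integrable sigma s F.
Proof.
intros H HG. apply (@ex_series_le _ R_CompleteNormedModule) with (2 := HG). intros n.
unfold norm; simpl. unfold abs; simpl. rewrite Rabs_Rabsolu, !Rabs_mult.
destruct (Req_dec (sigma n) 0) as [->|E]; [rewrite Rabs_R0; lra|].
apply Rmult_le_compat_l; [apply Rabs_pos|]. apply H. exists n; auto.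
Qed.

Lemma integrable_absw (sigma : nat -> R) (s : nat -> Cx) (F : Cx -> R) :
  integrable (absw sigma) s F <-> integrable sigma s F.
Proof.
unfold integrable, absw.
split; apply ex_series_ext; intros n; rewrite !Rabs_mult, Rabs_Rabsolu; reflexivity.
Qed.

Lemma integrable_plus (sigma : nat -> R) (s : nat -> Cx) (F G : Cx -> R) :
  integrable sigma s F -> integrable sigma s G -> integrable sigma s (fun z => F z + G z).
Proof.
intros HF HG.
assert (H := @ex_series_plus _ R_NormedModule _ _ HF HG).
apply (@ex_series_le _ R_CompleteNormedModule) with (2 := H). intros n.
unfold norm, plus; simpl. unfold abs; simpl.
rewrite Rabs_Rabsolu, Rmult_plus_distr_l. apply Rabs_triang.
Qed.

Lemma integrable_scal (sigma : nat -> R) (s : nat -> Cx) (k : R) (F : Cx -> R) :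
  integrable sigma s F -> integrable sigma s (fun z => k * F z).
Proof.
intros HF. assert (H := ex_series_scal_r (Rabs k) _ HF).
revert H. apply ex_series_ext. intros n. rewrite <- Rabs_mult. f_equal. ring.
Qed.

Lemma integrable_ext (sigma : nat -> R) (s : nat -> Cx) (F G : Cx -> R) :
  (forall z, supp sigma s z -> F z = G z) -> integrable sigma s G -> integrable sigma s F.
Proof. intros H. apply integrable_le. intros z Hz. rewrite H; [lra|exact Hz]. Qed.

Lemma sint_plus (sigma : nat -> R) (s : nat -> Cx) (F G : Cx -> R) :
  integrable sigma s F -> integrable sigma s G ->
  sint sigma s (fun z => F z + G z) = sint sigma s F + sint sigma s G.
Proof.
intros HF HG. unfold sint. rewrite <- Series_plus; try (apply ex_series_Rabs; assumption).
apply Series_ext. intros n. ring.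
Qed.

Lemma sint_scal (sigma : nat -> R) (s : nat -> Cx) (k : R) (F : Cx -> R) :
  sint sigma s (fun z => k * F z) = k * sint sigma s F.
Proof. unfold sint. rewrite <- Series_scal_l. apply Series_ext. intros n. ring. Qed.

Lemma sint_minus (sigma : nat -> R) (s : nat -> Cx) (F G : Cx -> R) :
  integrable sigma s F -> integrable sigma s G ->
  sint sigma s (fun z => F z - G z) = sint sigma s F - sint sigma s G.
Proof.
intros HF HG.
rewrite (sint_ext _ _ _ (fun z => F z + (-1) * G z)) by (intros; ring).
rewrite sint_plus, sint_scal; [ring|exact HF|apply integrable_scal, HG].
Qed.

Lemma sint_absw_mono (sigma : nat -> R) (s : nat -> Cx) (F G : Cx -> R) :
  (forall z, supp sigma s z -> 0 <= F z <= G z) -> integrable sigma s G ->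
  sint (absw sigma) s F <= sint (absw sigma) s G.
Proof.
intros H HG. apply Series_le.
- intros n. unfold absw. destruct (Req_dec (sigma n) 0) as [->|E]; [rewrite Rabs_R0; lra|].
  pose proof (Rabs_pos (sigma n)). assert (A := H (s n) (ex_intro _ n (conj E eq_refl))).
  split; [apply Rmult_le_pos; lra|apply Rmult_le_compat_l; lra].
- apply ex_series_Rabs. apply integrable_absw, HG.
Qed.

Lemma sint_abs_le (sigma : nat -> R) (s : nat -> Cx) (F G : Cx -> R) :
  (forall z, supp sigma s z -> Rabs (F z) <= G z) -> integrable sigma s G ->
  Rabs (sint sigma s F) <= sint (absw sigma) s G.
Proof.
intros H HG.
assert (HF : integrable sigma s F).
{ apply integrable_le with G; [|exact HG]. intros z Hz.
  eapply Rle_trans; [apply H, Hz|apply Rle_abs]. }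
eapply Rle_trans; [apply Series_Rabs, HF|].
rewrite (Series_ext _ (fun n => absw sigma n * Rabs (F (s n)))) by (intros; apply Rabs_mult).
apply sint_absw_mono with (F := fun z => Rabs (F z)); [|exact HG].
intros z Hz. split; [apply Rabs_pos|apply H, Hz].
Qed.

Lemma sint_absw_ge0 (sigma : nat -> R) (s : nat -> Cx) (F : Cx -> R) :
  (forall z, supp sigma s z -> 0 <= F z) -> integrable sigma s F -> 0 <= sint (absw sigma) s F.
Proof.
intros H HF. apply Rle_trans with (sint (absw sigma) s (fun _ => 0)).
- unfold sint. rewrite (Series_ext _ (fun n => 0)) by (intros; ring).
  rewrite (is_series_unique _ _ (is_series_finite (fun _ => 0) 0 (fun _ _ => eq_refl))). simpl; lra.
- apply sint_absw_mono; [|exact HF]. intros z Hz. specialize (H z Hz). lra.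
Qed.

Lemma compact_support_terms (sigma : nat -> R) (s : nat -> Cx) (r : R) :
  loc_finite sigma s -> exists N, forall F : Cx -> R, (forall z, r < Cnorm z -> F z = 0) ->
    forall n, (N <= n)%nat -> sigma n * F (s n) = 0.
Proof.
intros LF. destruct (LF r) as [N HN].
exists N. intros F H n Hn. destruct (Rle_lt_dec (Cnorm (s n)) r) as [E|E].
- rewrite (HN n Hn E); ring.
- rewrite (H _ E); ring.
Qed.

Lemma integrable_compact (sigma : nat -> R) (s : nat -> Cx) (r : R) (F : Cx -> R) :
  loc_finite sigma s -> (forall z, r < Cnorm z -> F z = 0) -> integrable sigma s F.
Proof.
intros LF H. destruct (compact_support_terms sigma s r LF) as [N HN].
exists (psum (fun n => Rabs (sigma n * F (s n))) N). apply is_series_finite.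
intros n Hn. rewrite (HN F H n Hn). apply Rabs_R0.
Qed.

(** The number of terms is fixed before F. A family of integrands depending on a radius t therefore
    becomes one finite sum, which can be integrated in t term by term. *)
Lemma sint_psum (sigma : nat -> R) (s : nat -> Cx) (r : R) :
  loc_finite sigma s -> exists N0, forall N, (N0 <= N)%nat ->
   forall F : Cx -> R, (forall z, r < Cnorm z -> F z = 0) ->
    sint sigma s F = psum (fun n => sigma n * F (s n)) N.
Proof.
intros LF. destruct (compact_support_terms sigma s r LF) as [N0 HN0].
exists N0. intros N HN F H. apply is_series_unique, is_series_finite.
intros n Hn. apply (HN0 F H). lia.
Qed.

Lemma psum_le_sint_absw (sigma : nat -> R) (s : nat -> Cx) (F : Cx -> R) (N : nat) :
  (forall z, 0 <= F z) -> integrable sigma s F ->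
  psum (fun n => absw sigma n * F (s n)) N <= sint (absw sigma) s F.
Proof.
intros H HF. apply psum_le_Series.
- intros n. apply Rmult_le_pos; [apply absw_ge0|apply H].
- apply ex_series_Rabs. apply integrable_absw, HF.
Qed.

Lemma sint_opp (sigma : nat -> R) (s : nat -> Cx) (F : Cx -> R) :
  sint (fun n => - sigma n) s F = - sint sigma s F.
Proof. unfold sint. rewrite <- Series_opp. apply Series_ext. intros n. ring. Qed.

Definition integrableC (sigma : nat -> R) (s : nat -> Cx) (F : Cx -> Cx) : Prop :=
  integrable sigma s (fun z => Cnorm (F z)).

Lemma integrableC_Re (sigma : nat -> R) (s : nat -> Cx) (F : Cx -> Cx) :
  integrableC sigma s F -> integrable sigma s (fun z => Re (F z)).
Proof.
apply integrable_le. intros z _. rewrite (Rabs_right (Cnorm _)) by apply Rle_ge, Cnorm_ge0.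
apply Re_le_Cnorm.
Qed.

Lemma integrableC_Im (sigma : nat -> R) (s : nat -> Cx) (F : Cx -> Cx) :
  integrableC sigma s F -> integrable sigma s (fun z => Im (F z)).
Proof.
apply integrable_le. intros z _. rewrite (Rabs_right (Cnorm _)) by apply Rle_ge, Cnorm_ge0.
apply Im_le_Cnorm.
Qed.

Lemma integrableC_le (sigma : nat -> R) (s : nat -> Cx) (F : Cx -> Cx) (G : Cx -> R) :
  (forall z, supp sigma s z -> Cnorm (F z) <= G z) -> integrable sigma s G -> integrableC sigma s F.
Proof.
intros H. apply integrable_le. intros z Hz. rewrite Rabs_right by apply Rle_ge, Cnorm_ge0.
eapply Rle_trans; [apply H, Hz|apply Rle_abs].
Qed.

Lemma integrableC_compact (sigma : nat -> R) (s : nat -> Cx) (r : R) (F : Cx -> Cx) :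
  loc_finite sigma s -> (forall z, r < Cnorm z -> F z = Czero) -> integrableC sigma s F.
Proof.
intros LF H. apply integrable_compact with r; [exact LF|].
intros z Hz. rewrite H by exact Hz. apply Cnorm_0.
Qed.

Lemma sintC_ext (sigma : nat -> R) (s : nat -> Cx) (F G : Cx -> Cx) :
  (forall z, supp sigma s z -> F z = G z) -> sintC sigma s F = sintC sigma s G.
Proof. intros H. unfold sintC. f_equal; apply sint_ext; intros z Hz; rewrite H; auto. Qed.

Lemma sintC_add (sigma : nat -> R) (s : nat -> Cx) (F G : Cx -> Cx) :
  integrableC sigma s F -> integrableC sigma s G ->
  sintC sigma s (fun z => Cadd (F z) (G z)) = Cadd (sintC sigma s F) (sintC sigma s G).
Proof.
intros HF HG. apply Cx_eq; simpl; apply sint_plus;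
  auto using integrableC_Re, integrableC_Im.
Qed.

Lemma sintC_sub (sigma : nat -> R) (s : nat -> Cx) (F G : Cx -> Cx) :
  integrableC sigma s F -> integrableC sigma s G ->
  sintC sigma s (fun z => Csub (F z) (G z)) = Csub (sintC sigma s F) (sintC sigma s G).
Proof.
intros HF HG. apply Cx_eq; simpl; apply sint_minus;
  auto using integrableC_Re, integrableC_Im.
Qed.

Lemma sintC_mul_l (sigma : nat -> R) (s : nat -> Cx) (c : Cx) (F : Cx -> Cx) :
  integrableC sigma s F ->
  sintC sigma s (fun z => Cmul c (F z)) = Cmul c (sintC sigma s F).
Proof.
intros HF. pose proof (integrableC_Re _ _ _ HF) as H1. pose proof (integrableC_Im _ _ _ HF) as H2.
apply Cx_eq; simpl.
- rewrite (sint_minus sigma s (fun z => Re c * Re (F z)) (fun z => Im c * Im (F z)));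
   [rewrite !sint_scal; reflexivity|apply integrable_scal; assumption..].
- rewrite (sint_plus sigma s (fun z => Re c * Im (F z)) (fun z => Im c * Re (F z)));
   [rewrite !sint_scal; reflexivity|apply integrable_scal; assumption..].
Qed.

Lemma Cnorm_sintC_le (sigma : nat -> R) (s : nat -> Cx) (F : Cx -> Cx) (G : Cx -> R) :
  (forall z, supp sigma s z -> Cnorm (F z) <= G z) -> integrable sigma s G ->
  Cnorm (sintC sigma s F) <= 2 * sint (absw sigma) s G.
Proof.
intros H HG. eapply Rle_trans; [apply Cnorm_le_ReIm|]. simpl.
assert (A := sint_abs_le sigma s (fun z => Re (F z)) G
   (fun z Hz => Rle_trans _ _ _ (Re_le_Cnorm (F z)) (H z Hz)) HG).
assert (B := sint_abs_le sigma s (fun z => Im (F z)) G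
   (fun z Hz => Rle_trans _ _ _ (Im_le_Cnorm (F z)) (H z Hz)) HG).
lra.
Qed.

Definition disc (r : R) (z : Cx) : R := ind (Cnorm z < r).

Lemma disc_outside (r : R) (z : Cx) : r < Cnorm z -> disc r z = 0.
Proof. intros H. apply ind_false. lra. Qed.

(** The points are not listed by increasing modulus, so truncating by discs differs from truncating
    the series. By absolute convergence it suffices that a large disc contains the first N + 1
    points, with N chosen so that the tail of the series is below eps. *)
Lemma sint_disc_tends (sigma : nat -> R) (s : nat -> Cx) (F : Cx -> R) :
  integrable sigma s F -> tends (fun r => sint sigma s (fun z => disc r z * F z)) (sint sigma s F).
Proof.
intros HF eps He.
set (x := fun n => Rabs (sigma n * F (s n))).
assert (Hx : is_lim_seq (fun n => psum x (S n)) (Series x)).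
{ apply is_series_psum, Series_correct, HF. }
apply is_lim_seq_spec in Hx. destruct (Hx (mkposreal eps He)) as [N HN].
specialize (HN N (Nat.le_refl N)). simpl in HN.
assert (Hb : exists R0, forall n, (n < S N)%nat -> Cnorm (s n) <= R0).
{ clear. induction (S N) as [|M [R0 H0]]; [exists 0; intros; lia|].
  exists (Rmax R0 (Cnorm (s M))). intros n Hn.
  destruct (Nat.eq_dec n M) as [->|E]; [apply Rmax_r|].
  eapply Rle_trans; [apply H0; lia|apply Rmax_l]. }
destruct Hb as [R0 HR0]. exists R0. intros r Hr.
set (y := fun n => (1 - disc r (s n)) * x n).
assert (Hd : forall z, 0 <= disc r z <= 1) by (intros; apply ind_bounds).
assert (Hyx : forall n, 0 <= y n <= x n).
{ intros n. unfold y. assert (H1 := Hd (s n)). assert (H2 : 0 <= x n) by apply Rabs_pos. nra. }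
assert (Ey : ex_series y).
{ apply (@ex_series_le _ R_CompleteNormedModule) with (2 := HF). intros n.
  unfold norm; simpl. unfold abs; simpl. specialize (Hyx n). rewrite Rabs_right; [apply Hyx|lra]. }
assert (A : Rabs (sint sigma s (fun z => disc r z * F z) - sint sigma s F) <= Series y).
{ assert (HdF : integrable sigma s (fun z => disc r z * F z)).
  { apply integrable_le with F; [|exact HF]. intros z _. rewrite Rabs_mult.
    specialize (Hd z). rewrite (Rabs_right (disc r z)) by lra. pose proof (Rabs_pos (F z)). nra. }
  rewrite <- sint_minus by assumption. unfold sint.
  eapply Rle_trans; [apply Series_Rabs|apply Series_le].
  - apply (@ex_series_le _ R_CompleteNormedModule) with (2 := Ey). intros n.
    unfold norm; simpl. unfold abs; simpl. rewrite Rabs_Rabsolu. unfold y, x.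
    replace (sigma n * (disc r (s n) * F (s n) - F (s n))) with
      (- (1 - disc r (s n)) * (sigma n * F (s n))) by ring.
    rewrite Rabs_mult, Rabs_Ropp, (Rabs_right (1 - _)); [lra|]. specialize (Hd (s n)); lra.
  - intros n. split; [apply Rabs_pos|]. unfold y, x.
    replace (sigma n * (disc r (s n) * F (s n) - F (s n))) with
      (- (1 - disc r (s n)) * (sigma n * F (s n))) by ring.
    rewrite Rabs_mult, Rabs_Ropp, (Rabs_right (1 - _)); [lra|]. specialize (Hd (s n)); lra.
  - exact Ey. }
(* The part y outside the disc vanishes on the first N + 1 indices, so it fits beside their partial
   sum inside the full series. *)
assert (B : Series y + psum x (S N) <= Series x).
{ set (w := fun n => if Nat.ltb n (S N) then x n else 0).
  assert (Hw0 : forall n, (S N <= n)%nat -> w n = 0).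
  { intros n Hn. unfold w. destruct (Nat.ltb_spec n (S N)); [lia|reflexivity]. }
  assert (Hw : is_series w (psum x (S N))).
  { replace (psum x (S N)) with (psum w (S N)); [apply is_series_finite; exact Hw0|].
    apply psum_ext. intros n Hn. unfold w. destruct (Nat.ltb_spec n (S N)); [reflexivity|lia]. }
  rewrite <- (is_series_unique _ _ Hw), <- Series_plus; [|exact Ey|eexists; exact Hw].
  apply Series_le; [|exact HF]. intros n. unfold w.
  destruct (Nat.ltb_spec n (S N)) as [L|L].
  - unfold y. replace (disc r (s n)) with 1; [assert (0 <= x n) by apply Rabs_pos; lra|].
    symmetry; apply ind_true. specialize (HR0 n L). lra.
  - specialize (Hyx n). lra. }
apply Rabs_def2 in HN. simpl psum in *. lra.
Qed.

Lemma sintC_disc_tends (sigma : nat -> R) (s : nat -> Cx) (F : Cx -> Cx) :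
  integrableC sigma s F ->
  Clim_infty (fun r => sintC sigma s (fun z => Cmul (RtoC (disc r z)) (F z))) (sintC sigma s F).
Proof.
intros HF. apply Clim_infty_iff. split; simpl.
- apply (tends_eventually_eq _ (fun r => sint sigma s (fun z => disc r z * Re (F z))) _ 0).
  { intros r _. apply sint_ext. intros z _. ring. }
  apply sint_disc_tends, integrableC_Re, HF.
- apply (tends_eventually_eq _ (fun r => sint sigma s (fun z => disc r z * Im (F z))) _ 0).
  { intros r _. apply sint_ext. intros z _. ring. }
  apply sint_disc_tends, integrableC_Im, HF.
Qed.

(** * Counting points in annuli *)

Lemma ln_le_sub1 (y : R) : 0 < y -> ln y <= y - 1.
Proof.
intros H. assert (A := exp_ineq1_le (ln y)). rewrite exp_ln in A by exact H. lra.
Qed.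

Lemma ln_ge_1_sub_inv (y : R) : 0 < y -> 1 - / y <= ln y.
Proof.
intros H. assert (H' := Rinv_0_lt_compat _ H). assert (A := ln_le_sub1 (/ y) H').
rewrite ln_Rinv in A by exact H. lra.
Qed.

Lemma ln_nonneg (y : R) : 1 <= y -> 0 <= ln y.
Proof. intros H. rewrite <- ln_1. apply ln_le; lra. Qed.

(** The positive part of log (t/m). For m >= 1 it is the integral of 1/u over those u in [1, t] with
    u > m, that is the contribution of a point at distance m to the integrals in (d) and (e). *)
Definition lnp (m t : R) : R := if Rlt_dec m t then ln (t / m) else 0.

(** The cutoff at 1 reflects the lower limit of the integrals in (d) and (e): points closer to c
    than 1 are counted during the whole of [1, r]. *)
Definition rad (c z : Cx) : R := Rmax 1 (Cnorm (Csub z c)).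

Lemma rad_ge1 (c z : Cx) : 1 <= rad c z.
Proof. apply Rmax_l. Qed.

Lemma rad_ge_Cnorm (c z : Cx) : Cnorm z <= Cnorm c + rad c z.
Proof.
assert (H := Cnorm_add (Csub z c) c). replace (Cadd (Csub z c) c) with z in H by ring.
pose proof (Rmax_r 1 (Cnorm (Csub z c))). unfold rad. lra.
Qed.

Lemma lnp_zero (m t : R) : t <= m -> lnp m t = 0.
Proof. intros H. unfold lnp. destruct (Rlt_dec m t); [lra|reflexivity]. Qed.

Lemma lnp_pos (m t : R) : m < t -> lnp m t = ln (t / m).
Proof. intros H. unfold lnp. destruct (Rlt_dec m t); [reflexivity|lra]. Qed.

Lemma lnp_outside (c z : Cx) (t : R) : Cnorm c + t < Cnorm z -> lnp (rad c z) t = 0.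
Proof. intros H. apply lnp_zero. pose proof (rad_ge_Cnorm c z). lra. Qed.

(** Telescoping: 1/(k+1)^2 <= 1/k - 1/(k+1). *)
Lemma psum_inv_sqr (J : nat) : psum (fun j => / ((INR j + 1) * (INR j + 1))) J <= 2.
Proof.
assert (H : forall K, psum (fun j => / ((INR j + 1) * (INR j + 1))) (S K) <= 2 - / (INR K + 1)).
{ induction K as [|K IH]; [simpl; lra|].
  change (psum (fun j => / ((INR j + 1) * (INR j + 1))) (S K) +
    / ((INR (S K) + 1) * (INR (S K) + 1)) <= 2 - / (INR (S K) + 1)).
  rewrite S_INR. pose proof (pos_INR K).
  assert (E : / (INR K + 1) - / (INR K + 1 + 1) = / ((INR K + 1) * (INR K + 1 + 1))) by (field; lra).
  assert (/ ((INR K + 1 + 1) * (INR K + 1 + 1)) <= / ((INR K + 1) * (INR K + 1 + 1))).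
  { apply Rinv_le_contravar; [nra|]. apply Rmult_le_compat_r; lra. }
  lra. }
destruct J as [|J]; [simpl; lra|].
specialize (H J). pose proof (pos_INR J). assert (0 < / (INR J + 1)) by (apply Rinv_0_lt_compat; lra). lra.
Qed.

Lemma integrable_psum (sigma : nat -> R) (s : nat -> Cx) (F : nat -> Cx -> R) (M : nat) :
  (forall j, integrable sigma s (F j)) -> integrable sigma s (fun z => psum (fun j => F j z) M).
Proof.
intros H. induction M as [|M IH]; simpl.
- exists 0. apply (is_series_finite (fun n => Rabs (sigma n * 0)) 0). intros n _. rewrite Rmult_0_r. apply Rabs_R0.
- apply integrable_plus; auto.
Qed.

Lemma sint_psum_exchange (sigma : nat -> R) (s : nat -> Cx) (F : nat -> Cx -> R) (M : nat) :
  (forall j, integrable sigma s (F j)) ->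
  sint sigma s (fun z => psum (fun j => F j z) M) = psum (fun j => sint sigma s (F j)) M.
Proof.
intros H. induction M as [|M IH]; simpl.
- apply is_series_unique. apply (is_series_finite _ 0). intros n _. ring.
- rewrite sint_plus; [rewrite IH; reflexivity|apply integrable_psum, H|apply H].
Qed.

(** The centres lie on the middle circle of radius r + 1/2, so the radial error is at most 1/2. The
    angular error is at most 12 (r+1) 2 pi / N <= 96 (r+1) / N, using pi <= 4, and 192 makes this
    1/2. There are N + 1 indices because the argument pi itself is allowed. *)
Lemma circle_net (r : R) (N : nat) (z : Cx) :
  0 <= r -> 192 * (r + 1) <= INR N -> r <= Cnorm z < r + 1 ->
  exists j, (j < S N)%nat /\
   Cnorm (Csub z (Cmul (RtoC (r + 1/2)) (Cexp (mkCx 0 (- PI + 2 * PI * INR j / INR N))))) <= 1.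
Proof.
intros Hr HN Hz. destruct (polar_form z) as [th [Hth [E1 E2]]].
assert (HPI := PI_RGT_0). assert (HPI4 := PI_4).
assert (HN0 : 0 < INR N) by lra.
destruct (nfloor_ex ((th + PI) * INR N / (2 * PI))) as [j [Hj1 Hj2]].
{ apply Rdiv_le_0_compat; [|lra]. apply Rmult_le_pos; lra. }
assert (Hj3 : 2 * PI * INR j / INR N <= th + PI).
{ apply Rle_div_l; [exact HN0|]. apply Rle_div_r in Hj1; lra. }
assert (Hj4 : th + PI <= 2 * PI * INR j / INR N + 2 * PI / INR N).
{ replace (2 * PI * INR j / INR N + 2 * PI / INR N) with ((2 * PI * INR j + 2 * PI) / INR N) by (field; lra).
  apply Rle_div_r; [exact HN0|]. apply Rlt_div_l in Hj2; lra. }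
exists j. split.
{ assert (INR j <= INR N).
  { eapply Rle_trans; [exact Hj1|]. apply Rle_div_l; [lra|]. nra. }
  apply INR_le in H. lia. }
set (ps := - PI + 2 * PI * INR j / INR N). set (rho := Cnorm z) in *.
assert (Hd : 0 <= th - ps <= 2 * PI / INR N) by (unfold ps; lra).
assert (Hs : 2 * PI / INR N * (r + 1) <= 1/24).
{ unfold Rdiv at 1. rewrite (Rmult_comm (2 * PI)), Rmult_assoc, Rmult_comm.
  apply Rle_div_l; [exact HN0|]. nra. }
replace (Csub z (Cmul (RtoC (r + 1 / 2)) (Cexp (mkCx 0 ps)))) with
  (Cadd (Cmul (RtoC rho) (Cmul (Cexp (mkCx 0 ps)) (Csub (Cexp (mkCx 0 (th - ps))) Cone)))
     (Cmul (RtoC (rho - (r + 1/2))) (Cexp (mkCx 0 ps)))).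
- eapply Rle_trans; [apply Cnorm_add|]. rewrite !Cnorm_mul, !Cnorm_RtoC, !Cnorm_Cexp. simpl. rewrite exp_0.
  assert (Hu : Cnorm (mkCx 0 (th - ps)) = th - ps) by (apply Cnorm_eq; simpl; [lra|ring]).
  assert (Hle : th - ps <= 1) by nra.
  assert (B := Cexp_sub1_bound (mkCx 0 (th - ps)) ltac:(lra)). rewrite Hu in B.
  rewrite (Rabs_right rho) by lra.
  assert (Rabs (rho - (r + 1 / 2)) <= 1/2) by (apply Rabs_le; lra).
  assert (rho * (1 * Cnorm (Csub (Cexp (mkCx 0 (th - ps))) Cone)) <= 1/2); [|lra].
  rewrite Rmult_1_l.
  apply Rle_trans with ((r + 1) * (12 * (th - ps))); [|nra].
  apply Rmult_le_compat; try apply Cnorm_ge0; lra.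
- transitivity (Csub (Cmul (RtoC rho) (Cmul (Cexp (mkCx 0 ps)) (Cexp (mkCx 0 (th - ps)))))
     (Cmul (RtoC (r + 1 / 2)) (Cexp (mkCx 0 ps)))).
  + replace (RtoC (rho - (r + 1/2))) with (Csub (RtoC rho) (RtoC (r + 1/2))) by cx. ring.
  + rewrite <- Cexp_add. f_equal. apply Cx_eq; simpl.
    * rewrite Rplus_0_l, exp_0. replace (ps + (th - ps)) with th by ring. rewrite E1. ring.
    * rewrite Rplus_0_l, exp_0. replace (ps + (th - ps)) with th by ring. rewrite E2. ring.
Qed.

Section Counting.

Context (sigma : nat -> R) (s : nat -> Cx) (LF : loc_finite sigma s) (Cb : R).
Context (Hcount : forall c, sint (absw sigma) s (fun z => ind (Cnorm (Csub z c) <= 1)) <= Cb).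

Lemma ball_integrable (c : Cx) (r : R) : integrable sigma s (fun z => ind (Cnorm (Csub z c) <= r)).
Proof.
apply integrable_compact with (Cnorm c + r); [exact LF|]. intros z Hz. apply ind_false. intros E.
assert (H := Cnorm_sub_ge z c). lra.
Qed.

Lemma Cb_ge0 : 0 <= Cb.
Proof.
eapply Rle_trans; [|apply (Hcount Czero)]. apply sint_absw_ge0; [|apply ball_integrable].
intros; apply ind_bounds.
Qed.

Lemma annulus_integrable (r1 r2 : R) : integrable sigma s (fun z => ind (r1 <= Cnorm z < r2)).
Proof.
apply integrable_compact with r2; [exact LF|]. intros z Hz. apply ind_false. lra.
Qed.

(** The annulus is covered by O(r) unit discs, each with mass at most [Cb]. At most 192 (r+1) + 2 <=
    194 (r+1) discs are used; [Cb + 1] makes the constant strictly positive. *)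
Lemma annulus_count : exists CA, 0 < CA /\ forall r, 0 <= r ->
  sint (absw sigma) s (fun z => ind (r <= Cnorm z < r + 1)) <= CA * (r + 1).
Proof.
pose proof Cb_ge0 as HCb.
exists (194 * (Cb + 1)). split; [lra|]. intros r Hr.
destruct (nfloor_ex (192 * (r + 1))) as [N' [HN1 HN2]]; [lra|].
set (N := S N').
assert (HN : INR N = INR N' + 1) by apply S_INR.
set (c := fun j => Cmul (RtoC (r + 1/2)) (Cexp (mkCx 0 (- PI + 2 * PI * INR j / INR N)))).
apply Rle_trans with (sint (absw sigma) s (fun z => psum (fun j => ind (Cnorm (Csub z (c j)) <= 1)) (S N))).
- apply sint_absw_mono; [|apply integrable_psum; intros; apply ball_integrable].
  intros z _. split; [apply ind_bounds|].
  destruct (classic (r <= Cnorm z < r + 1)) as [E|E].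
  + rewrite (ind_true _ E). destruct (circle_net r N z Hr ltac:(lra) E) as [j [Hj Hc]].
    apply Rle_trans with (ind (Cnorm (Csub z (c j)) <= 1)); [rewrite ind_true by exact Hc; lra|].
    apply (psum_term_le (fun j => ind (Cnorm (Csub z (c j)) <= 1)) (S N) j).
    * intros; apply ind_bounds.
    * exact Hj.
  + rewrite (ind_false _ E). apply psum_ge0. intros; apply ind_bounds.
- rewrite sint_psum_exchange by (intros; apply integrable_absw, ball_integrable).
  apply Rle_trans with (psum (fun _ => Cb * 1) (S N)); [apply psum_le; intros j; rewrite Rmult_1_r; apply Hcount|].
  rewrite psum_scal.
  assert (E : forall K, psum (fun _ => 1) K = INR K).
  { induction K as [|K IH]; [reflexivity|]. rewrite S_INR. simpl. rewrite IH. reflexivity. }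
  rewrite E, S_INR, HN. nra.
Qed.

Lemma wide_annulus_count (k : R) : 0 <= k -> exists K, 0 < K /\ forall r, k + 1 <= r ->
  sint (absw sigma) s (fun z => ind (r - k <= Cnorm z <= r + k)) <= K * r.
Proof.
intros Hk. destruct annulus_count as [CA [HCA H]].
destruct (nfloor_ex (2 * k)) as [M' [HM1 HM2]]; [lra|]. set (M := S M').
assert (HM : INR M = INR M' + 1) by apply S_INR.
exists (INR M * (CA * 4)). split; [pose proof (pos_INR M'); nra|]. intros r Hr.
apply Rle_trans with (sint (absw sigma) s
   (fun z => psum (fun j => ind (r - k + INR j <= Cnorm z < r - k + INR j + 1)) M)).
- apply sint_absw_mono; [|apply integrable_psum; intros; apply annulus_integrable].
  intros z _. split; [apply ind_bounds|].
  destruct (classic (r - k <= Cnorm z <= r + k)) as [E|E].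
  + rewrite (ind_true _ E). destruct (nfloor_ex (Cnorm z - (r - k))) as [j [Hj1 Hj2]]; [lra|].
    apply Rle_trans with (ind (r - k + INR j <= Cnorm z < r - k + INR j + 1)); [rewrite ind_true; lra|].
    apply (psum_term_le (fun j => ind (r - k + INR j <= Cnorm z < r - k + INR j + 1)) M j).
    * intros; apply ind_bounds.
    * apply INR_lt. lra.
  + rewrite (ind_false _ E). apply psum_ge0. intros; apply ind_bounds.
- rewrite sint_psum_exchange by (intros; apply integrable_absw, annulus_integrable).
  assert (E : forall K, (K <= M)%nat -> psum (fun j => sint (absw sigma) s
       (fun z => ind (r - k + INR j <= Cnorm z < r - k + INR j + 1))) K <= INR K * (CA * 4 * r)).
  { induction K as [|K IH]; intros HK; [simpl; lra|].
    rewrite S_INR. simpl psum. specialize (IH ltac:(lia)).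
    assert (INR K <= 2 * k) by (apply le_INR in HK; rewrite S_INR in HK; lra).
    pose proof (pos_INR K).
    assert (A := H (r - k + INR K) ltac:(lra)). nra. }
  specialize (E M (Nat.le_refl M)). lra.
Qed.

(** The annulus between radii j and j + 1 has mass O(j+1) and the weight there is at most (j+1)^-3,
    which leaves a sum of (j+1)^-2. An exponent of 2 would leave the harmonic series. *)
Lemma inv_cube_integrable : integrable sigma s (fun z => / (1 + Cnorm z) ^ 3).
Proof.
destruct annulus_count as [CA [HCA H]].
assert (Hpos : forall z, 0 < / (1 + Cnorm z) ^ 3).
{ intros z. apply Rinv_0_lt_compat, pow_lt. pose proof (Cnorm_ge0 z); lra. }
apply ex_series_nonneg_bounded with (CA * 2); [intros; apply Rabs_pos|]. intros N.
assert (HJ : exists J, forall n, (n < N)%nat -> Cnorm (s n) < INR J).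
{ induction N as [|N [J HJ]]; [exists O; intros; lia|].
  destruct (INR_unbounded (Cnorm (s N))) as [J' HJ']. exists (Nat.max J J'). intros n Hn.
  destruct (Nat.eq_dec n N) as [->|E].
  - eapply Rlt_le_trans; [apply HJ'|apply le_INR; lia].
  - eapply Rlt_le_trans; [apply HJ; lia|apply le_INR; lia]. }
destruct HJ as [J HJ].
set (t := fun n j => absw sigma n * (/ (INR j + 1) ^ 3 * ind (INR j <= Cnorm (s n) < INR j + 1))).
apply Rle_trans with (psum (fun n => psum (t n) J) N).
- clear -HJ Hpos. induction N as [|N IH]; [simpl; lra|].
  simpl. specialize (IH (fun n Hn => HJ n (Nat.lt_lt_succ_r _ _ Hn))).
  assert (HJN := HJ N (Nat.lt_succ_diag_r N)).
  enough (Rabs (sigma N * / (1 + Cnorm (s N)) ^ 3) <= psum (t N) J) by (simpl in *; lra).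
  rewrite Rabs_mult, (Rabs_right (/ _)) by (left; apply Hpos).
  destruct (nfloor_ex (Cnorm (s N))) as [j [Hj1 Hj2]]; [apply Cnorm_ge0|].
  apply Rle_trans with (t N j).
  + unfold t. rewrite ind_true by lra. rewrite Rmult_1_r.
    apply Rmult_le_compat_l; [apply Rabs_pos|]. pose proof (pos_INR j).
    apply Rinv_le_contravar; [apply pow_lt; lra|]. apply pow_incr. lra.
  + apply psum_term_le; [|apply INR_lt; lra].
    intros i. unfold t. apply Rmult_le_pos; [apply absw_ge0|]. apply Rmult_le_pos; [|apply ind_bounds].
    left. apply Rinv_0_lt_compat, pow_lt. pose proof (pos_INR i); lra.
- rewrite psum_exchange.
  apply Rle_trans with (psum (fun j => CA * / ((INR j + 1) * (INR j + 1))) J).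
  + apply psum_le. intros j. unfold t. pose proof (pos_INR j).
    rewrite (psum_ext _ (fun n => / (INR j + 1) ^ 3 * (absw sigma n * ind (INR j <= Cnorm (s n) < INR j + 1))))
      by (intros; ring).
    rewrite psum_scal.
    assert (A := psum_le_sint_absw sigma s (fun z => ind (INR j <= Cnorm z < INR j + 1)) N
       (fun z => proj1 (ind_bounds _)) (annulus_integrable _ _)). cbv beta in A.
    assert (B := H (INR j) ltac:(lra)).
    apply Rle_trans with (/ (INR j + 1) ^ 3 * (CA * (INR j + 1))).
    * apply Rmult_le_compat_l; [left; apply Rinv_0_lt_compat, pow_lt; lra|]. lra.
    * right. field. lra.
  + rewrite psum_scal. apply Rmult_le_compat_l; [lra|apply psum_inv_sqr].
Qed.

(** The part in a bounded disc is a finite sum; outside, 1 + |z| <= 2 |z| gives the factor 8 in the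
    comparison. *)
Lemma integrable_of_cube_bound (F : Cx -> R) (R0 K : R) :
  (forall z, supp sigma s z -> R0 < Cnorm z -> Rabs (F z) <= K / Cnorm z ^ 3) -> integrable sigma s F.
Proof.
intros H. set (R1 := Rmax R0 1).
apply integrable_ext with (G := fun z => ind (Cnorm z <= R1) * F z + ind (R1 < Cnorm z) * F z).
{ intros z _. destruct (Rle_lt_dec (Cnorm z) R1).
  - rewrite ind_true, ind_false by lra. ring.
  - rewrite ind_false, ind_true by lra. ring. }
apply integrable_plus.
- apply integrable_compact with R1; [exact LF|]. intros z Hz. rewrite ind_false by lra. ring.
- apply integrable_le with (fun z => (Rabs K * 8) * / (1 + Cnorm z) ^ 3); [|apply integrable_scal, inv_cube_integrable].
  intros z Hz. pose proof (Rmax_l R0 1 : R0 <= R1). pose proof (Rmax_r R0 1 : 1 <= R1).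
  pose proof (Rabs_pos K). pose proof (Cnorm_ge0 z).
  assert (0 < / (1 + Cnorm z) ^ 3) by (apply Rinv_0_lt_compat, pow_lt; lra).
  rewrite (Rabs_right (Rabs K * 8 * _)) by (apply Rle_ge, Rmult_le_pos; lra).
  destruct (Rlt_le_dec R1 (Cnorm z)) as [L|L].
  + rewrite ind_true by exact L. rewrite Rmult_1_l. eapply Rle_trans; [apply H; [exact Hz|lra]|].
    apply Rle_trans with (Rabs K / Cnorm z ^ 3).
    * apply Rmult_le_compat_r; [left; apply Rinv_0_lt_compat, pow_lt; lra|apply Rle_abs].
    * unfold Rdiv. rewrite Rmult_assoc. apply Rmult_le_compat_l; [assumption|].
      assert (E : 8 * / (1 + Cnorm z) ^ 3 = / ((1 + Cnorm z) / 2) ^ 3) by (field; lra).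
      rewrite E. apply Rinv_le_contravar; [apply pow_lt; lra|]. apply pow_incr. lra.
  + rewrite ind_false by lra. rewrite Rmult_0_l, Rabs_R0. apply Rmult_le_pos; lra.
Qed.

Lemma integrableC_of_cube_bound (F : Cx -> Cx) (R0 K : R) :
  (forall z, supp sigma s z -> R0 < Cnorm z -> Cnorm (F z) <= K / Cnorm z ^ 3) -> integrableC sigma s F.
Proof.
intros H. apply integrable_of_cube_bound with R0 K. intros z Hz Hr.
rewrite Rabs_right by apply Rle_ge, Cnorm_ge0. auto.
Qed.

(* Exchanging the discs |z| < r and |z - c| < r only affects O(r) points. *)
Lemma disc_change (c : Cx) (k : R -> Cx -> R) (K : R) :
  (forall r z, Cnorm c + 1 <= r -> r - Cnorm c <= Cnorm (Csub z c) <= r + Cnorm c ->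
     Rabs (k r z) <= K / (r * r)) ->
  tends (fun r => sint sigma s (fun z => (disc r z - disc r (Csub z c)) * k r z)) 0.
Proof.
intros Hk. pose proof (Cnorm_ge0 c) as Hc.
(* The hypothesis itself forces K >= 0: it is tested at the point c + r with r = |c| + 1. *)
assert (HK : 0 <= K).
{ set (r := Cnorm c + 1). assert (A := Hk r (Cadd c (RtoC r)) ltac:(unfold r; lra)).
  replace (Csub (Cadd c (RtoC r)) c) with (RtoC r) in A by ring.
  rewrite Cnorm_RtoC, (Rabs_right r) in A by (unfold r; lra). specialize (A ltac:(lra)).
  assert (0 < r * r) by (unfold r; nra). pose proof (Rabs_pos (k r (Cadd c (RtoC r)))).
  apply Rle_div_r in A; [|assumption]. nra. }
destruct (wide_annulus_count (Cnorm c) Hc) as [M [HM HA]].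
apply tends_squeeze with (fun r => K * M / r) (Cnorm c + 1); [|apply tends_div_r].
intros r Hr. rewrite Rminus_0_r.
eapply Rle_trans; [apply sint_abs_le with (G := fun z => (K / (r * r)) * ind (r - Cnorm c <= Cnorm z <= r + Cnorm c))|].
- intros z _. assert (H1 := Cnorm_sub_ge z c).
  assert (H2 := Cnorm_sub_le z c). assert (H3 := Cnorm_sub_ge c z). rewrite Cnorm_sub_sym in H3.
  assert (H4 := Cnorm_add (Csub z c) c). replace (Cadd (Csub z c) c) with z in H4 by ring.
  assert (0 < r * r) by nra.
  assert (HKr : 0 <= K / (r * r)) by (apply Rdiv_le_0_compat; lra).
  unfold disc. rewrite Rabs_mult.
  destruct (Rlt_le_dec (Cnorm z) r) as [L1|L1]; destruct (Rlt_le_dec (Cnorm (Csub z c)) r) as [L2|L2].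
  + rewrite !ind_true by assumption. rewrite Rminus_diag, Rabs_R0.
    pose proof (ind_bounds (r - Cnorm c <= Cnorm z <= r + Cnorm c)). nra.
  + rewrite (ind_true (Cnorm z < r)), (ind_false (_ < _)) by lra.
    rewrite ind_true by lra. rewrite Rminus_0_r, Rabs_R1, Rmult_1_l, Rmult_1_r. apply Hk; lra.
  + rewrite (ind_false (Cnorm z < r)), (ind_true (_ < _)) by lra.
    rewrite ind_true by lra. rewrite Rminus_0_l, Rabs_Ropp, Rabs_R1, Rmult_1_l, Rmult_1_r. apply Hk; lra.
  + rewrite !ind_false by lra. rewrite Rminus_diag, Rabs_R0.
    rewrite Rmult_0_l. apply Rmult_le_pos; [assumption|apply ind_bounds].
- apply integrable_scal. apply integrable_compact with (r + Cnorm c); [exact LF|].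
  intros z Hz. apply ind_false. lra.
- rewrite sint_scal. assert (A := HA r ltac:(lra)).
  assert (0 < r * r) by nra.
  apply Rle_trans with (K / (r * r) * (M * r)).
  + apply Rmult_le_compat_l; [apply Rdiv_le_0_compat; lra|exact A].
  + right. field. lra.
Qed.

(** From r to r + 1 the logarithmic weight of every point in the disc grows by the same L = log
    ((r+1)/r), while the points of the annulus between r and r + 1 contribute O(r) * (1/r). The
    increment is bounded by the hypothesis and L >= 1/(2r), so the signed mass is O(r), one order
    better than the count of points. *)
Lemma disc_charge_linear (Cd : R) :
  (forall r, 1 <= r -> Rabs (sint sigma s (fun z => lnp (rad Czero z) r)) <= Cd) ->
  exists K, forall r, 1 <= r -> Rabs (sint sigma s (disc r)) <= K * r.
Proof.
intros HL. destruct annulus_count as [CA [HCA HA]].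
assert (Hint : forall r, integrable sigma s (fun z => lnp (rad Czero z) r)).
{ intros r. apply integrable_compact with r; [exact LF|]. intros z Hz. apply lnp_outside. rewrite Cnorm_0. lra. }
assert (Hdisc : forall r, integrable sigma s (disc r)).
{ intros r. apply integrable_compact with r; [exact LF|]. intros z Hz. apply disc_outside, Hz. }
exists (2 * (2 * Cd + CA * 2)). intros r Hr.
set (L := ln ((r + 1) / r)).
assert (Hq : (r + 1) / r = 1 + / r) by (field; lra).
assert (Hir : 0 < / r) by (apply Rinv_0_lt_compat; lra).
assert (HL1 : L <= / r) by (unfold L; eapply Rle_trans; [apply ln_le_sub1|]; lra).
assert (HL2 : / (2 * r) <= L).
{ unfold L. eapply Rle_trans; [|apply ln_ge_1_sub_inv; lra].
  replace (1 - / ((r + 1) / r)) with (/ (r + 1)) by (field; lra). apply Rinv_le_contravar; lra. }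
assert (E : Rabs (sint sigma s (fun z => (lnp (rad Czero z) (r + 1) - lnp (rad Czero z) r) - L * disc r z))
   <= / r * (CA * (r + 1))).
{ eapply Rle_trans; [apply sint_abs_le with (G := fun z => / r * ind (r <= Cnorm z < r + 1))|].
  - intros z _. assert (Hz : Csub z Czero = z) by ring.
    unfold disc. unfold rad. rewrite Hz.
    destruct (Rlt_le_dec (Cnorm z) r) as [L1|L1].
    + rewrite ind_true, ind_false by lra. rewrite Rmult_1_r, Rmult_0_r.
      set (m := Rmax 1 (Cnorm z)). assert (1 <= m <= r) by (split; [apply Rmax_l|apply Rmax_lub; lra]).
      rewrite lnp_pos by lra. unfold L.
      destruct (Rlt_le_dec m r) as [L2|L2].
      * rewrite lnp_pos by lra. rewrite !ln_div by lra.
        replace (ln (r + 1) - ln m - (ln r - ln m) - (ln (r + 1) - ln r)) with 0 by ring. rewrite Rabs_R0; lra.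
      * rewrite lnp_zero by lra. replace m with r by lra. rewrite Rminus_0_r, Rminus_diag, Rabs_R0. lra.
    + rewrite (ind_false (_ < _)) by lra. rewrite Rmult_0_r, Rminus_0_r.
      rewrite Rmax_right by lra. rewrite (lnp_zero _ r) by lra. rewrite Rminus_0_r.
      destruct (Rlt_le_dec (Cnorm z) (r + 1)) as [L2|L2].
      * rewrite lnp_pos, ind_true by lra. rewrite Rmult_1_r.
        rewrite Rabs_right.
        -- apply Rle_trans with L; [|exact HL1]. unfold L. apply ln_le; [apply Rdiv_lt_0_compat; lra|].
           apply Rmult_le_compat_l; [lra|]. apply Rinv_le_contravar; lra.
        -- apply Rle_ge, ln_nonneg. apply Rle_div_r; lra.
      * rewrite lnp_zero, ind_false by lra. rewrite Rabs_R0. lra.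
  - apply integrable_scal, annulus_integrable.
  - rewrite sint_scal. apply Rmult_le_compat_l; [lra|]. apply HA; lra. }
rewrite sint_minus, sint_minus, sint_scal in E; auto.
2: { apply (integrable_ext _ _ _ (fun z => lnp (rad Czero z) (r + 1) + (-1) * lnp (rad Czero z) r)); [intros; ring|].
     apply integrable_plus; [|apply integrable_scal]; auto. }
2: { apply integrable_scal; auto. }
assert (A1 := HL (r + 1) ltac:(lra)). assert (A2 := HL r Hr).
set (X := sint sigma s (disc r)) in *. 
set (Y1 := sint sigma s (fun z => lnp (rad Czero z) (r + 1))) in *.
set (Y2 := sint sigma s (fun z => lnp (rad Czero z) r)) in *.
assert (HX : Rabs (L * X) <= 2 * Cd + CA * 2).
{ assert (/ r * (CA * (r + 1)) <= CA * 2).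
  { replace (/ r * (CA * (r + 1))) with (CA * (1 + / r)) by (field; lra).
    apply Rmult_le_compat_l; [lra|]. assert (/ r <= / 1) by (apply Rinv_le_contravar; lra). lra. }
  apply Rabs_le_between in E. apply Rabs_le_between in A1. apply Rabs_le_between in A2.
  apply Rabs_le. lra. }
rewrite Rabs_mult, (Rabs_right L) in HX.
- pose proof (Rabs_pos X).
  assert (HX2 : / (2 * r) * Rabs X <= 2 * Cd + CA * 2) by (eapply Rle_trans; [apply Rmult_le_compat_r; eassumption|exact HX]).
  apply Rmult_le_compat_l with (r := 2 * r) in HX2; [|lra].
  replace (2 * r * (/ (2 * r) * Rabs X)) with (Rabs X) in HX2 by (field; lra). lra.
- apply Rle_ge. eapply Rle_trans; [|exact HL2]. left. apply Rinv_0_lt_compat. lra.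
Qed.

End Counting.

(** * Radial averages *)

Lemma is_RInt_zero (a b : R) : is_RInt (fun _ => 0) a b 0.
Proof.
assert (H := @is_RInt_const R_NormedModule a b 0). unfold scal in H; simpl in H.
unfold mult in H; simpl in H. rewrite Rmult_0_r in H. exact H.
Qed.

(** The radial weights vanish up to the distance m of a point and are smooth beyond it. With the
    primitive normalised to 0 at m, the position of m relative to the interval only decides which
    end values survive. *)
Lemma is_RInt_piecewise (f g G : R -> R) (m a b : R) :
  a <= b ->
  (forall t, t < m -> f t = 0) -> (forall t, m < t -> f t = g t) -> G m = 0 ->
  (forall t, m <= t -> is_derive G t (g t)) -> (forall t, m <= t -> continuous g t) ->
  is_RInt f a b ((if Rlt_dec m b then G b else 0) - (if Rlt_dec m a then G a else 0)).
Proof.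
intros Hab H0 Hg Gm HG Hc.
assert (W : forall u v, u <= v -> v <= m -> is_RInt f u v 0).
{ intros u v Huv Hv. apply (is_RInt_ext (fun _ => 0)).
  - intros x. rewrite Rmin_left, Rmax_right by exact Huv. intros. rewrite H0; lra.
  - apply is_RInt_zero. }
assert (V : forall u v, u <= v -> m <= u -> is_RInt f u v (G v - G u)).
{ intros u v Huv Hu. apply (is_RInt_ext g).
  - intros x. rewrite Rmin_left, Rmax_right by exact Huv. intros. rewrite Hg; lra.
  - apply (@is_RInt_derive R_CompleteNormedModule); intros x; rewrite Rmin_left, Rmax_right by exact Huv; intros; [apply HG|apply Hc]; lra. }
destruct (Rlt_dec m b) as [Lb|Lb]; destruct (Rlt_dec m a) as [La|La].
- apply V; lra.
- replace (G b - 0) with (plus 0 (G b - G m)) by (unfold plus; simpl; rewrite Gm; ring).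
  apply (@is_RInt_Chasles R_NormedModule) with m; [apply W|apply V]; lra.
- exfalso; lra.
- rewrite Rminus_diag. apply W; lra.
Qed.

Lemma lnp_integral_ind (m r : R) : 1 <= m -> 1 <= r -> is_RInt (fun t => ind (m < t) / t) 1 r (lnp m r).
Proof.
intros Hm Hr.
assert (H := is_RInt_piecewise (fun t => ind (m < t) / t) (fun t => / t) (fun t => ln (t / m)) m 1 r Hr).
cbv beta in H. unfold lnp. destruct (Rlt_dec m 1) as [E|E]; [exfalso; lra|]. rewrite Rminus_0_r in H.
apply H.
- intros t Ht. rewrite ind_false by lra. unfold Rdiv; ring.
- intros t Ht. rewrite ind_true by lra. unfold Rdiv; ring.
- unfold Rdiv. rewrite Rinv_r by lra. apply ln_1.
- intros t Ht. auto_derive; [|field; lra].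
  apply Rmult_lt_0_compat; [lra|]. apply Rinv_0_lt_compat; lra.
- intros t Ht. apply (@ex_derive_continuous _ R_NormedModule). auto_derive. lra.
Qed.

(** The positive part of 1/m^2 - 1/t^2. Times conj w, with |w| = m < t, it is the kernel 1/w - conj
    w / t^2 from the definition of alpha. *)
Definition sqp (m t : R) : R := if Rlt_dec m t then / (m * m) - / (t * t) else 0.

(** This is the integration by parts that turns the weights of (e) into those of alpha: 1/m^2 -
    1/t^2 - (2/t^2) log (t/m) has t-derivative (4/t^3) log (t/m). *)
Lemma lnp_integral_inv_cube (m a b : R) : 1 <= m -> 1 <= a <= b ->
  is_RInt (fun t => 4 / t ^ 3 * lnp m t) a b
    ((sqp m b - 2 / (b * b) * lnp m b) - (sqp m a - 2 / (a * a) * lnp m a)).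
Proof.
intros Hm Hab.
assert (H := is_RInt_piecewise (fun t => 4 / t ^ 3 * lnp m t) (fun t => 4 / t ^ 3 * ln (t / m))
  (fun t => / (m * m) - / (t * t) - 2 / (t * t) * ln (t / m)) m a b ltac:(lra)).
cbv beta in H. unfold lnp at 2 3, sqp.
assert (HD : forall t, m <= t -> 0 < t * / m).
{ intros t Ht. apply Rmult_lt_0_compat; [lra|]. apply Rinv_0_lt_compat; lra. }
destruct (Rlt_dec m b) as [Lb|Lb]; destruct (Rlt_dec m a) as [La|La]; try (exfalso; lra);
  rewrite ?Rmult_0_r, ?Rminus_0_r in *; apply H; clear H.
all: try (intros t Ht; rewrite lnp_zero by lra; ring).
all: try (intros t Ht; rewrite lnp_pos by lra; reflexivity).
all: try (unfold Rdiv; rewrite Rinv_r by lra; rewrite ln_1; ring).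
all: try (intros t Ht; apply (@ex_derive_continuous _ R_NormedModule); auto_derive; repeat split; auto; assert (0 < t * (t * (t * 1))) by (repeat apply Rmult_lt_0_compat; lra); lra).
all: intros t Ht; auto_derive; [repeat split; auto; nra|].
all: change (ln (t * / m)) with (ln (t / m)); field; lra.
Qed.

(** The mean over the disc |w| < r of [lnp m] at |w|, that is (2/r^2) times the integral of t
    [lnp m t]; the range t < 1 contributes nothing as m >= 1. *)
Definition areap (m r : R) : R :=
  if Rlt_dec m r then ln (r / m) - / 2 * (1 - m * m / (r * r)) else 0.

Lemma lnp_integral_id (m r : R) : 1 <= m -> 1 <= r ->
  is_RInt (fun t => t * lnp m t) 1 r (r * r / 2 * areap m r).
Proof.
intros Hm Hr.
assert (H := is_RInt_piecewise (fun t => t * lnp m t) (fun t => t * ln (t / m))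
  (fun t => t * t / 2 * ln (t / m) - / 4 * (t * t - m * m)) m 1 r Hr).
cbv beta in H. unfold areap. destruct (Rlt_dec m 1) as [E|E]; [exfalso; lra|]. rewrite Rminus_0_r in H.
assert (HD : forall t, m <= t -> 0 < t * / m).
{ intros t Ht. apply Rmult_lt_0_compat; [lra|]. apply Rinv_0_lt_compat; lra. }
replace (r * r / 2 * (if Rlt_dec m r then ln (r / m) - / 2 * (1 - m * m / (r * r)) else 0)) with
 (if Rlt_dec m r then r * r / 2 * ln (r / m) - / 4 * (r * r - m * m) else 0)
 by (destruct (Rlt_dec m r); [field; lra|ring]).
apply H.
- intros t Ht. rewrite lnp_zero by lra. ring.
- intros t Ht. rewrite lnp_pos by lra. reflexivity.
- unfold Rdiv. rewrite Rinv_r by lra. rewrite ln_1. ring.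
- intros t Ht. auto_derive; [auto|]. change (ln (t * / m)) with (ln (t / m)). field. lra.
- intros t Ht. apply (@ex_derive_continuous _ R_NormedModule). auto_derive. auto.
Qed.

Lemma is_RInt_psum (w : nat -> R) (f : nat -> R -> R) (l : nat -> R) (a b : R) (N : nat) :
  (forall n, is_RInt (f n) a b (l n)) ->
  is_RInt (fun t => psum (fun n => w n * f n t) N) a b (psum (fun n => w n * l n) N).
Proof.
intros H. induction N as [|N IH]; simpl.
- apply is_RInt_zero.
- apply (@is_RInt_plus R_NormedModule); [exact IH|].
  apply (@is_RInt_scal R_NormedModule). apply H.
Qed.

Lemma is_RInt_abs_le (f h : R -> R) (a b I J : R) :
  a <= b -> is_RInt f a b I -> is_RInt h a b J ->
  (forall t, a < t < b -> Rabs (f t) <= h t) -> Rabs I <= J.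
Proof.
intros Hab Hf Hh H. apply Rabs_le. split.
- replace (- J) with (opp J) by reflexivity.
  apply (is_RInt_le (fun t => opp (h t)) f a b); [exact Hab|apply (@is_RInt_opp R_NormedModule), Hh|exact Hf|].
  intros t Ht. specialize (H t Ht). apply Rabs_le_between in H. unfold opp; simpl. lra.
- apply (is_RInt_le f h a b); [exact Hab|exact Hf|exact Hh|].
  intros t Ht. specialize (H t Ht). apply Rabs_le_between in H. lra.
Qed.

Section RadialAverages.

Context (sigma : nat -> R) (s : nat -> Cx) (LF : loc_finite sigma s) (c : Cx) (g : Cx -> R).

(** For t > 1 the conditions [rad c z < t] and |z - c| < t agree, so the sums over discs in (d) and
    (e) integrate to sums with the weight [lnp]. *)
Lemma is_RInt_disc_sum (r : R) : 1 <= r ->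
  is_RInt (fun t => sint sigma s (fun z => g z * ind (Cnorm (Csub z c) < t)) / t) 1 r
    (sint sigma s (fun z => g z * lnp (rad c z) r)).
Proof.
intros Hr. destruct (sint_psum sigma s (Cnorm c + r) LF) as [N HN].
specialize (HN N (Nat.le_refl N)).
rewrite (HN (fun z => g z * lnp (rad c z) r)).
2: { intros z Hz. rewrite lnp_outside by exact Hz. ring. }
apply (is_RInt_ext (fun t => psum (fun n => (sigma n * g (s n)) * (ind (rad c (s n) < t) / t)) N)).
- intros t. rewrite Rmin_left, Rmax_right by exact Hr. intros Ht.
  rewrite HN.
  2: { intros z Hz. rewrite ind_false; [ring|]. assert (H := Cnorm_sub_ge z c). lra. }
  unfold Rdiv. rewrite Rmult_comm, <- psum_scal. apply psum_ext. intros n _.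
  rewrite (ind_iff (rad c (s n) < t) (Cnorm (Csub (s n) c) < t)); [ring|].
  unfold rad, Rmax. destruct (Rle_dec 1 (Cnorm (Csub (s n) c))); lra.
- replace (psum (fun n => sigma n * (g (s n) * lnp (rad c (s n)) r)) N) with
    (psum (fun n => (sigma n * g (s n)) * lnp (rad c (s n)) r) N) by (apply psum_ext; intros; ring).
  apply (is_RInt_psum (fun n => sigma n * g (s n)) (fun n t => ind (rad c (s n) < t) / t)).
  intros n. apply lnp_integral_ind; [apply rad_ge1|exact Hr].
Qed.

(** By [lnp_integral_inv_cube], the bound C t on the sums makes the integral contribute at most 4 C
    (1/r1 - 1/r2) and the boundary terms 2 C/r1 and 2 C/r2. The decay in r1 gives convergence of the
    moment at the origin, the case r1 = 1 its uniform boundedness. *)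
Lemma sqp_increment (C r1 r2 : R) :
  (forall t, 1 <= t -> Rabs (sint sigma s (fun z => g z * lnp (rad c z) t)) <= C * t) ->
  1 <= r1 <= r2 ->
  Rabs (sint sigma s (fun z => g z * sqp (rad c z) r2) - sint sigma s (fun z => g z * sqp (rad c z) r1))
    <= 8 * C / r1.
Proof.
intros HC Hr. destruct (sint_psum sigma s (Cnorm c + r2) LF) as [N HN].
specialize (HN N (Nat.le_refl N)).
assert (HC0 : 0 <= C).
{ assert (A := HC 1 ltac:(lra)). rewrite Rmult_1_r in A. eapply Rle_trans; [apply Rabs_pos|exact A]. }
set (P := fun t => sint sigma s (fun z => g z * lnp (rad c z) t)).
set (S := fun t => sint sigma s (fun z => g z * sqp (rad c z) t)).
assert (HP : forall t, t <= r2 -> P t = psum (fun n => sigma n * (g (s n) * lnp (rad c (s n)) t)) N).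
{ intros t Ht. apply (HN (fun z => g z * lnp (rad c z) t)). intros z Hz. rewrite lnp_outside by lra. ring. }
assert (HS : forall t, t <= r2 -> S t = psum (fun n => sigma n * (g (s n) * sqp (rad c (s n)) t)) N).
{ intros t Ht. apply (HN (fun z => g z * sqp (rad c z) t)). intros z Hz.
  unfold sqp. pose proof (rad_ge_Cnorm c z). destruct (Rlt_dec (rad c z) t); [exfalso; lra|ring]. }
assert (A : is_RInt (fun t => 4 / t ^ 3 * P t) r1 r2
   ((S r2 - 2 / (r2 * r2) * P r2) - (S r1 - 2 / (r1 * r1) * P r1))).
{ apply (is_RInt_ext (fun t => psum (fun n => (sigma n * g (s n)) * (4 / t ^ 3 * lnp (rad c (s n)) t)) N)).
  - intros t. rewrite Rmin_left, Rmax_right by lra. intros Ht. rewrite HP by lra.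
    rewrite <- psum_scal. apply psum_ext. intros; ring.
  - rewrite !HS, !HP by lra.
    replace (_ - _) with (psum (fun n => (sigma n * g (s n)) * ((sqp (rad c (s n)) r2 - 2 / (r2 * r2) * lnp (rad c (s n)) r2)
        - (sqp (rad c (s n)) r1 - 2 / (r1 * r1) * lnp (rad c (s n)) r1))) N).
    + apply (is_RInt_psum (fun n => sigma n * g (s n))  (fun n t => 4 / t ^ 3 * lnp (rad c (s n)) t)).
      intros n. apply lnp_integral_inv_cube; [apply rad_ge1|exact Hr].
    + clear. induction N as [|N IH]; simpl; [ring|]. rewrite IH. ring. }
assert (B : is_RInt (fun t => 4 * C / (t * t)) r1 r2 (- (4 * C / r2) - - (4 * C / r1))).
{ apply (@is_RInt_derive R_CompleteNormedModule (fun t => - (4 * C / t))); intros t; rewrite Rmin_left, Rmax_right by lra; intros Ht.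
  - auto_derive; [lra|]. field. lra.
  - apply (@ex_derive_continuous _ R_NormedModule). auto_derive. nra. }
assert (E := is_RInt_abs_le _ _ _ _ _ _ (proj2 Hr) A B).
assert (H4 : Rabs (S r2 - 2 / (r2 * r2) * P r2 - (S r1 - 2 / (r1 * r1) * P r1)) <= - (4 * C / r2) - - (4 * C / r1)).
{ apply E. intros t Ht. assert (0 < t ^ 3) by (apply pow_lt; lra).
  rewrite Rabs_mult, (Rabs_right (4 / t ^ 3)) by (apply Rle_ge, Rdiv_le_0_compat; lra).
  apply Rle_trans with (4 / t ^ 3 * (C * t)).
  - apply Rmult_le_compat_l; [apply Rdiv_le_0_compat; lra|]. apply HC. lra.
  - right. field. lra. }
assert (Q : forall t, 1 <= t -> Rabs (2 / (t * t) * P t) <= 2 * C / t).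
{ intros t Ht. rewrite Rabs_mult, (Rabs_right (2 / (t * t))) by (apply Rle_ge, Rdiv_le_0_compat; nra).
  apply Rle_trans with (2 / (t * t) * (C * t)).
  - apply Rmult_le_compat_l; [apply Rdiv_le_0_compat; nra|]. apply HC, Ht.
  - right. field. lra. }
assert (Q1 := Q r1 ltac:(lra)). assert (Q2 := Q r2 ltac:(lra)).
assert (M : C / r2 <= C / r1).
{ apply Rmult_le_compat_l; [exact HC0|]. apply Rinv_le_contravar; lra. }
assert (0 <= C / r2) by (apply Rdiv_le_0_compat; lra).
apply Rabs_le_between in H4. apply Rabs_le_between in Q1. apply Rabs_le_between in Q2.
replace (8 * C / r1) with (8 * (C / r1)) by (unfold Rdiv; ring).
replace (2 * C / r1) with (2 * (C / r1)) in Q1 by (unfold Rdiv; ring).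
replace (2 * C / r2) with (2 * (C / r2)) in Q2 by (unfold Rdiv; ring).
replace (4 * C / r1) with (4 * (C / r1)) in H4 by (unfold Rdiv; ring).
replace (4 * C / r2) with (4 * (C / r2)) in H4 by (unfold Rdiv; ring).
fold (S r1) (S r2). apply Rabs_le. lra.
Qed.

(** The increment is started at r1 = 1, where every weight vanishes because [rad] is at least 1. *)
Lemma sqp_bounded (C r : R) :
  (forall t, 1 <= t -> Rabs (sint sigma s (fun z => g z * lnp (rad c z) t)) <= C * t) ->
  1 <= r -> Rabs (sint sigma s (fun z => g z * sqp (rad c z) r)) <= 8 * C.
Proof.
intros HC Hr. assert (A := sqp_increment C 1 r HC ltac:(lra)).
replace (sint sigma s (fun z => g z * sqp (rad c z) 1)) with 0 in A.
- rewrite Rminus_0_r, Rdiv_1_r in A. exact A.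
- symmetry. apply is_series_unique. apply (is_series_finite _ 0). intros n _.
  unfold sqp. pose proof (rad_ge1 c (s n)). destruct (Rlt_dec (rad c (s n)) 1); [exfalso; lra|ring].
Qed.

End RadialAverages.

Lemma areap_integrable (sigma : nat -> R) (s : nat -> Cx) (LF : loc_finite sigma s) (c : Cx) (r : R) :
  integrable sigma s (fun z => areap (rad c z) r).
Proof.
apply integrable_compact with (Cnorm c + r); [exact LF|]. intros z Hz.
unfold areap. pose proof (rad_ge_Cnorm c z). destruct (Rlt_dec (rad c z) r); [exfalso; lra|ring].
Qed.

(** An average over a disc of quantities bounded by C is bounded by C. *)
Lemma areap_bounded (sigma : nat -> R) (s : nat -> Cx) (LF : loc_finite sigma s) (c : Cx) (C r : R) :
  (forall t, 1 <= t -> Rabs (sint sigma s (fun z => lnp (rad c z) t)) <= C) ->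
  1 <= r -> Rabs (sint sigma s (fun z => areap (rad c z) r)) <= C.
Proof.
intros HC Hr. destruct (sint_psum sigma s (Cnorm c + r) LF) as [N HN].
specialize (HN N (Nat.le_refl N)).
assert (HC0 : 0 <= C) by (eapply Rle_trans; [apply Rabs_pos|exact (HC 1 ltac:(lra))]).
set (X := sint sigma s (fun z => areap (rad c z) r)).
assert (HX : X = psum (fun n => sigma n * areap (rad c (s n)) r) N).
{ apply (HN (fun z => areap (rad c z) r)). intros z Hz.
  unfold areap. pose proof (rad_ge_Cnorm c z). destruct (Rlt_dec (rad c z) r); [exfalso; lra|ring]. }
assert (A : is_RInt (fun t => t * sint sigma s (fun z => lnp (rad c z) t)) 1 r (r * r / 2 * X)).
{ apply (is_RInt_ext (fun t => psum (fun n => sigma n * (t * lnp (rad c (s n)) t)) N)).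
  - intros t. rewrite Rmin_left, Rmax_right by lra. intros Ht.
    rewrite (HN (fun z => lnp (rad c z) t)) by (intros; apply lnp_outside; lra).
    rewrite <- psum_scal. apply psum_ext. intros; ring.
  - rewrite HX, <- psum_scal.
    rewrite (psum_ext _ (fun n => sigma n * (r * r / 2 * areap (rad c (s n)) r))) by (intros; ring).
    apply (is_RInt_psum sigma (fun n t => t * lnp (rad c (s n)) t)).
    intros n. apply lnp_integral_id; [apply rad_ge1|exact Hr]. }
assert (B : is_RInt (fun t => C * t) 1 r (C * r * r / 2 - C * 1 * 1 / 2)).
{ apply (@is_RInt_derive R_CompleteNormedModule (fun t => C * t * t / 2)); intros t _.
  - auto_derive; [trivial|]. field.
  - apply (@ex_derive_continuous _ R_NormedModule). auto_derive. trivial. }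
assert (E : Rabs (r * r / 2 * X) <= C * r * r / 2 - C * 1 * 1 / 2).
{ apply (is_RInt_abs_le _ _ _ _ _ _ Hr A B). intros t Ht.
  rewrite Rabs_mult, (Rabs_right t) by lra. rewrite Rmult_comm.
  apply Rmult_le_compat_r; [lra|]. apply HC. lra. }
rewrite Rabs_mult, (Rabs_right (r * r / 2)) in E by nra.
apply Rmult_le_reg_l with (r * r / 2); [nra|]. lra.
Qed.

(** * The logarithm of the canonical product *)

Lemma Cadd_assoc (x y z : Cx) : Cadd (Cadd x y) z = Cadd x (Cadd y z).
Proof. ring. Qed.

Definition unit_weights (sigma : nat -> R) : Prop :=
  forall n, sigma n = 0 \/ sigma n = 1 \/ sigma n = -1.

(** Integer weights are what makes the branch of each logarithm irrelevant: an error in 2 pi i Z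
    stays in 2 pi i Z. *)
Lemma Cexp_weighted_psum_ext (sigma : nat -> R) (P Q : nat -> Cx) (N : nat) :
  unit_weights sigma -> (forall n, sigma n <> 0 -> Cexp (P n) = Cexp (Q n)) ->
  Cexp (mkCx (psum (fun n => sigma n * Re (P n)) N) (psum (fun n => sigma n * Im (P n)) N)) =
  Cexp (mkCx (psum (fun n => sigma n * Re (Q n)) N) (psum (fun n => sigma n * Im (Q n)) N)).
Proof.
intros Hs H. induction N as [|N IH]; [reflexivity|]. simpl.
assert (E : forall x y u v, mkCx (x + u) (y + v) = Cadd (mkCx x y) (mkCx u v)) by reflexivity.
rewrite !E, !Cexp_add, IH. f_equal.
assert (E' : forall p : Cx, mkCx (1 * Re p) (1 * Im p) = p) by (intros; cx).
assert (E'' : forall p : Cx, mkCx (-1 * Re p) (-1 * Im p) = Copp p) by (intros; cx).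
destruct (Hs N) as [A|[A|A]]; rewrite A.
- f_equal. cx.
- rewrite !E'. apply H. lra.
- rewrite !E'', !Cexp_opp. rewrite H; [reflexivity|lra].
Qed.

(** The two sums need not be close to each other, so the exponentials are compared on discs, where
    the sums are finite, and the equality passes to the limit. *)
Lemma Cexp_sintC_ext (sigma : nat -> R) (s : nat -> Cx) (P Q : Cx -> Cx) :
  loc_finite sigma s -> unit_weights sigma ->
  (forall z, supp sigma s z -> Cexp (P z) = Cexp (Q z)) ->
  integrableC sigma s P -> integrableC sigma s Q ->
  Cexp (sintC sigma s P) = Cexp (sintC sigma s Q).
Proof.
intros LF Hs H HP HQ.
apply Clim_infty_unique with (fun r => Cexp (sintC sigma s (fun z => Cmul (RtoC (disc r z)) (P z)))).
- apply Clim_infty_exp, sintC_disc_tends, HP.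
- apply (Clim_infty_eventually_eq _ (fun r => Cexp (sintC sigma s (fun z => Cmul (RtoC (disc r z)) (Q z)))) _ 0).
  2: apply Clim_infty_exp, sintC_disc_tends, HQ.
  intros r _. destruct (sint_psum sigma s r LF) as [N HN]. specialize (HN N (Nat.le_refl N)).
  unfold sintC.
  rewrite !HN by (intros z Hz; simpl; rewrite disc_outside by exact Hz; ring).
  apply (Cexp_weighted_psum_ext sigma (fun n => Cmul (RtoC (disc r (s n))) (P (s n)))
     (fun n => Cmul (RtoC (disc r (s n))) (Q (s n)))); [exact Hs|].
  intros n Hn. unfold disc, ind. destruct excluded_middle_informative.
  + assert (E : forall p, Cmul (RtoC 1) p = p) by (intros; cx). rewrite !E. apply H. exists n; auto.
  + f_equal. cx.
Qed.

Lemma C_differentiable_at_of_quadratic (g : Cx -> Cx) (z d : Cx) (K delta : R) :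
  delta > 0 ->
  (forall h, Cnorm h < delta -> Cnorm (Csub (Csub (g (Cadd z h)) (g z)) (Cmul d h)) <= K * (Cnorm h * Cnorm h)) ->
  C_differentiable_at g z.
Proof.
intros Hd H. exists d. intros eps He.
assert (HK : 0 <= Rabs K) by apply Rabs_pos.
exists (Rmin delta (eps / (Rabs K + 1))). split.
{ apply Rmin_pos; [lra|]. apply Rdiv_lt_0_compat; lra. }
intros h [H0 H1].
assert (A := Rlt_le_trans _ _ _ H1 (Rmin_l _ _)). assert (B := Rlt_le_trans _ _ _ H1 (Rmin_r _ _)).
apply Rlt_div_r in B; [|lra].
assert (Hh := Cnorm_neq0 h H0).
replace (Csub (Cdiv (Csub (g (Cadd z h)) (g z)) h) d) with
  (Cdiv (Csub (Csub (g (Cadd z h)) (g z)) (Cmul d h)) h) by (field; exact Hh).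
rewrite Cnorm_div by exact Hh. apply Rlt_div_l; [exact H0|].
eapply Rle_lt_trans; [apply H, A|]. pose proof (Rle_abs K). nra.
Qed.

(** The point c itself is excluded, so this serves at regular points as well as at zeros and poles.
    Only finitely many points lie within distance 1 of c, and d <= 1 covers the others. *)
Lemma dist_to_supp_pos (sigma : nat -> R) (s : nat -> Cx) (c : Cx) :
  loc_finite sigma s -> exists d, 0 < d <= 1 /\ forall z, supp sigma s z -> z <> c -> d <= Cnorm (Csub z c).
Proof.
intros LF. destruct (LF (Cnorm c + 1)) as [N HN].
assert (H : forall M, exists d, 0 < d <= 1 /\ forall n, (n < M)%nat -> sigma n <> 0 -> s n <> c -> d <= Cnorm (Csub (s n) c)).
{ induction M as [|M [d [Hd H]]]; [exists 1; split; [lra|intros; lia]|].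
  destruct (classic (s M = c)) as [E|E].
  - exists d. split; [exact Hd|]. intros n Hn Hs Hc. apply H; try assumption.
    destruct (Nat.eq_dec n M) as [->|]; [contradiction|lia].
  - exists (Rmin d (Cnorm (Csub (s M) c))). split.
    + split; [apply Rmin_pos; [lra|apply Cnorm_pos, Csub_neq0, E]|]. eapply Rle_trans; [apply Rmin_l|lra].
    + intros n Hn Hs Hc. destruct (Nat.eq_dec n M) as [->|]; [apply Rmin_r|].
      eapply Rle_trans; [apply Rmin_l|apply H; auto; lia]. }
destruct (H N) as [d [Hd Hd']]. exists d. split; [exact Hd|].
intros z [n [Hn Hz]] Hc. subst z. destruct (Nat.lt_ge_cases n N) as [L|L]; [apply Hd'; auto|].
assert (A : Cnorm c + 1 < Cnorm (s n)).
{ apply Rnot_le_lt. intros Hle. apply Hn, HN; assumption. }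
assert (B := Cnorm_sub_ge (s n) c). lra.
Qed.

Section LogProduct.

Context (sigma : nat -> R) (s : nat -> Cx) (LF : loc_finite sigma s) (Cb : R).
Context (Hcount : forall c, sint (absw sigma) s (fun z => ind (Cnorm (Csub z c) <= 1)) <= Cb).
Context (H0 : forall z, supp sigma s z -> z <> Czero) (Hs : unit_weights sigma).

(** With B the limit of the sums of a^-2, this is a logarithm of the function of the theorem.
    [alpha] and [B] are free parameters so that the same lemmas apply after changing the sign of the
    measure or removing a point from it. *)
Definition logF (alpha B z : Cx) : Cx :=
  Cadd (Csub (Cmul alpha z) (Cmul (Cmul (RtoC (1/2)) (Cmul z z)) B))
    (sintC sigma s (fun a => Clog_rem (Cdiv z a))).

(* v_a(z) = 1/(z - a) + 1/a + z/a^2, the derivative in z of Clog_rem (z/a). *)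
Definition dlog_rem (z a : Cx) : Cx := Copp (Cdiv (Cmul z z) (Cmul (Cmul a a) (Csub a z))).

Definition dlogF (alpha B z : Cx) : Cx :=
  Cadd (Csub alpha (Cmul z B)) (sintC sigma s (dlog_rem z)).

Lemma supp_far (z a : Cx) : 2 * Cnorm z + 1 < Cnorm a -> Cnorm a / 2 <= Cnorm (Csub a z).
Proof. intros H. assert (A := Cnorm_sub_ge a z). lra. Qed.

Lemma Clog_rem_integrable (z : Cx) : integrableC sigma s (fun a => Clog_rem (Cdiv z a)).
Proof.
apply integrableC_of_cube_bound with Cb (2 * Cnorm z + 1) (4 * Cnorm z ^ 3); try assumption.
intros a Ha Hr. pose proof (Cnorm_ge0 z). assert (Ha0 := H0 a Ha).
assert (E : Cnorm (Cdiv z a) = Cnorm z / Cnorm a) by (apply Cnorm_div, Ha0).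
eapply Rle_trans; [apply Clog_rem_bound|].
- rewrite E. apply Rle_div_l; lra.
- rewrite E. right. field. lra.
Qed.

Lemma dlog_rem_integrable (z : Cx) : integrableC sigma s (dlog_rem z).
Proof.
apply integrableC_of_cube_bound with Cb (2 * Cnorm z + 1) (2 * (Cnorm z * Cnorm z)); try assumption.
intros a Ha Hr. pose proof (Cnorm_ge0 z). assert (Ha0 := H0 a Ha). assert (Hf := supp_far z a Hr).
assert (Hn : Csub a z <> Czero) by (apply Cnorm_neq0; lra).
unfold dlog_rem. rewrite Cnorm_opp, Cnorm_div.
2: { intros E. apply Cmul_eq0 in E. destruct E as [E|E]; [apply Cmul_eq0 in E; tauto|tauto]. }
rewrite !Cnorm_mul. set (x := Cnorm a) in *. set (y := Cnorm z) in *. set (w := Cnorm (Csub a z)) in *.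
apply Rle_trans with ((y * y) / (x * x * (x / 2))).
- apply Rmult_le_compat_l; [nra|]. apply Rinv_le_contravar; [repeat apply Rmult_lt_0_compat; lra|].
  apply Rmult_le_compat_l; [nra|lra].
- right. field. lra.
Qed.

(* log ((1 - (z+h)/a) / (1 - z/a)), corrected by the quadratic Weierstrass terms. *)
Definition log_incr (z h a : Cx) : Cx :=
  Cadd (Cmul h (dlog_rem z a))
    (Csub (Clog_rem (Cdiv h (Csub a z)))
       (Cmul (Cmul (RtoC (1/2)) (Cmul h h))
          (Csub (Cinv (Cmul (Csub a z) (Csub a z))) (Cinv (Cmul a a))))).

(** Rests on 1 - (z+h)/a = (1 - z/a)(1 - h/(a-z)). The equality holds only after exponentiation,
    since the three logarithms may lie on different branches. *)
Lemma Cexp_log_incr (z h a : Cx) : a <> Czero -> a <> z -> a <> Cadd z h ->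
  Cexp (Clog_rem (Cdiv (Cadd z h) a)) = Cexp (Cadd (Clog_rem (Cdiv z a)) (log_incr z h a)).
Proof.
intros A0 A1 A2.
assert (B1 : Csub a z <> Czero) by (apply Csub_neq0, A1).
assert (N1 : Cdiv (Cadd z h) a <> Cone).
{ intros E. apply A2. replace (Cadd z h) with (Cmul (Cdiv (Cadd z h) a) a) by (field; exact A0). rewrite E. ring. }
assert (N2 : Cdiv z a <> Cone).
{ intros E. apply A1. replace z with (Cmul (Cdiv z a) a) by (field; exact A0). rewrite E. ring. }
assert (N3 : Cdiv h (Csub a z) <> Cone).
{ intros E. apply A2. replace h with (Cmul (Cdiv h (Csub a z)) (Csub a z)) by (field; exact B1). rewrite E. ring. }
unfold log_incr, Clog_rem.
set (x1 := Cdiv (Cadd z h) a) in *. set (x2 := Cdiv z a) in *. set (x3 := Cdiv h (Csub a z)) in *.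
set (y := Cadd x1 (Cmul (RtoC (1/2)) (Cmul x1 x1))).
replace (Cadd (Cadd (Clog1m x2) (Cadd x2 (Cmul (RtoC (1 / 2)) (Cmul x2 x2)))) _) with
  (Cadd (Cadd (Clog1m x2) (Clog1m x3)) y).
- rewrite !Cexp_add, !Cexp_Clog1m by assumption. f_equal. unfold x1, x2, x3. field. split; assumption.
- unfold y, x1, x2, x3, dlog_rem.
  replace (RtoC (1/2)) with (Cinv (Cadd Cone Cone)) by (apply Cx_eq; simpl; field).
  field. repeat split; try assumption.
  intros E. apply (f_equal Re) in E. simpl in E. lra.
Qed.

(** The majorant has two parts: the cubic bound for [Clog_rem] at h/(a-z), with one factor |h| <= 1
    dropped, and 1/(a-z)^2 - 1/a^2 = z(2a-z)/((a-z)^2 a^2), which is also O(|a|^-3). Neither depends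
    on h, so the sum over a is quadratic in h. *)
Lemma log_incr_remainder (z : Cx) : ~ supp sigma s z ->
  exists G : Cx -> R, integrable sigma s G /\ (forall a, supp sigma s a -> 0 <= G a) /\
  exists delta, 0 < delta <= 1 /\ forall h, Cnorm h < delta ->
   forall a, supp sigma s a -> a <> Cadd z h /\
     Cnorm (Csub (log_incr z h a) (Cmul h (dlog_rem z a))) <= Cnorm h * Cnorm h * G a.
Proof.
intros Hz. destruct (dist_to_supp_pos sigma s z LF) as [d [Hd Hd']].
set (y := Cnorm z). assert (Hy : 0 <= y) by apply Cnorm_ge0.
assert (Hd'' : forall a, supp sigma s a -> d <= Cnorm (Csub a z)).
{ intros a Ha. apply Hd'; [exact Ha|]. intros ->. contradiction. }
set (G := fun a => 4 / Cnorm (Csub a z) ^ 3 + / 2 * (y * (2 * Cnorm a + y)) /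
   ((Cnorm (Csub a z) * Cnorm (Csub a z)) * (Cnorm a * Cnorm a))).
assert (HG0 : forall a, supp sigma s a -> 0 <= G a).
{ intros a Ha. specialize (Hd'' a Ha). assert (A := Cnorm_pos a (H0 a Ha)). unfold G.
  apply Rplus_le_le_0_compat; apply Rdiv_le_0_compat; try lra; try (apply pow_lt; lra).
  - apply Rmult_le_pos; [lra|]. nra.
  - repeat apply Rmult_lt_0_compat; lra. }
exists G. split; [|split; [exact HG0|]].
- apply integrable_of_cube_bound with Cb (2 * y + 1) (32 + 6 * y); try assumption.
  intros a Ha Hr. rewrite Rabs_right by apply Rle_ge, HG0, Ha.
  assert (Hf := supp_far z a Hr). unfold G.
  set (x := Cnorm a) in *. set (w := Cnorm (Csub a z)) in *.
  apply Rle_trans with (4 / (x / 2) ^ 3 + / 2 * (y * (3 * x)) / ((x / 2 * (x / 2)) * (x * x))).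
  + apply Rplus_le_compat.
    * apply Rmult_le_compat_l; [lra|]. apply Rinv_le_contravar; [apply pow_lt; lra|]. apply pow_incr; lra.
    * apply Rmult_le_compat.
      -- apply Rmult_le_pos; [lra|nra].
      -- left. apply Rinv_0_lt_compat. repeat apply Rmult_lt_0_compat; lra.
      -- apply Rmult_le_compat_l; [lra|]. apply Rmult_le_compat_l; lra.
      -- apply Rinv_le_contravar; [repeat apply Rmult_lt_0_compat; lra|].
         apply Rmult_le_compat_r; [nra|]. apply Rmult_le_compat; lra.
  + right. field. lra.
(* All points are at distance at least d from z, so |h| < d/2 gives |h/(a-z)| <= 1/2, the range of
   [Clog_rem_bound]. *)
- exists (d / 2). split; [lra|]. intros h Hh a Ha. specialize (Hd'' a Ha).
  assert (Ha0 := H0 a Ha). assert (A := Cnorm_pos a Ha0). pose proof (Cnorm_ge0 h) as Hh0.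
  split.
  { intros E. replace (Csub a z) with h in Hd'' by (rewrite E; ring). lra. }
  assert (Hn : Csub a z <> Czero) by (apply Cnorm_neq0; lra).
  unfold log_incr.
  replace (Csub (Cadd (Cmul h (dlog_rem z a)) _) (Cmul h (dlog_rem z a))) with
    (Csub (Clog_rem (Cdiv h (Csub a z)))
       (Cmul (Cmul (RtoC (1/2)) (Cmul h h))
          (Cdiv (Cmul z (Csub (Cadd a a) z)) (Cmul (Cmul (Csub a z) (Csub a z)) (Cmul a a)))))
    by (field; repeat split; assumption).
  eapply Rle_trans; [apply Cnorm_sub_le|].
  assert (E3 : Cnorm (Cdiv h (Csub a z)) = Cnorm h / Cnorm (Csub a z)) by (apply Cnorm_div, Hn).
  set (w := Cnorm (Csub a z)) in *. set (x := Cnorm a) in *. set (t := Cnorm h) in *.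
  unfold G. fold w x. rewrite Rmult_plus_distr_l. apply Rplus_le_compat.
  + eapply Rle_trans; [apply Clog_rem_bound; rewrite E3; apply Rle_div_l; lra|].
    rewrite E3. assert (0 < / w ^ 3) by (apply Rinv_0_lt_compat, pow_lt; lra).
    replace (4 * (t / w) ^ 3) with (4 * / w ^ 3 * (t * t) * t) by (field; lra).
    replace (t * t * (4 / w ^ 3)) with (4 * / w ^ 3 * (t * t) * 1) by (field; lra).
    apply Rmult_le_compat_l; [|lra]. apply Rmult_le_pos; nra.
  + rewrite !Cnorm_mul, Cnorm_RtoC, (Rabs_right (1/2)) by lra.
    rewrite Cnorm_div.
    2: { intros E. apply Cmul_eq0 in E. destruct E as [E|E]; apply Cmul_eq0 in E; tauto. }
    rewrite !Cnorm_mul. fold w x t y.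
    replace (t * t * (/ 2 * (y * (2 * x + y)) / (w * w * (x * x)))) with
      (1 / 2 * (t * t) * ((y * (2 * x + y)) / (w * w * (x * x)))) by (field; lra).
    apply Rmult_le_compat_l; [nra|]. apply Rmult_le_compat_r.
    * left. apply Rinv_0_lt_compat. repeat apply Rmult_lt_0_compat; lra.
    * apply Rmult_le_compat_l; [exact Hy|]. eapply Rle_trans; [apply Cnorm_sub_le|].
      pose proof (Cnorm_add a a). fold x in H. fold y. lra.
Qed.

(** The increment Y of the logarithm satisfies |Y - D h| <= K1 |h|^2, and e^Y - 1 - D h = (e^Y - 1 -
    Y) + (Y - D h). The radius 1/(K2+1) keeps |Y| <= 1. An explicit quadratic remainder serves both
    the complex derivative and the real derivative along a segment. *)
Lemma Cexp_logF_quadratic (alpha B z : Cx) : ~ supp sigma s z ->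
  exists K delta, delta > 0 /\ forall h, Cnorm h < delta ->
    Cnorm (Csub (Csub (Cexp (logF alpha B (Cadd z h))) (Cexp (logF alpha B z)))
             (Cmul (Cmul (Cexp (logF alpha B z)) (dlogF alpha B z)) h)) <= K * (Cnorm h * Cnorm h).
Proof.
intros Hz. destruct (log_incr_remainder z Hz) as [G [HG [HG0 [d [Hd H]]]]].
set (J := sint (absw sigma) s G).
assert (HJ : 0 <= J) by (apply sint_absw_ge0; assumption).
set (D := dlogF alpha B z).
set (K1 := 2 * J + Cnorm B). assert (HK1 : 0 <= K1) by (pose proof (Cnorm_ge0 B); unfold K1; lra).
set (K2 := Cnorm D + K1). assert (HK2 : 0 <= K2) by (pose proof (Cnorm_ge0 D); unfold K2; lra).
exists (Cnorm (Cexp (logF alpha B z)) * (48 * (K2 * K2) + K1)), (Rmin d (/ (K2 + 1))).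
split; [apply Rmin_pos; [lra|apply Rinv_0_lt_compat; lra]|].
intros h Hh.
assert (A := Rlt_le_trans _ _ _ Hh (Rmin_l _ _)). assert (A' := Rlt_le_trans _ _ _ Hh (Rmin_r _ _)).
specialize (H h A). pose proof (Cnorm_ge0 h) as Hh0.
set (t := Cnorm h) in *.
assert (Hq : integrableC sigma s (fun a => Csub (log_incr z h a) (Cmul h (dlog_rem z a)))).
{ apply integrableC_le with (fun a => t * t * G a); [|apply integrable_scal, HG].
  intros a Ha. apply H, Ha. }
assert (Hv : integrableC sigma s (fun a => Cmul h (dlog_rem z a))).
{ unfold integrableC. apply integrable_ext with (fun a => t * Cnorm (dlog_rem z a)); [intros; apply Cnorm_mul|].
  apply integrable_scal, dlog_rem_integrable. }
assert (Hu : integrableC sigma s (log_incr z h)).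
{ apply integrableC_le with (fun a => Cnorm (Csub (log_incr z h a) (Cmul h (dlog_rem z a))) + Cnorm (Cmul h (dlog_rem z a)));
   [|apply integrable_plus; assumption].
  intros a Ha. replace (log_incr z h a) with (Cadd (Csub (log_incr z h a) (Cmul h (dlog_rem z a))) (Cmul h (dlog_rem z a))) at 1 by ring.
  apply Cnorm_add. }
set (Q := sintC sigma s (fun a => Csub (log_incr z h a) (Cmul h (dlog_rem z a)))).
assert (HQ : Cnorm Q <= 2 * J * (t * t)).
{ eapply Rle_trans; [apply Cnorm_sintC_le with (G := fun a => t * t * G a)|].
  - intros a Ha. apply H, Ha.
  - apply integrable_scal, HG.
  - rewrite sint_scal. fold J. right. ring. }
assert (EU : sintC sigma s (log_incr z h) = Cadd Q (Cmul h (sintC sigma s (dlog_rem z)))).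
{ unfold Q. rewrite sintC_sub by assumption. rewrite sintC_mul_l by apply dlog_rem_integrable. ring. }
assert (EE : Cexp (sintC sigma s (fun a => Clog_rem (Cdiv (Cadd z h) a))) =
   Cmul (Cexp (sintC sigma s (fun a => Clog_rem (Cdiv z a)))) (Cexp (sintC sigma s (log_incr z h)))).
{ rewrite <- Cexp_add, <- sintC_add; [|apply Clog_rem_integrable|exact Hu].
  apply Cexp_sintC_ext; try assumption.
  - intros a Ha. destruct (H a Ha) as [Ha' _].
    apply Cexp_log_incr; [apply H0, Ha| |exact Ha']. intros ->. contradiction.
  - apply Clog_rem_integrable.
  - apply integrableC_le with (fun a => Cnorm (Clog_rem (Cdiv z a)) + Cnorm (log_incr z h a)).
    + intros; apply Cnorm_add.
    + apply integrable_plus; [apply Clog_rem_integrable|exact Hu]. }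
set (Y := Cadd (Cmul D h) (Csub Q (Cmul (Cmul (RtoC (1/2)) (Cmul h h)) B))).
assert (EF : Cexp (logF alpha B (Cadd z h)) = Cmul (Cexp (logF alpha B z)) (Cexp Y)).
{ unfold logF. rewrite (Cexp_add (Csub _ _) (sintC _ _ _)), EE.
  rewrite (Cexp_add (Csub _ _) (sintC _ _ _)).
  replace Y with (Cadd (Csub (Cmul alpha h) (Cmul (Cmul (RtoC (1/2)) (Cadd (Cmul (Cadd z z) h) (Cmul h h))) B))
     (sintC sigma s (log_incr z h))).
  - rewrite (Cexp_add (Csub (Cmul alpha h) _)).
    replace (Csub (Cmul alpha (Cadd z h)) (Cmul (Cmul (RtoC (1 / 2)) (Cmul (Cadd z h) (Cadd z h))) B)) with
     (Cadd (Csub (Cmul alpha z) (Cmul (Cmul (RtoC (1 / 2)) (Cmul z z)) B))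
        (Csub (Cmul alpha h) (Cmul (Cmul (RtoC (1/2)) (Cadd (Cmul (Cadd z z) h) (Cmul h h))) B))) by ring.
    rewrite Cexp_add. ring.
  - rewrite EU. unfold Y, D, dlogF.
    replace (RtoC (1/2)) with (Cinv (Cadd Cone Cone)) by (apply Cx_eq; simpl; field).
    field. intros E. apply (f_equal Re) in E. simpl in E. lra. }
assert (HY1 : Cnorm (Csub Y (Cmul D h)) <= K1 * (t * t)).
{ replace (Csub Y (Cmul D h)) with (Csub Q (Cmul (Cmul (RtoC (1/2)) (Cmul h h)) B)) by (unfold Y; ring).
  eapply Rle_trans; [apply Cnorm_sub_le|]. rewrite !Cnorm_mul, Cnorm_RtoC, (Rabs_right (1/2)) by lra.
  fold t. unfold K1. pose proof (Cnorm_ge0 B). assert (0 <= t * t) by nra. nra. }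
assert (HY : Cnorm Y <= K2 * t).
{ replace Y with (Cadd (Csub Y (Cmul D h)) (Cmul D h)) by ring.
  eapply Rle_trans; [apply Cnorm_add|]. rewrite Cnorm_mul. fold t. unfold K2.
  assert (K1 * (t * t) <= K1 * t) by (apply Rmult_le_compat_l; [exact HK1|nra]). nra. }
assert (HY' : Cnorm Y <= 1).
{ eapply Rle_trans; [exact HY|]. assert (A2 : (K2 + 1) * t < 1).
  { apply Rmult_lt_compat_l with (r := K2 + 1) in A'; [|lra]. rewrite Rinv_r in A' by lra. exact A'. } nra. }
assert (HE := Cexp_taylor1_bound Y HY').
rewrite EF.
replace (Csub (Csub (Cmul (Cexp (logF alpha B z)) (Cexp Y)) (Cexp (logF alpha B z)))
   (Cmul (Cmul (Cexp (logF alpha B z)) D) h)) with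
  (Cmul (Cexp (logF alpha B z)) (Cadd (Csub (Csub (Cexp Y) Cone) Y) (Csub Y (Cmul D h)))) by ring.
rewrite Cnorm_mul, Rmult_assoc. apply Rmult_le_compat_l; [apply Cnorm_ge0|].
eapply Rle_trans; [apply Cnorm_add|]. pose proof (Cnorm_ge0 Y).
assert (Cnorm Y * Cnorm Y <= (K2 * t) * (K2 * t)) by (apply Rmult_le_compat; assumption).
lra.
Qed.

Lemma Cexp_logF_differentiable (alpha B z : Cx) : ~ supp sigma s z ->
  C_differentiable_at (fun w => Cexp (logF alpha B w)) z.
Proof.
intros Hz. destruct (Cexp_logF_quadratic alpha B z Hz) as [K [d [Hd H]]].
apply C_differentiable_at_of_quadratic with (1 := Hd) (2 := H).
Qed.

Lemma disc_integrableC (r : R) (F : Cx -> Cx) :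
  integrableC sigma s (fun a => Cmul (RtoC (disc r a)) (F a)).
Proof.
apply integrableC_compact with r; [exact LF|]. intros z Hz. rewrite disc_outside by exact Hz. cx.
Qed.

(** The quadratic terms added in [Clog_rem] are taken away again by the truncated sums of a^-2; only
    these converge conditionally, and by hypothesis. *)
Lemma logF_tends (alpha B z : Cx) :
  Clim_infty (fun r => sintC sigma s (fun a => Cmul (RtoC (disc r a)) (Cinv (Cmul a a)))) B ->
  Clim_infty (fun r => Cadd (Cmul alpha z) (sintC sigma s
     (fun a => Cmul (RtoC (disc r a)) (Cadd (Clog1m (Cdiv z a)) (Cdiv z a))))) (logF alpha B z).
Proof.
intros HB.
apply (Clim_infty_eventually_eq _ (fun r => Cadd (Cadd (Cmul alpha z)
   (Cmul (Copp (Cmul (RtoC (1/2)) (Cmul z z))) (sintC sigma s (fun a => Cmul (RtoC (disc r a)) (Cinv (Cmul a a))))))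
   (sintC sigma s (fun a => Cmul (RtoC (disc r a)) (Clog_rem (Cdiv z a))))) _ 0).
- intros r _. rewrite <- sintC_mul_l by apply disc_integrableC.
  rewrite Cadd_assoc.
  f_equal. rewrite <- sintC_add; [|unfold integrableC; apply integrableC_compact with r; [exact LF|]|apply disc_integrableC].
  + apply sintC_ext. intros a Ha. unfold Clog_rem. assert (Ha0 := H0 a Ha). field. exact Ha0.
  + intros a Ha. rewrite disc_outside by exact Ha. cx.
- unfold logF. apply Clim_infty_add; [|apply sintC_disc_tends, Clog_rem_integrable].
  replace (Csub (Cmul alpha z) (Cmul (Cmul (RtoC (1 / 2)) (Cmul z z)) B)) with
    (Cadd (Cmul alpha z) (Cmul (Copp (Cmul (RtoC (1/2)) (Cmul z z))) B)) by ring.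
  apply Clim_infty_add; [apply Clim_infty_const|apply Clim_infty_mul_l, HB].
Qed.

Lemma dlogF_tends (alpha B z : Cx) : ~ supp sigma s z ->
  Clim_infty (fun r => sintC sigma s (fun a => Cmul (RtoC (disc r a)) (Cinv (Cmul a a)))) B ->
  Clim_infty (fun r => Cadd alpha (sintC sigma s
     (fun a => Cmul (RtoC (disc r a)) (Cadd (Cinv (Csub z a)) (Cinv a))))) (dlogF alpha B z).
Proof.
intros Hz HB.
apply (Clim_infty_eventually_eq _ (fun r => Cadd (Cadd alpha
   (Cmul (Copp z) (sintC sigma s (fun a => Cmul (RtoC (disc r a)) (Cinv (Cmul a a))))))
   (sintC sigma s (fun a => Cmul (RtoC (disc r a)) (dlog_rem z a)))) _ 0).
- intros r _. rewrite <- sintC_mul_l by apply disc_integrableC.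
  rewrite Cadd_assoc.
  f_equal. rewrite <- sintC_add; [|unfold integrableC; apply integrableC_compact with r; [exact LF|]|apply disc_integrableC].
  + apply sintC_ext. intros a Ha. unfold dlog_rem. assert (Ha0 := H0 a Ha).
    assert (Csub a z <> Czero) by (apply Csub_neq0; intros ->; contradiction).
    assert (Csub z a <> Czero) by (apply Csub_neq0; intros ->; contradiction).
    field. repeat split; assumption.
  + intros a Ha. rewrite disc_outside by exact Ha. cx.
- unfold dlogF. apply Clim_infty_add; [|apply sintC_disc_tends, dlog_rem_integrable].
  replace (Csub alpha (Cmul z B)) with (Cadd alpha (Cmul (Copp z) B)) by ring.
  apply Clim_infty_add; [apply Clim_infty_const|apply Clim_infty_mul_l, HB].
Qed.

End LogProduct.

(** * Uniform estimates *)

Lemma Cconj_mul_inv (w : Cx) : w <> Czero -> Cconj w = Cmul (RtoC (Cnorm w * Cnorm w)) (Cinv w).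
Proof.
intros H. assert (A := Cx_sqnorm_pos w H). rewrite Cnorm_sqr.
apply Cx_eq; simpl; field; lra.
Qed.

Lemma Re_RtoC_mul (x : R) (p : Cx) : Re (Cmul (RtoC x) p) = x * Re p.
Proof. simpl; ring. Qed.

Lemma Im_RtoC_mul (x : R) (p : Cx) : Im (Cmul (RtoC x) p) = x * Im p.
Proof. simpl; ring. Qed.

(* Minus the complex gradient 2 d/dw of [green r |w|]. *)
Definition disc_kernel (r : R) (w : Cx) : Cx :=
  Csub (Cinv w) (Cdiv (Cconj w) (RtoC (r * r))).

Lemma RtoC_neq0 (x : R) : x <> 0 -> RtoC x <> Czero.
Proof. intros H E. apply (f_equal Re) in E. simpl in E. contradiction. Qed.

Lemma RtoC_inv (x : R) : x <> 0 -> RtoC (/ x) = Cinv (RtoC x).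
Proof. intros H. apply Cx_eq; simpl; field; auto. Qed.

Lemma RtoC_sub (x y : R) : RtoC (x - y) = Csub (RtoC x) (RtoC y).
Proof. cx. Qed.

(** This form shows that the kernel vanishes on |w| = r and that it is the weight [sqp] times conj
    w. *)
Lemma disc_kernel_eq (r : R) (w : Cx) : r <> 0 -> w <> Czero ->
  disc_kernel r w = Cmul (RtoC (/ (Cnorm w * Cnorm w) - / (r * r))) (Cconj w).
Proof.
intros Hr Hw. assert (A := Cnorm_pos w Hw). assert (Hrr : r * r <> 0) by nra.
rewrite Cnorm_sqr. apply Cx_sqnorm_pos in Hw.
apply Cx_eq; simpl; field; repeat split; auto; lra.
Qed.

(** The same expression as in [areap], without the cutoff. Both it and its derivative -1/d + d/r^2
    vanish at d = r, so it is O(1/r^2) at bounded distance from the circle. *)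
Definition green (r d : R) : R := ln (r / d) - / 2 * (1 - d * d / (r * r)).

Lemma near_circle (x r d : R) : 0 <= x -> x + 1 <= r -> r - x <= d <= r + x ->
  0 < d /\ Rabs (r * r - d * d) <= 3 * x * r /\ r <= (x + 1) * d.
Proof.
intros Hx Hr Hd. split; [lra|]. split; [|nra].
replace (r * r - d * d) with ((r - d) * (r + d)) by ring. rewrite Rabs_mult.
rewrite (Rabs_right (r + d)) by lra.
assert (Rabs (r - d) <= x) by (apply Rabs_le; lra). pose proof (Rabs_pos (r - d)). nra.
Qed.

Lemma disc_kernel_near_circle (x r : R) (w : Cx) : 0 <= x -> x + 1 <= r -> r - x <= Cnorm w <= r + x ->
  Cnorm (disc_kernel r w) <= 3 * x * (x + 1) / (r * r).
Proof.
intros Hx Hr Hw. destruct (near_circle x r _ Hx Hr Hw) as [H1 [H2 H3]].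
rewrite disc_kernel_eq by (try apply Cnorm_neq0; lra).
rewrite Cnorm_mul, Cnorm_RtoC, Cnorm_conj. set (d := Cnorm w) in *.
replace (/ (d * d) - / (r * r)) with ((r * r - d * d) * / (d * d * (r * r))) by (field; lra).
assert (0 < d * d * (r * r)) by (repeat apply Rmult_lt_0_compat; lra).
rewrite Rabs_mult, Rabs_inv, (Rabs_right (d * d * (r * r))) by lra.
apply Rle_trans with (3 * x * r * / (d * d * (r * r)) * d).
- apply Rmult_le_compat_r; [lra|]. apply Rmult_le_compat_r; [left; apply Rinv_0_lt_compat; lra|exact H2].
- replace (3 * x * r * / (d * d * (r * r)) * d) with (3 * x * (r / d) * / (r * r)) by (field; lra).
  unfold Rdiv at 2. apply Rmult_le_compat_r; [left; apply Rinv_0_lt_compat; nra|].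
  apply Rmult_le_compat_l; [lra|]. apply Rle_div_l; lra.
Qed.

(** With y = d^2/r^2 one has 2 [green] = log (1/y) - (1-y). Since 1 - y <= log (1/y) <= 1/y - 1,
    this lies between 0 and (1-y)^2/y, where 1 - y is O(x/r). *)
Lemma green_near_circle (x r d : R) : 0 <= x -> x + 1 <= r -> r - x <= d <= r + x ->
  Rabs (green r d) <= 9 * (x * x) * ((x + 1) * (x + 1)) / (r * r).
Proof.
intros Hx Hr Hd. destruct (near_circle x r d Hx Hr Hd) as [H1 [H2 H3]].
set (y := d * d / (r * r)).
assert (Hy : 0 < y) by (apply Rdiv_lt_0_compat; nra).
assert (E : ln (r / d) = / 2 * ln (/ y)).
{ unfold y. replace (/ (d * d / (r * r))) with ((r / d) * (r / d)) by (field; lra).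
  assert (0 < r / d) by (apply Rdiv_lt_0_compat; lra). rewrite ln_mult by assumption. lra. }
assert (Hiy : 0 < / y) by (apply Rinv_0_lt_compat, Hy).
assert (L1 := ln_le_sub1 (/ y) Hiy). assert (L2 := ln_ge_1_sub_inv (/ y) Hiy). rewrite Rinv_inv in L2.
assert (Ey : / y - 1 - (1 - y) = (1 - y) * (1 - y) * / y) by (field; lra).
assert (B1 : / y <= (x + 1) * (x + 1)).
{ unfold y. replace (/ (d * d / (r * r))) with ((r / d) * (r / d)) by (field; lra).
  assert (0 <= r / d <= x + 1) by (split; [apply Rdiv_le_0_compat; lra|apply Rle_div_l; lra]). nra. }
assert (B2 : (1 - y) * (1 - y) <= 9 * (x * x) / (r * r)).
{ assert (Ez : 1 - y = (r * r - d * d) * / (r * r)) by (unfold y; field; lra).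
  apply Rle_trans with ((3 * x * r * / (r * r)) * (3 * x * r * / (r * r))).
  - rewrite Ez. set (u := r * r - d * d) in *. assert (0 < / (r * r)) by (apply Rinv_0_lt_compat; nra).
    replace (u * / (r * r) * (u * / (r * r))) with (u * u * (/ (r * r) * / (r * r))) by ring.
    replace (3 * x * r * / (r * r) * (3 * x * r * / (r * r))) with
      (3 * x * r * (3 * x * r) * (/ (r * r) * / (r * r))) by ring.
    apply Rmult_le_compat_r; [nra|].
    replace (u * u) with (Rabs u * Rabs u) by (rewrite <- Rabs_mult, Rabs_right; nra).
    pose proof (Rabs_pos u). nra.
  - right. field. lra. }
unfold green. fold y. rewrite E.
replace (9 * (x * x) * ((x + 1) * (x + 1)) / (r * r)) with (9 * (x * x) / (r * r) * ((x + 1) * (x + 1))) by (field; lra).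
assert (0 <= (1 - y) * (1 - y) * / y <= 9 * (x * x) / (r * r) * ((x + 1) * (x + 1))).
{ split; [apply Rmult_le_pos; nra|]. apply Rmult_le_compat; nra. }
rewrite Rabs_right; lra.
Qed.

Section Estimates.

Context (sigma : nat -> R) (s : nat -> Cx) (LF : loc_finite sigma s) (Cb Cd Ce : R).
Context (Hcount : forall c, sint (absw sigma) s (fun z => ind (Cnorm (Csub z c) <= 1)) <= Cb).
Context (H0 : forall z, supp sigma s z -> z <> Czero) (Hs : unit_weights sigma).
Context (HD : forall c t, 1 <= t -> Rabs (sint sigma s (fun z => lnp (rad c z) t)) <= Cd).
Context (HE1 : forall c t, 1 <= t -> Rabs (sint sigma s (fun z => Re (Csub z c) * lnp (rad c z) t)) <= Ce * t).
Context (HE2 : forall c t, 1 <= t -> Rabs (sint sigma s (fun z => Im (Csub z c) * lnp (rad c z) t)) <= Ce * t).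

Definition disc_moment (c : Cx) (r : R) : Cx :=
  sintC sigma s (fun a => Cmul (RtoC (disc r (Csub a c))) (disc_kernel r (Csub a c))).

Definition inv_dist_sum (c : Cx) : R :=
  sint (absw sigma) s (fun a => ind (Cnorm (Csub a c) < 1) * / Cnorm (Csub a c)).

(** Signed, unlike [inv_dist_sum]: zeros and poles push log |f| in opposite directions, and the sign
    is needed for an upper bound that is small near a zero. For f'/f only the size matters. *)
Definition log_dist_sum (c : Cx) : R :=
  sint sigma s (fun a => ind (Cnorm (Csub a c) < 1) * (- ln (Cnorm (Csub a c)))).

Lemma unit_ball_integrable (c : Cx) (F : Cx -> R) :
  integrable sigma s (fun a => ind (Cnorm (Csub a c) < 1) * F a).
Proof.
apply integrable_compact with (Cnorm c + 1); [exact LF|]. intros z Hz. rewrite ind_false; [ring|].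
pose proof (Cnorm_sub_ge z c); lra.
Qed.

Definition near_moment (c : Cx) : Cx :=
  sintC sigma s (fun a => Cmul (RtoC (ind (Cnorm (Csub a c) < 1)))
     (Csub (Cinv (Csub a c)) (Cconj (Csub a c)))).

Definition far_moment (c : Cx) (r : R) : Cx :=
  sintC sigma s (fun a => Cmul (RtoC (sqp (rad c a) r)) (Cconj (Csub a c))).

Lemma unit_ball_integrableC (c : Cx) (F : Cx -> Cx) :
  integrableC sigma s (fun a => Cmul (RtoC (ind (Cnorm (Csub a c) < 1))) (F a)).
Proof.
apply integrableC_compact with (Cnorm c + 1); [exact LF|]. intros z Hz. rewrite ind_false; [cx|].
pose proof (Cnorm_sub_ge z c); lra.
Qed.

Lemma far_moment_integrable (c : Cx) (r : R) :
  integrableC sigma s (fun a => Cmul (RtoC (sqp (rad c a) r)) (Cconj (Csub a c))).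
Proof.
apply integrableC_compact with (Cnorm c + r); [exact LF|]. intros z Hz.
unfold sqp. pose proof (rad_ge_Cnorm c z). destruct (Rlt_dec (rad c z) r); [exfalso; lra|cx].
Qed.

(** For |w| < 1 the kernel is (1 - 1/r^2) conj w + (1/w - conj w). The first summand is what the
    cutoff radius 1 produces and joins the far part; the second does not depend on r. For |w| >= 1
    the cutoff changes nothing. *)
Lemma disc_moment_split (c : Cx) (r : R) : 1 < r -> ~ supp sigma s c ->
  disc_moment c r = Cadd (far_moment c r) (near_moment c).
Proof.
intros Hr Hc. unfold far_moment, near_moment.
rewrite <- (sintC_add _ _ _ _ (far_moment_integrable c r) (unit_ball_integrableC c _)).
apply sintC_ext. intros a Ha.
assert (Hn : Csub a c <> Czero) by (apply Csub_neq0; intros ->; contradiction).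
rewrite disc_kernel_eq by (auto; lra). set (w := Csub a c) in *.
assert (Hw := Cnorm_pos w Hn).
unfold disc, sqp, rad. fold w.
destruct (Rlt_le_dec (Cnorm w) 1) as [L|L].
- rewrite !ind_true by lra. rewrite Rmax_left by lra. destruct (Rlt_dec 1 r) as [_|]; [|exfalso; lra].
  replace (Cinv w) with (Cmul (RtoC (/ (Cnorm w * Cnorm w))) (Cconj w)).
  + rewrite Rmult_1_l, Rinv_1, !RtoC_sub. fold Cone. replace (RtoC 1) with Cone by reflexivity. ring.
  + rewrite (Cconj_mul_inv w Hn), RtoC_inv by nra. field. split; [exact Hn|apply RtoC_neq0; nra].
- rewrite Rmax_right by lra. rewrite (ind_false (_ < 1)) by lra.
  destruct (Rlt_dec (Cnorm w) r) as [L'|L'].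
  + rewrite ind_true by exact L'. cx.
  + rewrite ind_false by exact L'. cx.
Qed.

Lemma far_moment_bound (c : Cx) (r : R) : 1 <= r -> Cnorm (far_moment c r) <= 16 * Ce.
Proof.
intros Hr. eapply Rle_trans; [apply Cnorm_le_ReIm|]. simpl.
assert (A := sqp_bounded sigma s LF c (fun z => Re (Csub z c)) Ce r (HE1 c) Hr).
assert (B := sqp_bounded sigma s LF c (fun z => Im (Csub z c)) Ce r (HE2 c) Hr).
rewrite (sint_ext _ _ _ (fun z => Re (Csub z c) * sqp (rad c z) r)) by (intros; simpl; ring).
rewrite (sint_ext _ _ (fun z => sqp (rad c z) r * - (Im z + - Im c) + 0 * (Re z + - Re c))
   (fun z => (-1) * (Im (Csub z c) * sqp (rad c z) r))) by (intros; simpl; ring).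
rewrite sint_scal, Rabs_mult, Rabs_m1. lra.
Qed.

(** |1/w - conj w| = (1 - |w|^2)/|w| <= 1/|w|. *)
Lemma near_moment_bound (c : Cx) : ~ supp sigma s c -> Cnorm (near_moment c) <= 2 * inv_dist_sum c.
Proof.
intros Hc. apply Cnorm_sintC_le; [|apply unit_ball_integrable].
intros a Ha. assert (Hn : Csub a c <> Czero) by (apply Csub_neq0; intros ->; contradiction).
assert (Hw := Cnorm_pos _ Hn). set (w := Csub a c) in *.
destruct (Rlt_le_dec (Cnorm w) 1) as [L|L].
- rewrite !ind_true by lra. rewrite Cnorm_mul, Cnorm_RtoC, Rabs_R1, !Rmult_1_l.
  rewrite (Cconj_mul_inv w Hn).
  replace (Csub (Cinv w) (Cmul (RtoC (Cnorm w * Cnorm w)) (Cinv w))) with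
    (Cmul (RtoC (1 - Cnorm w * Cnorm w)) (Cinv w)) by (rewrite RtoC_sub; cx).
  rewrite Cnorm_mul, Cnorm_RtoC, Cnorm_inv by exact Hn.
  rewrite <- (Rmult_1_l (/ Cnorm w)) at 2. apply Rmult_le_compat_r; [left; apply Rinv_0_lt_compat, Hw|].
  rewrite Rabs_right; nra.
- rewrite !ind_false by lra. rewrite Cnorm_mul, Cnorm_RtoC, Rabs_R0. lra.
Qed.

Lemma disc_moment_bound (c : Cx) (r : R) : 1 < r -> ~ supp sigma s c ->
  Cnorm (disc_moment c r) <= 16 * Ce + 2 * inv_dist_sum c.
Proof.
intros Hr Hc. rewrite disc_moment_split by assumption.
eapply Rle_trans; [apply Cnorm_add|].
apply Rplus_le_compat; [apply far_moment_bound; lra|apply near_moment_bound, Hc].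
Qed.

Lemma not_supp_0 : ~ supp sigma s Czero.
Proof. intros H. apply (H0 _ H). reflexivity. Qed.

(** The far part is Cauchy by [sqp_increment], the near part constant. The sign is that of the
    theorem, where alpha sums over the poles minus the zeros. *)
Lemma disc_moment_0_converges : exists alpha, Clim_infty (disc_moment Czero) (Copp alpha).
Proof.
assert (H : exists l, Clim_infty (far_moment Czero) l).
{ destruct (tends_cauchy (fun r => Re (far_moment Czero r)) (8 * Ce)) as [l1 H1].
  { intros r1 r2 Hr. simpl.
    assert (A := sqp_increment sigma s LF Czero (fun z => Re (Csub z Czero)) Ce r1 r2 (HE1 Czero) Hr).
    rewrite !(sint_ext _ _ (fun z => sqp _ _ * _ - _) (fun z => Re (Csub z Czero) * sqp (rad Czero z) _))
      by (intros; simpl; ring). exact A. }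
  destruct (tends_cauchy (fun r => Im (far_moment Czero r)) (8 * Ce)) as [l2 H2].
  { intros r1 r2 Hr. simpl.
    assert (A := sqp_increment sigma s LF Czero (fun z => Im (Csub z Czero)) Ce r1 r2 (HE2 Czero) Hr).
    rewrite !(sint_ext _ _ (fun z => sqp _ _ * _ + _) (fun z => (-1) * (Im (Csub z Czero) * sqp (rad Czero z) _)))
      by (intros; simpl; ring).
    rewrite !sint_scal, <- Rmult_minus_distr_l, Rabs_mult, Rabs_m1, Rmult_1_l. exact A. }
  exists (mkCx l1 l2). apply Clim_infty_iff. split; assumption. }
destruct H as [l Hl]. exists (Copp (Cadd l (near_moment Czero))).
replace (Copp (Copp (Cadd l (near_moment Czero)))) with (Cadd l (near_moment Czero)) by ring.
apply (Clim_infty_eventually_eq _ (fun r => Cadd (far_moment Czero r) (near_moment Czero)) _ 1).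
- intros r Hr. apply disc_moment_split; [lra|apply not_supp_0].
- apply Clim_infty_add; [exact Hl|apply Clim_infty_const].
Qed.

Lemma disc_charge_tends0 (k : R) : tends (fun r => k / (r * r) * sint sigma s (disc r)) 0.
Proof.
destruct (disc_charge_linear sigma s LF Cb Hcount Cd) as [K HK]; [intros r Hr; apply HD, Hr|].
apply tends_squeeze with (fun r => Rabs k * K / r) 1; [|apply tends_div_r].
intros r Hr. rewrite Rminus_0_r, Rabs_mult. assert (0 < r * r) by nra.
unfold Rdiv at 1. rewrite Rabs_mult, Rabs_inv, (Rabs_right (r * r)) by lra.
apply Rle_trans with (Rabs k * / (r * r) * (K * r)).
- apply Rmult_le_compat_l; [|apply HK; lra].
  apply Rmult_le_pos; [apply Rabs_pos|left; apply Rinv_0_lt_compat; assumption].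
- right. field. lra.
Qed.

Lemma disc_centered_integrableC (c : Cx) (r : R) (F : Cx -> Cx) :
  integrableC sigma s (fun a => Cmul (RtoC (disc r (Csub a c))) (F a)).
Proof.
apply integrableC_compact with (Cnorm c + r); [exact LF|]. intros z Hz. rewrite disc_outside; [cx|].
pose proof (Cnorm_sub_ge z c); lra.
Qed.

Lemma disc_centered_integrable (c : Cx) (r : R) (F : Cx -> R) :
  integrable sigma s (fun a => disc r (Csub a c) * F a).
Proof.
apply integrable_compact with (Cnorm c + r); [exact LF|]. intros z Hz. rewrite disc_outside; [ring|].
pose proof (Cnorm_sub_ge z c); lra.
Qed.

Context (alpha B : Cx) (Halpha : Clim_infty (disc_moment Czero) (Copp alpha)).
Context (HB : Clim_infty (fun r => sintC sigma s (fun a => Cmul (RtoC (disc r a)) (Cinv (Cmul a a)))) B).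

(** The kernel centred at c replaces the one centred at 0. By linearity of the conjugation the two
    expressions differ by conj c times the charge of the disc over r^2, and by the exchange of discs
    [T]; both tend to 0. *)
Lemma dlogF_eq_lim (c : Cx) : ~ supp sigma s c ->
  Clim_infty (fun r => Copp (disc_moment c r)) (dlogF sigma s alpha B c).
Proof.
intros Hc.
set (X := fun r => Cadd alpha (sintC sigma s
     (fun a => Cmul (RtoC (disc r a)) (Cadd (Cinv (Csub c a)) (Cinv a))))).
assert (HX := dlogF_tends sigma s LF Cb Hcount H0 alpha B c Hc HB : Clim_infty X _).
set (T := fun r a => Cmul (RtoC (disc r a - disc r (Csub a c))) (disc_kernel r (Csub a c))).
assert (HT : Clim_infty (fun r => sintC sigma s (T r)) Czero).
{ set (K := 3 * Cnorm c * (Cnorm c + 1)).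
  assert (HK : forall r z, Cnorm c + 1 <= r -> r - Cnorm c <= Cnorm (Csub z c) <= r + Cnorm c ->
     Cnorm (disc_kernel r (Csub z c)) <= K / (r * r)).
  { intros r z Hr Hz. apply disc_kernel_near_circle; [apply Cnorm_ge0|exact Hr|exact Hz]. }
  apply Clim_infty_iff. split.
  - apply (tends_eventually_eq _ (fun r => sint sigma s (fun z => (disc r z - disc r (Csub z c)) *
        Re (disc_kernel r (Csub z c)))) _ 0).
    + intros r _. apply sint_ext. intros a _. apply Re_RtoC_mul.
    + apply (disc_change sigma s LF Cb Hcount c (fun r z => Re (disc_kernel r (Csub z c))) K).
      intros r z Hr Hz. eapply Rle_trans; [apply Re_le_Cnorm|]. apply HK; assumption.
  - apply (tends_eventually_eq _ (fun r => sint sigma s (fun z => (disc r z - disc r (Csub z c)) *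
        Im (disc_kernel r (Csub z c)))) _ 0).
    + intros r _. apply sint_ext. intros a _. apply Im_RtoC_mul.
    + apply (disc_change sigma s LF Cb Hcount c (fun r z => Im (disc_kernel r (Csub z c))) K).
      intros r z Hr Hz. eapply Rle_trans; [apply Im_le_Cnorm|]. apply HK; assumption. }
assert (HN : Clim_infty (fun r => Cmul (Cconj c) (RtoC (1 / (r * r) * sint sigma s (disc r)))) Czero).
{ replace Czero with (Cmul (Cconj c) Czero) by ring. apply Clim_infty_mul_l.
  apply Clim_infty_iff. simpl. split; [apply disc_charge_tends0|apply tends_const]. }
assert (Hid : forall r, r > 0 -> Copp (disc_moment c r) =
   Cadd (Cadd (X r) (Cmul (Copp Cone) (Cadd alpha (disc_moment Czero r))))
     (Cadd (sintC sigma s (T r)) (Cmul (Copp Cone) (Cmul (Cconj c) (RtoC (1 / (r * r) * sint sigma s (disc r))))))).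
{ intros r Hr.
  (* Pointwise identity under the sum: on |a| < r the poles 1/(a-c) and 1/(c-a) cancel and conj
     (a-c) = conj a - conj c leaves the charge term; the terms on |a-c| < r match directly. *)
  assert (E : Cadd (sintC sigma s (fun a => Cmul (RtoC (disc r a)) (Cadd (Cinv (Csub c a)) (Cinv a))))
      (disc_moment c r) = Cadd (disc_moment Czero r)
        (Csub (Cmul (Cconj c) (RtoC (1 / (r * r) * sint sigma s (disc r)))) (sintC sigma s (T r)))).
  { unfold disc_moment.
    replace (RtoC (1 / (r * r) * sint sigma s (disc r))) with
       (sintC sigma s (fun a => Cmul (RtoC (disc r a)) (RtoC (1 / (r * r))))).
    2: { apply Cx_eq; simpl.
         - rewrite <- sint_scal. apply sint_ext. intros; ring.
         - rewrite (sint_ext _ _ _ (fun _ => 0 * 0)) by (intros; ring). rewrite sint_scal. ring. }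
    assert (HTi : integrableC sigma s (T r)).
    { apply integrableC_compact with (Cnorm c + r); [exact LF|]. intros z Hz. unfold T.
      pose proof (Cnorm_ge0 c). rewrite !disc_outside; [cx| |lra]. pose proof (Cnorm_sub_ge z c); lra. }
    assert (HCi : integrableC sigma s (fun a => Cmul (Cconj c) (Cmul (RtoC (disc r a)) (RtoC (1 / (r * r)))))).
    { apply integrableC_compact with r; [exact LF|]. intros z Hz. rewrite !disc_outside; [cx|exact Hz]. }
    rewrite <- (sintC_mul_l sigma s (Cconj c)) by apply disc_integrableC, LF.
    rewrite <- sintC_sub by assumption.
    rewrite <- !sintC_add; try apply disc_integrableC, LF; try apply disc_centered_integrableC.
    2: { apply integrableC_compact with (Cnorm c + r); [exact LF|]. intros z Hz. unfold T.
         pose proof (Cnorm_ge0 c). rewrite !disc_outside; [cx| |lra]. pose proof (Cnorm_sub_ge z c); lra. }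
    apply sintC_ext. intros a Ha. unfold T.
    replace (Csub a Czero) with a by ring.
    rewrite RtoC_sub. unfold disc_kernel.
    assert (Hc' : Cconj (Csub a c) = Csub (Cconj a) (Cconj c)) by cx. rewrite Hc'.
    replace (RtoC (1 / (r * r))) with (Cinv (RtoC (r * r))) by (rewrite <- RtoC_inv by nra; f_equal; unfold Rdiv; ring).
    assert (Ha0 := H0 a Ha).
    assert (Csub a c <> Czero) by (apply Csub_neq0; intros ->; contradiction).
    assert (Csub c a <> Czero) by (apply Csub_neq0; intros ->; contradiction).
    assert (RtoC (r * r) <> Czero) by (apply RtoC_neq0; nra).
    field. repeat split; assumption. }
  unfold X. set (S1 := sintC _ _ _) in *. set (S2 := sintC _ _ (T r)) in *.
  set (M := disc_moment c r) in *. set (M0 := disc_moment Czero r) in *.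
  set (N := Cmul (Cconj c) _) in *.
  replace (Copp M) with (Csub S1 (Cadd S1 M)) by ring. rewrite E. ring. }
apply (Clim_infty_eventually_eq _ _ _ 0 Hid).
replace (dlogF sigma s alpha B c) with
  (Cadd (Cadd (dlogF sigma s alpha B c) (Cmul (Copp Cone) (Cadd alpha (Copp alpha))))
     (Cadd Czero (Cmul (Copp Cone) Czero))) by ring.
apply Clim_infty_add; apply Clim_infty_add; try assumption; apply Clim_infty_mul_l; [|assumption].
apply Clim_infty_add; [apply Clim_infty_const|assumption].
Qed.

Lemma dlogF_bound (c : Cx) : ~ supp sigma s c ->
  Cnorm (dlogF sigma s alpha B c) <= 2 * (16 * Ce + 2 * inv_dist_sum c).
Proof.
intros Hc. assert (H := dlogF_eq_lim c Hc). apply Clim_infty_iff in H. destruct H as [H1 H2].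
eapply Rle_trans; [apply Cnorm_le_ReIm|].
apply tends_le with (k := 16 * Ce + 2 * inv_dist_sum c) (R0 := 1) in H1.
2: { intros r Hr. eapply Rle_trans; [apply Re_le_Cnorm|]. rewrite Cnorm_opp. apply disc_moment_bound; [lra|exact Hc]. }
apply tends_le with (k := 16 * Ce + 2 * inv_dist_sum c) (R0 := 1) in H2.
2: { intros r Hr. eapply Rle_trans; [apply Im_le_Cnorm|]. rewrite Cnorm_opp. apply disc_moment_bound; [lra|exact Hc]. }
lra.
Qed.

Definition green_sum (c : Cx) (r : R) : R :=
  sint sigma s (fun a => disc r (Csub a c) * green r (Cnorm (Csub a c))).

(** For d < 1, [green r d] is the [areap] of distance 1 plus -log d plus (d^2-1)/(2 r^2). The last
    term is at most 1 in size per point of the unit disc, hence the extra [Cb]; the first is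
    controlled by (d). *)
Lemma green_sum_bound (c : Cx) (r : R) : 1 < r -> ~ supp sigma s c ->
  Rabs (green_sum c r - log_dist_sum c) <= Cd + Cb.
Proof.
intros Hr Hc.
set (X := sint sigma s (fun a => ind (Cnorm (Csub a c) < 1) *
    (/ 2 * ((Cnorm (Csub a c) * Cnorm (Csub a c) - 1) / (r * r))))).
assert (E : green_sum c r = sint sigma s (fun a => areap (rad c a) r) + (log_dist_sum c + X)).
{ unfold green_sum, log_dist_sum, X.
  rewrite <- sint_plus by apply unit_ball_integrable.
  rewrite <- sint_plus; [|apply areap_integrable, LF|apply integrable_plus; apply unit_ball_integrable].
  apply sint_ext. intros a Ha.
  assert (Hn : Csub a c <> Czero) by (apply Csub_neq0; intros ->; contradiction).
  assert (Hw := Cnorm_pos _ Hn). unfold areap, rad, disc, green. set (d := Cnorm (Csub a c)) in *.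
  destruct (Rlt_le_dec d 1) as [L|L].
  - rewrite !ind_true by lra. rewrite Rmax_left by lra. destruct (Rlt_dec 1 r) as [_|]; [|exfalso; lra].
    rewrite !ln_div by lra. rewrite ln_1. field. lra.
  - rewrite Rmax_right by lra. rewrite (ind_false (d < 1)) by lra.
    destruct (Rlt_dec d r) as [L'|L']; [rewrite ind_true by exact L'|rewrite ind_false by exact L']; ring. }
rewrite E.
assert (A := areap_bounded sigma s LF c Cd r (HD c) ltac:(lra)).
assert (HX : Rabs X <= Cb).
{ eapply Rle_trans; [apply sint_abs_le with (G := fun a => ind (Cnorm (Csub a c) <= 1))|apply Hcount].
  - intros a _. set (d := Cnorm (Csub a c)). assert (0 <= d) by apply Cnorm_ge0.
    destruct (Rlt_le_dec d 1) as [L|L].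
    + rewrite !ind_true by lra. rewrite Rmult_1_l.
      assert (0 <= (1 - d * d) / (r * r) <= 1).
      { split; [apply Rdiv_le_0_compat; nra|]. apply Rle_div_l; nra. }
      replace ((d * d - 1) / (r * r)) with (- ((1 - d * d) / (r * r))) by (field; lra).
      apply Rabs_le. lra.
    + rewrite ind_false by lra. rewrite Rmult_0_l, Rabs_R0. apply ind_bounds.
  - apply ball_integrable, LF. }
apply Rabs_le_between in A. apply Rabs_le_between in HX. apply Rabs_le. lra.
Qed.

Lemma Cnorm_sub_sqr (a c : Cx) :
  Cnorm (Csub a c) * Cnorm (Csub a c) =
  Cnorm a * Cnorm a - 2 * Re (Cmul c (Cconj a)) + Cnorm c * Cnorm c.
Proof. rewrite !Cnorm_sqr. simpl. ring. Qed.

(** Expanding |a-c|^2 = |a|^2 - 2 Re (c conj a) + |c|^2, the mixed term together with Re (c/a) is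
    exactly Re (c k(a)) for the kernel k of the moment at 0. Its sum tends to -Re (c alpha), which
    cancels the factor e^(alpha c). *)
Lemma Re_logF_eq_lim (c : Cx) : ~ supp sigma s c ->
  tends (fun r => green_sum Czero r - green_sum c r) (Re (logF sigma s alpha B c)).
Proof.
intros Hc.
assert (HX := logF_tends sigma s LF Cb Hcount H0 alpha B c HB).
apply Clim_infty_iff in HX. apply proj1 in HX.
set (X := fun r => sintC sigma s (fun a => Cmul (RtoC (disc r a)) (Cadd (Clog1m (Cdiv c a)) (Cdiv c a)))) in *.
set (T := fun r a => (disc r a - disc r (Csub a c)) * green r (Cnorm (Csub a c))).
assert (HT : tends (fun r => sint sigma s (T r)) 0).
{ apply (disc_change sigma s LF Cb Hcount c (fun r z => green r (Cnorm (Csub z c)))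
    (9 * (Cnorm c * Cnorm c) * ((Cnorm c + 1) * (Cnorm c + 1)))).
  intros r z Hr Hz. apply green_near_circle; [apply Cnorm_ge0|exact Hr|exact Hz]. }
set (k := Cnorm c * Cnorm c / 2).
assert (HN := disc_charge_tends0 k).
assert (HM : tends (fun r => Re (Cmul c (disc_moment Czero r))) (Re (Cmul c (Copp alpha)))).
{ apply (proj1 (proj1 (Clim_infty_iff _ _) (Clim_infty_mul_l c _ _ Halpha))). }
assert (Hid : forall r, r > 0 -> green_sum Czero r - green_sum c r =
   (Re (Cadd (Cmul alpha c) (X r)) - (Re (Cmul c (disc_moment Czero r)) + Re (Cmul alpha c)))
    + (sint sigma s (T r) - k / (r * r) * sint sigma s (disc r))).
{ intros r Hr.
  assert (E : Re (X r) + green_sum c r + sint sigma s (T r) =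
      green_sum Czero r + (Re (Cmul c (disc_moment Czero r)) + k / (r * r) * sint sigma s (disc r))).
  { assert (EX : Re (X r) = sint sigma s (fun a => Re (Cmul (RtoC (disc r a)) (Cadd (Clog1m (Cdiv c a)) (Cdiv c a)))))
      by reflexivity.
    assert (EM : Re (Cmul c (disc_moment Czero r)) = sint sigma s
       (fun a => Re (Cmul c (Cmul (RtoC (disc r (Csub a Czero))) (disc_kernel r (Csub a Czero)))))).
    { unfold disc_moment. rewrite <- sintC_mul_l by apply disc_centered_integrableC. reflexivity. }
    rewrite EX, EM, <- (sint_scal sigma s (k / (r * r)) (disc r)). unfold green_sum. clear EX EM.
    assert (HTi : integrable sigma s (T r)).
    { apply integrable_compact with (Cnorm c + r); [exact LF|]. intros z Hz. unfold T.
      pose proof (Cnorm_ge0 c). rewrite !disc_outside; [ring| |lra]. pose proof (Cnorm_sub_ge z c); lra. }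
    assert (HXi : integrable sigma s (fun a => Re (Cmul (RtoC (disc r a)) (Cadd (Clog1m (Cdiv c a)) (Cdiv c a))))).
    { apply integrable_compact with r; [exact LF|]. intros z Hz. rewrite disc_outside by exact Hz. simpl. ring. }
    assert (HMi : integrable sigma s (fun a => Re (Cmul c (Cmul (RtoC (disc r (Csub a Czero))) (disc_kernel r (Csub a Czero)))))).
    { apply integrable_compact with r; [exact LF|]. intros z Hz. rewrite disc_outside.
      - simpl. ring.
      - replace (Csub z Czero) with z by ring. exact Hz. }
    assert (HNi : integrable sigma s (fun a => k / (r * r) * disc r a)).
    { apply integrable_scal. apply integrable_compact with r; [exact LF|]. intros; apply disc_outside; assumption. }
    rewrite <- (sint_plus sigma s _ _ HXi (disc_centered_integrable c r _)).
    rewrite <- sint_plus; [|apply integrable_plus; [exact HXi|apply disc_centered_integrable]|exact HTi].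
    rewrite <- (sint_plus sigma s _ _ HMi HNi).
    rewrite <- (sint_plus sigma s _ _ (disc_centered_integrable Czero r _) (integrable_plus _ _ _ _ HMi HNi)).
    apply sint_ext. intros a Ha. unfold T.
    assert (Ha0 := H0 a Ha). assert (Ha1 := Cnorm_pos a Ha0).
    assert (Hn : Csub a c <> Czero) by (apply Csub_neq0; intros ->; contradiction).
    assert (Hw := Cnorm_pos _ Hn).
    replace (Csub a Czero) with a by ring.
    assert (Eln : Re (Clog1m (Cdiv c a)) = ln (Cnorm (Csub a c)) - ln (Cnorm a)).
    { unfold Clog1m, Clog. simpl Re. rewrite <- ln_div by assumption. f_equal.
      rewrite <- Cnorm_div by exact Ha0. f_equal. field. exact Ha0. }
    assert (E2 : forall x p q, Re (Cmul p (Cmul (RtoC x) q)) = x * Re (Cmul p q)) by (intros; simpl; ring).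
    rewrite Re_RtoC_mul, E2.
    assert (E3 : Re (Cmul c (disc_kernel r a)) = Re (Cdiv c a) - Re (Cmul c (Cconj a)) / (r * r)).
    { unfold disc_kernel.
      replace (Cmul c (Csub (Cinv a) (Cdiv (Cconj a) (RtoC (r * r))))) with
        (Csub (Cdiv c a) (Cmul (RtoC (/ (r * r))) (Cmul c (Cconj a)))).
      - assert (ES : forall p q, Re (Csub p q) = Re p - Re q) by reflexivity.
        rewrite ES, Re_RtoC_mul. unfold Rdiv. ring.
      - rewrite RtoC_inv by nra. field. split; [apply RtoC_neq0; nra|exact Ha0]. }
    rewrite E3.
    replace (Re (Cadd (Clog1m (Cdiv c a)) (Cdiv c a))) with (Re (Clog1m (Cdiv c a)) + Re (Cdiv c a)) by reflexivity.
    rewrite Eln. unfold green. rewrite !ln_div by lra.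
    assert (Esq := Cnorm_sub_sqr a c).
    set (q := Re (Cmul c (Cconj a))) in *. set (d := Cnorm (Csub a c)) in *. set (x := Cnorm a) in *.
    set (p := Re (Cdiv c a)). rewrite Esq. unfold k. field. lra. }
  replace (Re (Cadd (Cmul alpha c) (X r))) with (Re (Cmul alpha c) + Re (X r)) by reflexivity. lra. }
apply (tends_eventually_eq _ _ _ 0 Hid).
replace (Re (logF sigma s alpha B c)) with
  ((Re (logF sigma s alpha B c) - (Re (Cmul c (Copp alpha)) + Re (Cmul alpha c))) + (0 - 0)) by (simpl; ring).
apply tends_plus; apply tends_minus; try assumption.
apply tends_plus; [exact HM|apply tends_const].
Qed.

Lemma Re_logF_bound (c : Cx) : ~ supp sigma s c ->
  Rabs (Re (logF sigma s alpha B c) + log_dist_sum c) <= 2 * (Cd + Cb) + Rabs (log_dist_sum Czero).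
Proof.
intros Hc. assert (H := tends_plus _ _ _ _ (Re_logF_eq_lim c Hc) (tends_const (log_dist_sum c))).
apply tends_le with (1 := H) (R0 := 1). intros r Hr.
assert (A := green_sum_bound c r ltac:(lra) Hc). assert (A0 := green_sum_bound Czero r ltac:(lra) not_supp_0).
replace (green_sum Czero r - green_sum c r + log_dist_sum c) with
  ((green_sum Czero r - log_dist_sum Czero) + log_dist_sum Czero - (green_sum c r - log_dist_sum c)) by ring.
pose proof (Rle_abs (log_dist_sum Czero)). pose proof (Rle_abs (- log_dist_sum Czero)). rewrite Rabs_Ropp in H2.
apply Rabs_le_between in A. apply Rabs_le_between in A0. apply Rabs_le. lra.
Qed.

End Estimates.

(** * Lipschitz bounds in the chordal metric *)

Lemma is_derive_of_quadratic (f : R -> R) (x d K delta : R) :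
  delta > 0 -> (forall u, Rabs u < delta -> Rabs (f (x + u) - f x - d * u) <= K * (u * u)) ->
  is_derive f x d.
Proof.
intros Hd H. apply is_derive_Reals. intros eps He.
assert (HK : 0 <= Rabs K) by apply Rabs_pos.
assert (Hp : 0 < Rmin delta (eps / (Rabs K + 1))).
{ apply Rmin_pos; [lra|]. apply Rdiv_lt_0_compat; lra. }
exists (mkposreal _ Hp). simpl. intros u Hu0 Hu.
assert (A := Rlt_le_trans _ _ _ Hu (Rmin_l _ _)). assert (B := Rlt_le_trans _ _ _ Hu (Rmin_r _ _)).
apply Rlt_div_r in B; [|lra]. assert (Hu' := Rabs_pos_lt u Hu0).
replace ((f (x + u) - f x) / u - d) with ((f (x + u) - f x - d * u) / u) by (field; exact Hu0).
unfold Rdiv. rewrite Rabs_mult, Rabs_inv. apply Rlt_div_l; [exact Hu'|].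
eapply Rle_lt_trans; [apply H, A|].
replace (u * u) with (Rabs u * Rabs u) by (rewrite <- Rabs_mult, Rabs_right; nra).
pose proof (Rle_abs K). nra.
Qed.

Lemma absw_opp (sigma : nat -> R) : absw (fun n => - sigma n) = absw sigma.
Proof. apply functional_extensionality. intros n. apply Rabs_Ropp. Qed.

Lemma supp_opp (sigma : nat -> R) (s : nat -> Cx) (z : Cx) :
  supp (fun n => - sigma n) s z <-> supp sigma s z.
Proof. split; intros [n [H E]]; exists n; split; auto; lra. Qed.

Lemma sintC_opp (sigma : nat -> R) (s : nat -> Cx) (F : Cx -> Cx) :
  sintC (fun n => - sigma n) s F = Copp (sintC sigma s F).
Proof. apply Cx_eq; simpl; apply sint_opp. Qed.

Lemma logF_opp (sigma : nat -> R) (s : nat -> Cx) (alpha B z : Cx) :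
  logF (fun n => - sigma n) s (Copp alpha) (Copp B) z = Copp (logF sigma s alpha B z).
Proof. unfold logF. rewrite sintC_opp. ring. Qed.

Lemma dlogF_opp (sigma : nat -> R) (s : nat -> Cx) (alpha B z : Cx) :
  dlogF (fun n => - sigma n) s (Copp alpha) (Copp B) z = Copp (dlogF sigma s alpha B z).
Proof. unfold dlogF. rewrite sintC_opp. ring. Qed.

Lemma unit_weights_opp (sigma : nat -> R) : unit_weights sigma -> unit_weights (fun n => - sigma n).
Proof. intros H n. destruct (H n) as [E|[E|E]]; rewrite E; [left|right; right|right; left]; ring. Qed.

Lemma loc_finite_opp (sigma : nat -> R) (s : nat -> Cx) :
  loc_finite sigma s -> loc_finite (fun n => - sigma n) s.
Proof.
intros LF r. destruct (LF r) as [N HN]. exists N. intros n Hn Hr. rewrite (HN n Hn Hr). ring.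
Qed.

(** The value 0 on the whole support is meaningful only at zeros: it is used where poles are absent,
    and for 1/f with the opposite weights. *)
Definition fin_value (sigma : nat -> R) (s : nat -> Cx) (alpha B z : Cx) : Cx :=
  if excluded_middle_informative (supp sigma s z) then Czero else Cexp (logF sigma s alpha B z).

Section Lipschitz.

Context (sigma : nat -> R) (s : nat -> Cx) (LF : loc_finite sigma s) (Cb C1 C2 : R).
Context (Hcount : forall c, sint (absw sigma) s (fun z => ind (Cnorm (Csub z c) <= 1)) <= Cb).
Context (H0 : forall z, supp sigma s z -> z <> Czero) (Hs : unit_weights sigma).
Context (alpha B : Cx).
Context (Hlog : forall c, ~ supp sigma s c ->
   Rabs (Re (logF sigma s alpha B c) + log_dist_sum sigma s c) <= C1).
Context (Hdlog : forall c, ~ supp sigma s c ->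
   Cnorm (dlogF sigma s alpha B c) <= C2 + 4 * inv_dist_sum sigma s c).
Context (eta : R) (Heta : 0 < eta <= 1/2).

Definition no_pole_within (eta : R) (c : Cx) : Prop :=
  forall n, sigma n = -1 -> eta <= Cnorm (Csub (s n) c).

(** At most [Cb] points lie within distance 1, and each pole among them, being at distance at least
    eta, adds at most log (1/eta) to log |f|. *)
Definition upper_const : R := exp (C1 + Cb * ln (/ eta)).

(** In -[log_dist_sum] a pole contributes -log d <= log (1/eta) and a zero contributes log d <= 0.
    All zeros are dropped except the one with index n, whose term is retained; it reads 0 if n is
    not a zero in the unit disc. *)
Lemma neg_log_dist_sum_bound (c : Cx) (n : nat) : ~ supp sigma s c -> no_pole_within eta c ->
  - log_dist_sum sigma s c <= Cb * ln (/ eta) -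
     Rabs (sigma n) * (ind (Cnorm (Csub (s n) c) < 1) * ind (sigma n = 1) * (- ln (Cnorm (Csub (s n) c)))).
Proof.
intros Hc Hp.
assert (Hl : 0 <= ln (/ eta)).
{ apply ln_nonneg. rewrite <- Rinv_1. apply Rinv_le_contravar; lra. }
set (x := fun k => absw sigma k * (ln (/ eta) * ind (Cnorm (Csub (s k) c) <= 1))).
set (y := fun k => sigma k * (ind (Cnorm (Csub (s k) c) < 1) * (- ln (Cnorm (Csub (s k) c))))).
assert (Ex : ex_series x).
{ apply ex_series_Rabs. apply integrable_absw with (F := fun z => ln (/ eta) * ind (Cnorm (Csub z c) <= 1)).
  apply integrable_scal, ball_integrable, LF. }
assert (Ey : ex_series y).
{ apply ex_series_Rabs. apply (unit_ball_integrable sigma s LF c (fun z => - ln (Cnorm (Csub z c)))). }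
assert (Hxy : forall k, Rabs (sigma k) * (ind (Cnorm (Csub (s k) c) < 1) * ind (sigma k = 1) * (- ln (Cnorm (Csub (s k) c)))) <= x k + y k
   /\ 0 <= x k + y k).
(* Adding the majorant x makes every term nonnegative, so that the term of index n is at most the
   whole sum. *)
{ intros k. unfold x, y, absw. destruct (Hs k) as [E|[E|E]]; rewrite E.
  - rewrite Rabs_R0. lra.
  - assert (Hd : 0 < Cnorm (Csub (s k) c)).
    { apply Cnorm_pos, Csub_neq0. intros E'. apply Hc. exists k. split; [lra|exact E']. }
    rewrite Rabs_R1, (ind_true (1 = 1)) by reflexivity.
    assert (Hi := ind_bounds (Cnorm (Csub (s k) c) <= 1)).
    assert (0 <= ln (/ eta) * ind (Cnorm (Csub (s k) c) <= 1)) by (apply Rmult_le_pos; lra).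
    assert (0 <= ind (Cnorm (Csub (s k) c) < 1) * (- ln (Cnorm (Csub (s k) c)))).
    { destruct (Rlt_le_dec (Cnorm (Csub (s k) c)) 1) as [L|L].
      - rewrite ind_true by exact L. assert (A := ln_le_sub1 _ Hd). lra.
      - rewrite ind_false by lra. lra. }
    split; nra.
  - assert (Hd := Hp k E). rewrite (ind_false (-1 = 1)) by lra. rewrite Rabs_m1.
    enough (0 <= 1 * (ln (/ eta) * ind (Cnorm (Csub (s k) c) <= 1)) +
       -1 * (ind (Cnorm (Csub (s k) c) < 1) * - ln (Cnorm (Csub (s k) c)))) by (split; lra).
    destruct (Rlt_le_dec (Cnorm (Csub (s k) c)) 1) as [L|L].
    + rewrite !ind_true by lra. assert (A : ln eta <= ln (Cnorm (Csub (s k) c))) by (apply ln_le; lra).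
      rewrite ln_Rinv by lra. lra.
    + rewrite (ind_false (_ < 1)) by lra. assert (Hi := ind_bounds (Cnorm (Csub (s k) c) <= 1)). nra. }
assert (Hx : Series x <= Cb * ln (/ eta)).
{ apply Rle_trans with (ln (/ eta) * sint (absw sigma) s (fun z => ind (Cnorm (Csub z c) <= 1))).
  - rewrite <- sint_scal. right. reflexivity.
  - rewrite (Rmult_comm Cb). apply Rmult_le_compat_l; [exact Hl|apply Hcount]. }
assert (Hsum : Series (fun k => x k + y k) = Series x + log_dist_sum sigma s c).
{ rewrite Series_plus by assumption. reflexivity. }
assert (Hn : x n + y n <= Series (fun k => x k + y k)).
{ eapply Rle_trans; [apply (psum_term_le (fun k => x k + y k) (S n) n)|apply psum_le_Series].
  - intros k. apply Hxy.
  - lia.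
  - intros k. apply Hxy.
  - apply (@ex_series_plus _ R_NormedModule _ _ Ex Ey). }
destruct (Hxy n) as [Hn' _]. lra.
Qed.

Lemma upper_const_ge (c : Cx) (u : R) :
  - log_dist_sum sigma s c <= Cb * ln (/ eta) + u -> ~ supp sigma s c ->
  Cnorm (Cexp (logF sigma s alpha B c)) <= upper_const * exp u.
Proof.
intros H Hc. rewrite Cnorm_Cexp. unfold upper_const. rewrite <- exp_plus.
assert (A := Hlog c Hc). apply Rabs_le_between in A.
assert (L : Re (logF sigma s alpha B c) <= C1 + Cb * ln (/ eta) + u) by lra.
destruct L as [L|L]; [left; apply exp_increasing, L|rewrite L; lra].
Qed.

Lemma Cexp_logF_upper (c : Cx) : ~ supp sigma s c -> no_pole_within eta c ->
  Cnorm (Cexp (logF sigma s alpha B c)) <= upper_const.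
Proof.
intros Hc Hp. rewrite <- (Rmult_1_r upper_const), <- exp_0. apply upper_const_ge; [|exact Hc].
(* The index 0 is arbitrary: the retained term is nonnegative and is discarded. *)
assert (A := neg_log_dist_sum_bound c 0 Hc Hp). rewrite Rplus_0_r.
eapply Rle_trans; [exact A|].
enough (0 <= Rabs (sigma 0%nat) * (ind (Cnorm (Csub (s 0%nat) c) < 1) * ind (sigma 0%nat = 1) * - ln (Cnorm (Csub (s 0%nat) c)))) by lra.
apply Rmult_le_pos; [apply Rabs_pos|].
destruct (Rlt_le_dec (Cnorm (Csub (s 0%nat) c)) 1) as [L|L]; [|rewrite ind_false by lra; lra].
destruct (classic (sigma 0%nat = 1)) as [E|E]; [|rewrite (ind_false (_ = 1)) by exact E; lra].
rewrite !ind_true by assumption.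
assert (Hd : 0 < Cnorm (Csub (s 0%nat) c)).
{ apply Cnorm_pos, Csub_neq0. intros E'. apply Hc. exists 0%nat. split; [lra|exact E']. }
assert (B' := ln_le_sub1 _ Hd). lra.
Qed.

(** The retained term log |s n - c| exponentiates to the factor |s n - c|. This factor is what
    compensates the pole of f'/f at the zero. *)
Lemma Cexp_logF_upper_near_zero (c : Cx) (n : nat) : ~ supp sigma s c -> no_pole_within eta c ->
  sigma n = 1 -> Cnorm (Csub (s n) c) < 1 ->
  Cnorm (Cexp (logF sigma s alpha B c)) <= upper_const * Cnorm (Csub (s n) c).
Proof.
intros Hc Hp Hn Hd.
assert (Hd0 : 0 < Cnorm (Csub (s n) c)).
{ apply Cnorm_pos, Csub_neq0. intros E'. apply Hc. exists n. split; [lra|exact E']. }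
rewrite <- (exp_ln (Cnorm (Csub (s n) c))) by exact Hd0. apply upper_const_ge; [|exact Hc].
assert (A := neg_log_dist_sum_bound c n Hc Hp).
rewrite Hn, Rabs_R1, !ind_true in A by (assumption || reflexivity). lra.
Qed.

(** The bound for f times f'/f; the final + 1 makes it at least [upper_const], which is the
    Lipschitz constant for a segment through a zero. *)
Definition lip_const : R := upper_const * (Rabs C2 + 4 * (Cb / eta) + 1).

Lemma upper_const_pos : 0 < upper_const.
Proof. apply exp_pos. Qed.

(** It suffices to bound |f(c)|/|a-c| for each point a of the unit disc. At a zero, |f(c)| carries
    the factor |a-c|; at a pole, |a-c| >= eta. In both cases [upper_const / eta] is enough, and
    there are at most [Cb] points. *)
Lemma derivative_bound (c : Cx) : ~ supp sigma s c -> no_pole_within eta c ->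
  Cnorm (Cmul (Cexp (logF sigma s alpha B c)) (dlogF sigma s alpha B c)) <= lip_const.
Proof.
intros Hc Hp. rewrite Cnorm_mul. set (F := Cnorm (Cexp (logF sigma s alpha B c))).
assert (HF : F <= upper_const) by (apply Cexp_logF_upper; assumption).
assert (HF0 : 0 <= F) by apply Cnorm_ge0.
pose proof upper_const_pos as Hu.
assert (HCb : 0 <= Cb) by (apply (Cb_ge0 sigma s LF Cb Hcount)).
assert (HS : F * inv_dist_sum sigma s c <= upper_const / eta * Cb).
{ unfold inv_dist_sum. rewrite <- sint_scal.
  apply Rle_trans with (sint (absw sigma) s (fun z => upper_const / eta * ind (Cnorm (Csub z c) <= 1))).
  - apply sint_absw_mono; [|apply integrable_scal, ball_integrable, LF].
    intros a [n [Hn Ha]]. subst a.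
    assert (Hd0 : 0 < Cnorm (Csub (s n) c)).
    { apply Cnorm_pos, Csub_neq0. intros E'. apply Hc. exists n. split; [exact Hn|exact E']. }
    assert (Hi : 0 < / Cnorm (Csub (s n) c)) by (apply Rinv_0_lt_compat, Hd0).
    assert (He : 0 < / eta) by (apply Rinv_0_lt_compat; lra).
    destruct (Rlt_le_dec (Cnorm (Csub (s n) c)) 1) as [L|L].
    + rewrite !ind_true by lra. rewrite Rmult_1_l, Rmult_1_r. split; [apply Rmult_le_pos; lra|].
      apply Rle_div_l; [exact Hd0|].
      destruct (Hs n) as [E|[E|E]]; [contradiction| |].
      * eapply Rle_trans; [apply (Cexp_logF_upper_near_zero c n); assumption|].
        apply Rmult_le_compat_r; [lra|]. apply Rle_div_r; nra.
      * eapply Rle_trans; [exact HF|]. assert (Hd := Hp n E).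
        apply Rle_trans with (upper_const / eta * eta); [right; field; lra|].
        apply Rmult_le_compat_l; [apply Rdiv_le_0_compat; lra|exact Hd].
    + rewrite ind_false by lra. rewrite Rmult_0_l, Rmult_0_r. split; [lra|].
      apply Rmult_le_pos; [apply Rdiv_le_0_compat; lra|apply ind_bounds].
  - rewrite sint_scal. apply Rmult_le_compat_l; [apply Rdiv_le_0_compat; lra|apply Hcount]. }
apply Rle_trans with (F * (C2 + 4 * inv_dist_sum sigma s c)).
- apply Rmult_le_compat_l; [exact HF0|apply Hdlog, Hc].
- unfold lip_const. pose proof (Rle_abs C2). pose proof (Rabs_pos C2).
  assert (F * C2 <= upper_const * Rabs C2) by nra.
  replace (upper_const * (Rabs C2 + 4 * (Cb / eta) + 1)) with
    (upper_const * Rabs C2 + 4 * (upper_const / eta * Cb) + upper_const) by (field; lra).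
  lra.
Qed.

Lemma fin_value_near_zero (c : Cx) (n : nat) : no_pole_within eta c ->
  sigma n = 1 -> Cnorm (Csub (s n) c) < 1 ->
  Cnorm (fin_value sigma s alpha B c) <= upper_const * Cnorm (Csub (s n) c).
Proof.
intros Hp Hn Hd. unfold fin_value. destruct excluded_middle_informative as [Hc|Hc].
- rewrite Cnorm_0. apply Rmult_le_pos; [left; apply upper_const_pos|apply Cnorm_ge0].
- apply Cexp_logF_upper_near_zero; assumption.
Qed.

(** The margin 2 eta at z keeps every point of the segment at distance at least eta from the
    poles. *)
Lemma fin_value_lipschitz (z w : Cx) : Cnorm (Csub z w) <= eta -> no_pole_within (2 * eta) z ->
  Cnorm (Csub (fin_value sigma s alpha B z) (fin_value sigma s alpha B w)) <= lip_const * Cnorm (Csub z w).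
Proof.
intros Hzw Hz.
pose proof upper_const_pos as Hu.
assert (HCb : 0 <= Cb) by (apply (Cb_ge0 sigma s LF Cb Hcount)).
assert (HuL : upper_const <= lip_const).
{ unfold lip_const. pose proof (Rabs_pos C2). assert (0 <= Cb / eta) by (apply Rdiv_le_0_compat; lra). nra. }
set (p := fun t => Cadd z (Cmul (RtoC t) (Csub w z))).
assert (Hpz : forall t, 0 <= t <= 1 -> Cnorm (Csub (p t) z) = t * Cnorm (Csub z w)).
{ intros t Ht. unfold p. replace (Csub (Cadd z (Cmul (RtoC t) (Csub w z))) z) with (Cmul (RtoC t) (Csub w z)) by ring.
  rewrite Cnorm_mul, Cnorm_RtoC, Rabs_right, Cnorm_sub_sym; [reflexivity|lra]. }
assert (Hpw : forall t, 0 <= t <= 1 -> Cnorm (Csub (p t) w) = (1 - t) * Cnorm (Csub z w)).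
{ intros t Ht. unfold p. replace (Csub (Cadd z (Cmul (RtoC t) (Csub w z))) w) with (Cmul (RtoC (1 - t)) (Csub z w)).
  - rewrite Cnorm_mul, Cnorm_RtoC, Rabs_right; [reflexivity|lra].
  - rewrite RtoC_sub. replace (RtoC 1) with Cone by reflexivity. ring. }
pose proof (Cnorm_ge0 (Csub z w)) as Hd0.
assert (Hpp : forall t, 0 <= t <= 1 -> no_pole_within eta (p t)).
{ intros t Ht n Hn. assert (A := Hz n Hn). assert (Q := Cnorm_triangle_sub (s n) (p t) z).
  rewrite Hpz in Q by exact Ht. nra. }
assert (P0 : p 0 = z) by (unfold p; cx). assert (P1 : p 1 = w) by (unfold p; cx).
(* If the segment meets the support, it does so at a zero, and both end values are bounded by
   [upper_const] times their distance to it; these distances add up to |z-w|. No differentiability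
   at zeros is then needed. *)
destruct (classic (exists t, 0 <= t <= 1 /\ supp sigma s (p t))) as [[t [Ht [n [Hn Hnt]]]]|Hseg].
- assert (E : sigma n = 1).
  { destruct (Hs n) as [E|[E|E]]; [contradiction|exact E|].
    exfalso. assert (A := Hz n E). rewrite Hnt, Hpz in A by exact Ht. nra. }
  assert (A := fin_value_near_zero z n ltac:(rewrite <- P0; apply Hpp; lra) E
     ltac:(rewrite Hnt, Hpz by exact Ht; nra)).
  assert (A' := fin_value_near_zero w n ltac:(rewrite <- P1; apply Hpp; lra) E
     ltac:(rewrite Hnt, Hpw by exact Ht; nra)).
  rewrite Hnt, Hpz in A by exact Ht. rewrite Hnt, Hpw in A' by exact Ht.
  eapply Rle_trans; [apply Cnorm_sub_le|]. nra.
- assert (Hns : forall t, 0 <= t <= 1 -> ~ supp sigma s (p t)).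
  { intros t Ht E. apply Hseg. exists t. auto. }
  set (F := fun c => Cexp (logF sigma s alpha B c)). set (D := dlogF sigma s alpha B).
  assert (Ez : fin_value sigma s alpha B z = F z).
  { unfold fin_value. destruct excluded_middle_informative as [E|E]; [|reflexivity].
    exfalso. apply (Hns 0); [lra|rewrite P0; exact E]. }
  assert (Ew : fin_value sigma s alpha B w = F w).
  { unfold fin_value. destruct excluded_middle_informative as [E|E]; [|reflexivity].
    exfalso. apply (Hns 1); [lra|rewrite P1; exact E]. }
  rewrite Ez, Ew. rewrite Cnorm_sub_sym. set (v := Csub (F w) (F z)).
  (* Pairing with conj v, where v = f(w) - f(z), reduces to a real mean value theorem: the increment
     of phi is |v|^2, and a factor |v| cancels at the end. *)
  set (phi := fun t => Re (Cmul (Cconj v) (F (p t)))).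
  set (dphi := fun t => Re (Cmul (Cconj v) (Cmul (Cmul (F (p t)) (D (p t))) (Csub w z)))).
  assert (Hmv : Rabs (phi 1 - phi 0) <= Cnorm v * (lip_const * Cnorm (Csub z w))).
  { apply mean_value_bound with dphi.
    - intros t Ht. destruct (Cexp_logF_quadratic sigma s LF Cb Hcount H0 Hs alpha B (p t) (Hns t Ht)) as [K [de [Hde HK]]].
      set (q := Csub w z) in *. pose proof (Cnorm_ge0 q) as Hq.
      apply is_derive_of_quadratic with (K := Cnorm v * (K * (Cnorm q * Cnorm q))) (delta := de / (Cnorm q + 1)).
      { apply Rdiv_lt_0_compat; lra. }
      intros u Hu'. apply Rlt_div_r in Hu'; [|lra].
      assert (Ehq : Cnorm (Cmul (RtoC u) q) = Rabs u * Cnorm q) by (rewrite Cnorm_mul, Cnorm_RtoC; reflexivity).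
      pose proof (Rabs_pos u) as Hu0.
      assert (A := HK (Cmul (RtoC u) q) ltac:(rewrite Ehq; nra)).
      replace (Cadd (p t) (Cmul (RtoC u) q)) with (p (t + u)) in A by (unfold p; fold q; cx).
      fold (F (p (t + u))) in A. fold (F (p t)) in A. fold (D (p t)) in A. rewrite Ehq in A.
      replace (phi (t + u) - phi t - dphi t * u) with
        (Re (Cmul (Cconj v) (Csub (Csub (F (p (t + u))) (F (p t))) (Cmul (Cmul (F (p t)) (D (p t))) (Cmul (RtoC u) q))))).
      + eapply Rle_trans; [apply Re_le_Cnorm|]. rewrite Cnorm_mul, Cnorm_conj, Rmult_assoc.
        apply Rmult_le_compat_l; [apply Cnorm_ge0|]. eapply Rle_trans; [exact A|]. right.
        replace (u * u) with (Rabs u * Rabs u) by (rewrite <- Rabs_mult, Rabs_right; nra). ring.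
      + unfold phi, dphi. fold q. generalize (F (p (t + u))) (F (p t)) (D (p t)). intros; simpl; ring.
    - intros t Ht. unfold dphi. eapply Rle_trans; [apply Re_le_Cnorm|].
      rewrite (Cnorm_mul (Cconj v)), Cnorm_conj. apply Rmult_le_compat_l; [apply Cnorm_ge0|].
      rewrite Cnorm_mul, (Cnorm_sub_sym w z). apply Rmult_le_compat_r; [exact Hd0|].
      apply derivative_bound; [apply Hns, Ht|apply Hpp, Ht]. }
  replace (phi 1 - phi 0) with (Cnorm v * Cnorm v) in Hmv.
  2: { rewrite Cnorm_sqr. unfold phi. rewrite P0, P1. unfold v. generalize (F w) (F z). intros; simpl; ring. }
  destruct (Cnorm_ge0 v) as [Hv|Hv].
  + rewrite Rabs_right in Hmv by nra. apply Rmult_le_reg_l in Hmv; assumption.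
  + rewrite <- Hv. apply Rmult_le_pos; lra.
Qed.

End Lipschitz.

(** * The chordal metric and the passage to 1/f *)

Lemma rhoS_le_fin (u v : Cx) : rhoS (Fin u) (Fin v) <= 2 * Cnorm (Csub u v).
Proof.
unfold rhoS. pose proof (Cnorm_ge0 (Csub u v)). pose proof (pow2_ge_0 (Cnorm u)). pose proof (pow2_ge_0 (Cnorm v)).
assert (1 <= sqrt ((1 + Cnorm u ^ 2) * (1 + Cnorm v ^ 2))).
{ rewrite <- sqrt_1 at 1. apply sqrt_le_1; nra. }
set (q := sqrt _) in *. apply Rle_div_l; nra.
Qed.

Definition inv_value (u : Cext) : Cx := match u with Inf => Czero | Fin w => Cinv w end.

(** The chordal metric is invariant under inversion. The value 0 is excluded because its inverse is
    infinite, whereas [Cinv] sends 0 to 0. *)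
Lemma rhoS_le_inv (u v : Cext) : u <> Fin Czero -> v <> Fin Czero ->
  rhoS u v <= 2 * Cnorm (Csub (inv_value u) (inv_value v)).
Proof.
assert (W : forall w, w <> Czero -> 2 / sqrt (1 + Cnorm w ^ 2) <= 2 * Cnorm (Cinv w)).
{ intros w Hw. assert (H := Cnorm_pos w Hw). rewrite Cnorm_inv by exact Hw.
  apply Rmult_le_compat_l; [lra|]. apply Rinv_le_contravar; [exact H|].
  rewrite <- (sqrt_square (Cnorm w)) at 1 by lra. apply sqrt_le_1; nra. }
destruct u as [u|], v as [v|]; intros Hu Hv.
- assert (Hu' : u <> Czero) by congruence. assert (Hv' : v <> Czero) by congruence.
  assert (A := Cnorm_pos u Hu'). assert (B := Cnorm_pos v Hv').
  simpl inv_value. replace (Csub (Cinv u) (Cinv v)) with (Cdiv (Csub v u) (Cmul u v)) by (field; split; assumption).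
  rewrite Cnorm_div by (intros E; apply Cmul_eq0 in E; tauto).
  rewrite Cnorm_mul, (Cnorm_sub_sym v u). simpl rhoS. unfold Rdiv. rewrite Rmult_assoc.
  apply Rmult_le_compat_l; [lra|]. apply Rmult_le_compat_l; [apply Cnorm_ge0|].
  apply Rinv_le_contravar; [nra|].
  rewrite <- (sqrt_square (Cnorm u * Cnorm v)) by nra. apply sqrt_le_1; [nra| |].
  + apply Rmult_le_pos; nra.
  + simpl. rewrite !Rmult_1_r. nra.
- simpl inv_value. replace (Csub (Cinv u) Czero) with (Cinv u) by ring. apply W. congruence.
- simpl inv_value. rewrite Cnorm_sub_sym. replace (Csub (Cinv v) Czero) with (Cinv v) by ring. apply W. congruence.
- simpl. pose proof (Cnorm_ge0 (Csub Czero Czero)). simpl in *. lra.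
Qed.

Definition meroF (sigma : nat -> R) (s : nat -> Cx) (alpha B z : Cx) : Cext :=
  if excluded_middle_informative (exists n, sigma n = -1 /\ s n = z) then Inf
  else Fin (fin_value sigma s alpha B z).

Theorem meroF_lipschitz (sigma : nat -> R) (s : nat -> Cx) (Cb C1 C2 delta : R) (alpha B : Cx) :
  loc_finite sigma s ->
  (forall c, sint (absw sigma) s (fun z => ind (Cnorm (Csub z c) <= 1)) <= Cb) ->
  (forall z, supp sigma s z -> z <> Czero) -> unit_weights sigma ->
  (forall c, ~ supp sigma s c -> Rabs (Re (logF sigma s alpha B c) + log_dist_sum sigma s c) <= C1) ->
  (forall c, ~ supp sigma s c -> Cnorm (dlogF sigma s alpha B c) <= C2 + 4 * inv_dist_sum sigma s c) ->
  delta > 0 -> (forall n k, sigma n = 1 -> sigma k = -1 -> delta <= Cnorm (Csub (s n) (s k))) ->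
  exists L eta, 0 <= L /\ eta > 0 /\ forall z w, Cnorm (Csub z w) <= eta ->
    rhoS (meroF sigma s alpha B z) (meroF sigma s alpha B w) <= L * Cnorm (Csub z w).
Proof.
intros LF Hcount H0 Hs Hlog Hdlog Hdelta Hsep.
(* Zeros and poles are 4 eta apart. So if a pole is within 2 eta of z, every zero is at distance at
   least 2 eta, and the bound for functions without nearby poles applies to 1/f. *)
set (eta := Rmin delta 1 / 4).
assert (Heta : 0 < eta <= 1/2).
{ assert (0 < Rmin delta 1) by (apply Rmin_pos; lra). pose proof (Rmin_r delta 1). unfold eta. lra. }
assert (Hed : 4 * eta <= delta) by (pose proof (Rmin_l delta 1); unfold eta; lra).
set (L := lip_const Cb C1 C2 eta).
assert (HL : 0 <= L).
{ unfold L, lip_const, upper_const. apply Rmult_le_pos; [left; apply exp_pos|].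
  assert (0 <= Cb) by (apply (Cb_ge0 sigma s LF Cb Hcount)).
  assert (0 <= Cb / eta) by (apply Rdiv_le_0_compat; lra). pose proof (Rabs_pos C2). lra. }
exists (2 * L), eta. split; [lra|]. split; [lra|]. intros z w Hzw.
assert (Hmove : forall x, 2 * eta <= Cnorm (Csub x z) -> x <> w).
{ intros x Hx ->. rewrite Cnorm_sub_sym in Hx. lra. }
destruct (classic (no_pole_within sigma s (2 * eta) z)) as [Hz|Hz].
- assert (Ez : meroF sigma s alpha B z = Fin (fin_value sigma s alpha B z)).
  { unfold meroF. destruct excluded_middle_informative as [[n [Hn E]]|]; [exfalso|reflexivity].
    assert (A := Hz n Hn). rewrite E in A. replace (Csub z z) with Czero in A by ring. rewrite Cnorm_0 in A. lra. }
  assert (Ew : meroF sigma s alpha B w = Fin (fin_value sigma s alpha B w)).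
  { unfold meroF. destruct excluded_middle_informative as [[n [Hn E]]|]; [exfalso|reflexivity].
    apply (Hmove (s n)); [apply Hz, Hn|exact E]. }
  rewrite Ez, Ew. eapply Rle_trans; [apply rhoS_le_fin|]. rewrite Rmult_assoc. apply Rmult_le_compat_l; [lra|].
  apply (fin_value_lipschitz sigma s LF Cb C1 C2 Hcount H0 Hs alpha B Hlog Hdlog eta Heta); assumption.
- assert (Hz' : no_pole_within (fun n => - sigma n) s (2 * eta) z).
  { intros n Hn. apply Rnot_lt_le. intros Hlt. apply Hz. intros k Hk. apply Rnot_lt_le. intros Hlt'.
    assert (A := Hsep n k ltac:(lra) Hk). assert (Q := Cnorm_triangle_sub (s n) z (s k)).
    rewrite (Cnorm_sub_sym z) in Q. lra. }
  assert (Einv : forall x, (forall n, sigma n = 1 -> s n <> x) -> meroF sigma s alpha B x <> Fin Czero /\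
     inv_value (meroF sigma s alpha B x) = fin_value (fun n => - sigma n) s (Copp alpha) (Copp B) x).
  { intros x Hx. unfold meroF, fin_value.
    destruct excluded_middle_informative as [[n [Hn E]]|Hnp].
    - split; [discriminate|]. simpl. destruct excluded_middle_informative as [|Hns]; [reflexivity|].
      exfalso. apply Hns. exists n. split; [lra|exact E].
    - assert (Hnx : ~ supp sigma s x).
      { intros [n [Hn E]]. destruct (Hs n) as [A|[A|A]]; [contradiction|apply (Hx n A E)|]. apply Hnp. exists n. auto. }
      destruct (excluded_middle_informative (supp sigma s x)); [contradiction|].
      destruct excluded_middle_informative as [Q|_]; [exfalso; exact (Hnx (proj1 (supp_opp _ _ _) Q))|].
      rewrite logF_opp, Cexp_opp. split; [|reflexivity].
      intros E.
      apply (f_equal (fun u => match u with Fin v => v | Inf => Czero end)) in E. cbv beta iota in E.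
      exact (Cexp_neq0 _ E). }
  destruct (Einv z) as [Nz Ez].
  { intros n Hn E. assert (A := Hz' n ltac:(lra)). rewrite E in A.
    replace (Csub z z) with Czero in A by ring. rewrite Cnorm_0 in A. lra. }
  destruct (Einv w) as [Nw Ew].
  { intros n Hn. apply Hmove, Hz'. lra. }
  eapply Rle_trans; [apply rhoS_le_inv; assumption|]. rewrite Ez, Ew, Rmult_assoc.
  apply Rmult_le_compat_l; [lra|].
  (* The absolute weights do not change under sigma -> -sigma, and [logF] and [dlogF] change sign,
     so all hypotheses hold for 1/f with the same constants. *)
  apply (fin_value_lipschitz (fun n => - sigma n) s (loc_finite_opp _ _ LF) Cb C1 C2); try assumption.
  + intros c. rewrite absw_opp. apply Hcount.
  + intros x Hx. exact (H0 x (proj1 (supp_opp _ _ _) Hx)).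
  + apply unit_weights_opp, Hs.
  + intros c Hc. rewrite logF_opp. unfold log_dist_sum. rewrite sint_opp.
    replace (Re (Copp (logF sigma s alpha B c)) + - _) with (- (Re (logF sigma s alpha B c) + log_dist_sum sigma s c)) by (unfold log_dist_sum; simpl; ring).
    rewrite Rabs_Ropp. apply Hlog. intros Q. exact (Hc (proj2 (supp_opp _ _ _) Q)).
  + intros c Hc. rewrite dlogF_opp, Cnorm_opp. unfold inv_dist_sum. rewrite absw_opp. apply Hdlog.
    intros Q. exact (Hc (proj2 (supp_opp _ _ _) Q)).
Qed.

(** * Arzela-Ascoli on the sphere *)

(* Stereographic coordinates: rhoS is the Euclidean distance on the unit sphere of R^3. *)
Definition sphere1 (u : Cext) : R :=
  match u with Inf => 0 | Fin w => 2 * Re w / (1 + (Re w * Re w + Im w * Im w)) end.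
Definition sphere2 (u : Cext) : R :=
  match u with Inf => 0 | Fin w => 2 * Im w / (1 + (Re w * Re w + Im w * Im w)) end.
Definition sphere3 (u : Cext) : R :=
  match u with Inf => 1 | Fin w => 1 - 2 / (1 + (Re w * Re w + Im w * Im w)) end.

Lemma rhoS_ge0 (u v : Cext) : 0 <= rhoS u v.
Proof.
assert (W : forall x, 0 <= x -> 0 <= 2 / sqrt (1 + x ^ 2)).
{ intros x Hx. apply Rdiv_le_0_compat; [lra|]. apply sqrt_lt_R0. nra. }
destruct u as [u|], v as [v|]; unfold rhoS; try apply W; try apply Cnorm_ge0; try lra.
apply Rdiv_le_0_compat; [pose proof (Cnorm_ge0 (Csub u v)); lra|]. apply sqrt_lt_R0.
pose proof (pow2_ge_0 (Cnorm u)). pose proof (pow2_ge_0 (Cnorm v)). nra.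
Qed.

Lemma rhoS_sqr (u v : Cext) : rhoS u v * rhoS u v =
  (sphere1 u - sphere1 v) * (sphere1 u - sphere1 v) + (sphere2 u - sphere2 v) * (sphere2 u - sphere2 v) +
  (sphere3 u - sphere3 v) * (sphere3 u - sphere3 v).
Proof.
assert (E : forall w, Cnorm w ^ 2 = Re w * Re w + Im w * Im w).
{ intros w. rewrite <- Cnorm_sqr. ring. }
assert (W : forall w, 2 / sqrt (1 + Cnorm w ^ 2) * (2 / sqrt (1 + Cnorm w ^ 2)) = 4 / (1 + (Re w * Re w + Im w * Im w))).
{ intros w. rewrite E. set (q := 1 + (Re w * Re w + Im w * Im w)). assert (0 < q) by (unfold q; nra).
  assert (Q := sqrt_sqrt q ltac:(lra)). assert (0 < sqrt q) by (apply sqrt_lt_R0; lra).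
  rewrite <- Q at 3. field. lra. }
destruct u as [u|], v as [v|]; unfold rhoS, sphere1, sphere2, sphere3.
- rewrite !E. set (p := 1 + (Re u * Re u + Im u * Im u)). set (q := 1 + (Re v * Re v + Im v * Im v)).
  assert (Hp : 0 < p) by (unfold p; nra). assert (Hq : 0 < q) by (unfold q; nra).
  assert (Hpq : 0 < p * q) by nra.
  assert (Q := sqrt_sqrt (p * q) ltac:(lra)). assert (0 < sqrt (p * q)) by (apply sqrt_lt_R0; lra).
  replace (2 * Cnorm (Csub u v) / sqrt (p * q) * (2 * Cnorm (Csub u v) / sqrt (p * q))) with
    (4 * (Cnorm (Csub u v) * Cnorm (Csub u v)) / (sqrt (p * q) * sqrt (p * q))) by (field; lra).
  rewrite Q, Cnorm_sqr. simpl. unfold p, q in *. field. lra.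
- rewrite W. field. nra.
- rewrite W. field. nra.
- ring.
Qed.

Lemma Rabs_le_of_sqr (x y : R) : 0 <= y -> x * x <= y * y -> Rabs x <= y.
Proof. intros Hy H. apply Rabs_le. nra. Qed.

Lemma sphere_le_rhoS (u v : Cext) :
  Rabs (sphere1 u - sphere1 v) <= rhoS u v /\ Rabs (sphere2 u - sphere2 v) <= rhoS u v /\
  Rabs (sphere3 u - sphere3 v) <= rhoS u v.
Proof.
assert (H := rhoS_sqr u v). pose proof (rhoS_ge0 u v).
pose proof (Rle_0_sqr (sphere1 u - sphere1 v)). pose proof (Rle_0_sqr (sphere2 u - sphere2 v)).
pose proof (Rle_0_sqr (sphere3 u - sphere3 v)). unfold Rsqr in *.
repeat split; (apply Rabs_le_of_sqr; [assumption|lra]).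
Qed.

(** Three coordinates give sqrt 3 e, rounded up to 2 e. *)
Lemma rhoS_le_sphere (u v : Cext) (e : R) :
  Rabs (sphere1 u - sphere1 v) <= e -> Rabs (sphere2 u - sphere2 v) <= e ->
  Rabs (sphere3 u - sphere3 v) <= e -> rhoS u v <= 2 * e.
Proof.
assert (H := rhoS_sqr u v). pose proof (rhoS_ge0 u v).
intros H1 H2 H3.
assert (S : forall x, Rabs x <= e -> x * x <= e * e).
{ intros x Hx. apply Rabs_le_between in Hx. nra. }
apply S in H1 as S1. apply S in H2 as S2. apply S in H3 as S3. pose proof (Rabs_pos (sphere1 u - sphere1 v)).
assert (He : 0 <= e) by lra. apply Rnot_lt_le. intros Hlt.
assert (2 * e * (2 * e) < rhoS u v * rhoS u v) by (apply Rmult_le_0_lt_compat; lra). nra.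
Qed.

Lemma sphere_bounded (u : Cext) :
  -1 <= sphere1 u <= 1 /\ -1 <= sphere2 u <= 1 /\ -1 <= sphere3 u <= 1.
Proof.
destruct u as [w|]; simpl; [|lra].
set (q := 1 + (Re w * Re w + Im w * Im w)). assert (Hq : 1 <= q) by (unfold q; nra).
assert (W : forall x, - q <= x <= q -> -1 <= x / q <= 1).
{ intros x Hx. split; [apply Rle_div_r|apply Rle_div_l]; lra. }
assert (0 < 2 / q <= 2) by (split; [apply Rdiv_lt_0_compat; lra|apply Rle_div_l; lra]).
pose proof (Rle_0_sqr (1 + Re w)). pose proof (Rle_0_sqr (1 - Re w)).
pose proof (Rle_0_sqr (1 + Im w)). pose proof (Rle_0_sqr (1 - Im w)).
pose proof (Rle_0_sqr (Re w)). pose proof (Rle_0_sqr (Im w)). unfold Rsqr in *.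
split; [apply W; unfold q; lra|]. split; [apply W; unfold q; lra|lra].
Qed.

(** Subsequences are handled as infinite index sets, so that repeated extraction is mere inclusion;
    an increasing enumeration is chosen only at the end. *)
Definition infinite (S : nat -> Prop) : Prop := forall N, exists n, (N <= n)%nat /\ S n.

Lemma infinite_or (S T U : nat -> Prop) :
  infinite S -> (forall n, S n -> T n \/ U n) -> infinite T \/ infinite U.
Proof.
intros HS H. destruct (classic (infinite T)) as [HT|HT]; [left; exact HT|right].
apply not_all_ex_not in HT. destruct HT as [N0 HN0]. intros N.
destruct (HS (Nat.max N N0)) as [n [Hn Sn]]. exists n. split; [lia|].
destruct (H n Sn) as [Q|Q]; [|exact Q]. exfalso. apply HN0. exists n. split; [lia|exact Q].
Qed.

(** The interval [-1, 1] is halved j times, 2^j >= 2/eps, keeping each time a half that contains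
    infinitely many values. Normality is a Cauchy condition, so a small oscillation is all that is
    required of each stage. *)
Lemma infinite_small_oscillation (x : nat -> R) (eps : R) : eps > 0 ->
  (forall n, -1 <= x n <= 1) -> forall S, infinite S ->
  exists S', infinite S' /\ (forall n, S' n -> S n) /\
    forall n m, S' n -> S' m -> Rabs (x n - x m) <= eps.
Proof.
intros He Hx.
assert (W : forall j S a b, infinite S -> (forall n, S n -> a <= x n <= b) -> b - a <= eps * 2 ^ j ->
  exists S', infinite S' /\ (forall n, S' n -> S n) /\ forall n m, S' n -> S' m -> Rabs (x n - x m) <= eps).
{ induction j as [|j IH]; intros S a b HS Hab Hj.
  - exists S. split; [exact HS|]. split; [auto|]. intros n m Sn Sm.
    assert (A := Hab n Sn). assert (B := Hab m Sm). simpl in Hj. apply Rabs_le. lra.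
  - simpl in Hj. set (c := (a + b) / 2).
    destruct (infinite_or S (fun n => S n /\ x n <= c) (fun n => S n /\ c <= x n)) as [T|T].
    + exact HS.
    + intros n Sn. destruct (Rle_lt_dec (x n) c); [left|right]; split; auto; lra.
    + destruct (IH _ a c T) as [S' [A [B C]]].
      * intros n [Sn Hn]. specialize (Hab n Sn). lra.
      * unfold c. lra.
      * exists S'. split; [exact A|]. split; [|exact C]. intros n Hn. apply B, Hn.
    + destruct (IH _ c b T) as [S' [A [B C]]].
      * intros n [Sn Hn]. specialize (Hab n Sn). lra.
      * unfold c. lra.
      * exists S'. split; [exact A|]. split; [|exact C]. intros n Hn. apply B, Hn. }
intros S HS.
destruct (Pow_x_infinity 2 ltac:(rewrite Rabs_right; lra) (2 / eps)) as [j Hj].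
specialize (Hj j (Nat.le_refl j)). rewrite Rabs_right in Hj by (apply Rle_ge, pow_le; lra).
apply (W j S (-1) 1 HS).
- intros n _. apply Hx.
- apply Rge_le, Rle_div_l in Hj; lra.
Qed.

Lemma Cx_net (Rad d : R) : d > 0 -> exists l : list Cx, forall z, Cnorm z <= Rad ->
  exists q, In q l /\ Cnorm (Csub z q) <= d.
Proof.
intros Hd. set (e := d / 2).
destruct (INR_unbounded (Rad / e)) as [K HK].
assert (HKe : Rad < INR K * e).
{ apply Rlt_div_l; [unfold e; lra|]. unfold e in *. lra. }
set (l := map (fun i => (INR i - INR K) * e) (List.seq 0 (2 * K + 1))).
assert (H : forall x, Rabs x <= Rad -> exists y, In y l /\ Rabs (x - y) <= e).
{ intros x Hx. apply Rabs_le_between in Hx.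
  destruct (nfloor_ex ((x + INR K * e) / e)) as [i [Hi1 Hi2]].
  { apply Rdiv_le_0_compat; [lra|unfold e; lra]. }
  apply Rle_div_r in Hi1; [|unfold e; lra]. apply Rlt_div_l in Hi2; [|unfold e; lra].
  exists ((INR i - INR K) * e). split.
  - apply in_map_iff. exists i. split; [reflexivity|]. apply in_seq.
    assert (INR i < INR (2 * K + 1)).
    { rewrite plus_INR, mult_INR. simpl INR. apply Rmult_lt_reg_r with e; [unfold e; lra|]. nra. }
    apply INR_lt in H. lia.
  - apply Rabs_le. nra. }
exists (map (fun p => mkCx (fst p) (snd p)) (list_prod l l)).
intros z Hz.
destruct (H (Re z) (Rle_trans _ _ _ (Re_le_Cnorm z) Hz)) as [x [Hx1 Hx2]].
destruct (H (Im z) (Rle_trans _ _ _ (Im_le_Cnorm z) Hz)) as [y [Hy1 Hy2]].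
exists (mkCx x y). split.
- apply in_map_iff. exists (x, y). split; [reflexivity|]. apply in_prod; assumption.
- eapply Rle_trans; [apply Cnorm_le_ReIm|]. simpl. unfold Rminus in *. unfold e in *. lra.
Qed.

(** All translates share the constants L and eta, hence are equicontinuous: a small oscillation on a
    finite net of the disc of radius k spreads to that whole disc. A diagonal sequence then works
    for all k. *)
Theorem lipschitz_normal (f : Cx -> Cext) (L eta : R) : 0 <= L -> eta > 0 ->
  (forall z w, Cnorm (Csub z w) <= eta -> rhoS (f z) (f w) <= L * Cnorm (Csub z w)) ->
  normal_function f.
Proof.
intros HL Heta Hf h.
set (osc := fun (S : nat -> Prop) z e => forall n m, S n -> S m ->
   Rabs (sphere1 (f (Cadd z (h n))) - sphere1 (f (Cadd z (h m)))) <= e /\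
   Rabs (sphere2 (f (Cadd z (h n))) - sphere2 (f (Cadd z (h m)))) <= e /\
   Rabs (sphere3 (f (Cadd z (h n))) - sphere3 (f (Cadd z (h m)))) <= e).
assert (Hlist : forall e l S, e > 0 -> infinite S -> exists S', infinite S' /\ (forall n, S' n -> S n) /\
   forall q, In q l -> osc S' q e).
{ intros e l S He. revert S. induction l as [|q l IH]; intros S HS.
  - exists S. split; [exact HS|]. split; [auto|]. intros q [].
  - destruct (IH S HS) as [S0 [A0 [B0 C0]]].
    destruct (infinite_small_oscillation (fun n => sphere1 (f (Cadd q (h n)))) e He
      (fun n => proj1 (sphere_bounded _)) S0 A0) as [S1 [A1 [B1 D1]]].
    destruct (infinite_small_oscillation (fun n => sphere2 (f (Cadd q (h n)))) e He
      (fun n => proj1 (proj2 (sphere_bounded _))) S1 A1) as [S2 [A2 [B2 D2]]].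
    destruct (infinite_small_oscillation (fun n => sphere3 (f (Cadd q (h n)))) e He
      (fun n => proj2 (proj2 (sphere_bounded _))) S2 A2) as [S3 [A3 [B3 D3]]].
    exists S3. split; [exact A3|]. split; [auto|].
    intros q' [<-|Hq'] n m Sn Sm.
    + repeat split; auto.
    + apply (C0 q' Hq'); auto. }
assert (Hstep : forall k (S : {S | infinite S}), exists S' : {S | infinite S},
   (forall n, proj1_sig S' n -> proj1_sig S n) /\
   forall z, Cnorm z <= INR k -> osc (proj1_sig S') z (/ (INR k + 1))).
{ intros k [S HS]. pose proof (pos_INR k).
  set (e := / (INR k + 1)). assert (He : 0 < e) by (apply Rinv_0_lt_compat; lra).
  (* Moving to a point of the net costs at most L d <= e/4 for each of the two translates, which
     leaves e/2 for the oscillation on the net. *)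
  set (d := Rmin eta (e / (4 * (L + 1)))).
  assert (Hd : 0 < d) by (apply Rmin_pos; [lra|apply Rdiv_lt_0_compat; lra]).
  destruct (Cx_net (INR k) d Hd) as [l Hl].
  destruct (Hlist (e / 2) l S ltac:(lra) HS) as [S' [A [B C]]].
  exists (exist _ S' A). split; [exact B|]. intros z Hz n m Sn Sm. simpl in Sn, Sm.
  destruct (Hl z Hz) as [q [Hq Hzq]].
  assert (HLd : L * d <= e / 4).
  { assert (Q : d <= e / (4 * (L + 1))) by apply Rmin_r. apply Rle_div_r in Q; [|lra]. nra. }
  assert (N : forall i, rhoS (f (Cadd z (h i))) (f (Cadd q (h i))) <= e / 4).
  { intros i. assert (Ei : Csub (Cadd z (h i)) (Cadd q (h i)) = Csub z q) by ring.
    eapply Rle_trans; [apply Hf|].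
    - rewrite Ei. eapply Rle_trans; [exact Hzq|apply Rmin_l].
    - rewrite Ei. eapply Rle_trans; [|exact HLd]. apply Rmult_le_compat_l; assumption. }
  destruct (sphere_le_rhoS (f (Cadd z (h n))) (f (Cadd q (h n)))) as [N1 [N2 N3]].
  destruct (sphere_le_rhoS (f (Cadd z (h m))) (f (Cadd q (h m)))) as [M1 [M2 M3]].
  assert (Nn := N n). assert (Nm := N m). destruct (C q Hq n m Sn Sm) as [C1 [C2 C3]].
  assert (T : forall x x' y y', Rabs (x - x') <= e / 4 -> Rabs (y - y') <= e / 4 -> Rabs (x' - y') <= e / 2 ->
     Rabs (x - y) <= e).
  { intros x x' y y' Q1 Q2 Q3. apply Rabs_le_between in Q1. apply Rabs_le_between in Q2.
    apply Rabs_le_between in Q3. apply Rabs_le. lra. }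
  repeat split; [apply (T _ _ _ _ (Rle_trans _ _ _ N1 Nn) (Rle_trans _ _ _ M1 Nm) C1)
    |apply (T _ _ _ _ (Rle_trans _ _ _ N2 Nn) (Rle_trans _ _ _ M2 Nm) C2)
    |apply (T _ _ _ _ (Rle_trans _ _ _ N3 Nn) (Rle_trans _ _ _ M3 Nm) C3)]. }
assert (H0 : infinite (fun _ => True)) by (intros N; exists N; auto).
set (Sq := fix Sq k : {S | infinite S} := match k with
   | O => exist infinite (fun _ => True) H0
   | S j => proj1_sig (constructive_indefinite_description _ (Hstep j (Sq j))) end).
assert (HSq : forall k, (forall n, proj1_sig (Sq (S k)) n -> proj1_sig (Sq k) n) /\
   forall z, Cnorm z <= INR k -> osc (proj1_sig (Sq (S k))) z (/ (INR k + 1))).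
{ intros k. exact (proj2_sig (constructive_indefinite_description _ (Hstep k (Sq k)))). }
assert (Hnest : forall k j n, (k <= j)%nat -> proj1_sig (Sq j) n -> proj1_sig (Sq k) n).
{ intros k j n Hkj. induction Hkj as [|j Hkj IH]; [auto|]. intros Q. apply IH, HSq, Q. }
assert (Hpick : forall k N, exists n, (N <= n)%nat /\ proj1_sig (Sq k) n).
{ intros k. exact (proj2_sig (Sq k)). }
(* The index [phi n] lies in the set of stage n + 1, hence in those of all earlier stages, and
   exceeds the index before it. *)
set (phi := fix phi n : nat := match n with
   | O => proj1_sig (constructive_indefinite_description _ (Hpick 1%nat 0%nat))
   | S j => proj1_sig (constructive_indefinite_description _ (Hpick (S (S j)) (S (phi j)))) end).
assert (Hphi : forall n, proj1_sig (Sq (S n)) (phi n)).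
{ intros [|n]; simpl phi.
  - exact (proj2 (proj2_sig (constructive_indefinite_description _ (Hpick 1%nat 0%nat)))).
  - exact (proj2 (proj2_sig (constructive_indefinite_description _ (Hpick (S (S n)) (S (phi n)))))). }
exists phi. split.
{ intros n. exact (proj1 (proj2_sig (constructive_indefinite_description _ (Hpick (S (S n)) (S (phi n)))))). }
intros Rad eps HRad Heps.
(* N > Rad puts z in the disc of stage N, and N > 2/eps makes twice its oscillation 1/(N+1) smaller
   than eps. *)
destruct (INR_unbounded (Rmax Rad (2 / eps))) as [N HN].
assert (N1 := Rle_lt_trans _ _ _ (Rmax_l _ _) HN). assert (N2 := Rle_lt_trans _ _ _ (Rmax_r _ _) HN).
exists N. intros n m Hn Hm z Hz.
destruct (proj2 (HSq N) z ltac:(lra) (phi n) (phi m)) as [Q1 [Q2 Q3]].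
- apply (Hnest (S N) (S n)); [lia|apply Hphi].
- apply (Hnest (S N) (S m)); [lia|apply Hphi].
- eapply Rle_lt_trans; [apply rhoS_le_sphere with (1 := Q1) (2 := Q2) (3 := Q3)|].
  apply Rlt_div_l in N2; [|lra].
  apply Rmult_lt_reg_r with (INR N + 1); [lra|]. rewrite Rmult_assoc, Rinv_l by lra. nra.
Qed.

(** * Zeros and poles *)

Lemma Cpow_mul (x y : Cx) (n : nat) : Cpow (Cmul x y) n = Cmul (Cpow x n) (Cpow y n).
Proof. induction n as [|n IH]; simpl; [cx|]. rewrite IH. ring. Qed.

Lemma Cpowz_mul (x y : Cx) (m : Z) : Cpowz (Cmul x y) m = Cmul (Cpowz x m) (Cpowz y m).
Proof. destruct m; unfold Cpowz; [cx|apply Cpow_mul|]. rewrite Cpow_mul. apply Cinv_mul. Qed.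

Lemma Cexp_INR_mul (u : Cx) (n : nat) : Cexp (Cmul (RtoC (INR n)) u) = Cpow (Cexp u) n.
Proof.
induction n as [|n IH].
- simpl Cpow. rewrite <- Cexp_0. f_equal. cx.
- rewrite S_INR. simpl Cpow. rewrite <- IH, <- Cexp_add. f_equal. cx.
Qed.

Lemma Cexp_IZR_mul (u : Cx) (m : Z) : Cexp (Cmul (RtoC (IZR m)) u) = Cpowz (Cexp u) m.
Proof.
destruct m as [|p|p]; unfold Cpowz.
- rewrite <- Cexp_0. f_equal. cx.
- rewrite <- Cexp_INR_mul, INR_IZR_INZ, positive_nat_Z. reflexivity.
- rewrite <- Cexp_INR_mul, INR_IZR_INZ, positive_nat_Z, <- Cexp_opp. f_equal.
  change (Z.neg p) with (- Z.pos p)%Z. rewrite opp_IZR. cx.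
Qed.

Lemma Cpowz_neq0 (x : Cx) (m : Z) : x <> Czero -> Cpowz x m <> Czero.
Proof. intros H. rewrite <- (Cexp_Clog x H), <- Cexp_IZR_mul. apply Cexp_neq0. Qed.

Lemma C_differentiable_at_scal (c : Cx) (g : Cx -> Cx) (z : Cx) :
  C_differentiable_at g z -> C_differentiable_at (fun w => Cmul c (g w)) z.
Proof.
intros [d H]. exists (Cmul c d). intros eps He. pose proof (Cnorm_ge0 c).
destruct (H (eps / (Cnorm c + 1))) as [de [Hde H']]; [apply Rdiv_lt_0_compat; lra|].
exists de. split; [exact Hde|]. intros h Hh.
replace (Csub (Cdiv (Csub (Cmul c (g (Cadd z h))) (Cmul c (g z))) h) (Cmul c d)) with
  (Cmul c (Csub (Cdiv (Csub (g (Cadd z h)) (g z)) h) d)) by (unfold Cdiv; ring).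
rewrite Cnorm_mul. assert (A := H' h Hh). apply Rlt_div_r in A; [|lra].
pose proof (Cnorm_ge0 (Csub (Cdiv (Csub (g (Cadd z h)) (g z)) h) d)). nra.
Qed.

(** The measure without its mass at z0: the points stay in the list with weight 0, so the weights
    remain in {0, 1, -1}. *)
Definition punctured (sigma : nat -> R) (s : nat -> Cx) (z0 : Cx) (n : nat) : R :=
  sigma n * (1 - ind (s n = z0)).

Definition mass (sigma : nat -> R) (s : nat -> Cx) (z0 : Cx) : R := sint sigma s (fun a => ind (a = z0)).

Lemma sint_punctured (sigma : nat -> R) (s : nat -> Cx) (z0 : Cx) (F : Cx -> R) :
  sint (punctured sigma s z0) s F = sint sigma s (fun a => (1 - ind (a = z0)) * F a).
Proof. apply Series_ext. intros n. unfold punctured. ring. Qed.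

Lemma absw_punctured (sigma : nat -> R) (s : nat -> Cx) (z0 : Cx) :
  absw (punctured sigma s z0) = punctured (absw sigma) s z0.
Proof.
apply functional_extensionality. intros n. unfold absw, punctured. rewrite Rabs_mult. f_equal.
apply Rabs_right. assert (H := ind_bounds (s n = z0)). lra.
Qed.

Lemma supp_punctured (sigma : nat -> R) (s : nat -> Cx) (z0 z : Cx) :
  supp (punctured sigma s z0) s z <-> supp sigma s z /\ z <> z0.
Proof.
unfold supp, punctured. split.
- intros [n [Hn E]]. split.
  + exists n. split; [|exact E]. intros E'. apply Hn. rewrite E'. ring.
  + intros E'. apply Hn. rewrite ind_true by congruence. ring.
- intros [[n [Hn E]] Hz]. exists n. split; [|exact E]. rewrite ind_false by congruence. lra.
Qed.

Lemma mass_integrable (sigma : nat -> R) (s : nat -> Cx) (z0 : Cx) :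
  loc_finite sigma s -> integrable sigma s (fun a => ind (a = z0)).
Proof.
intros LF. apply integrable_compact with (Cnorm z0); [exact LF|].
intros z Hz. apply ind_false. intros ->. lra.
Qed.

Lemma sint_split_mass (sigma : nat -> R) (s : nat -> Cx) (z0 : Cx) (F : Cx -> R) :
  loc_finite sigma s -> integrable sigma s F ->
  sint sigma s F = sint (punctured sigma s z0) s F + mass sigma s z0 * F z0.
Proof.
intros LF HF. rewrite sint_punctured. unfold mass. rewrite Rmult_comm, <- sint_scal, <- sint_plus.
- apply sint_ext. intros a _. unfold ind. destruct excluded_middle_informative as [->|]; ring.
- apply integrable_le with F; [|exact HF]. intros a _. rewrite Rabs_mult.
  assert (H := ind_bounds (a = z0)). rewrite (Rabs_right (1 - _)) by lra. pose proof (Rabs_pos (F a)). nra.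
- apply integrable_scal, mass_integrable, LF.
Qed.

Lemma sintC_split_mass (sigma : nat -> R) (s : nat -> Cx) (z0 : Cx) (F : Cx -> Cx) :
  loc_finite sigma s -> integrableC sigma s F ->
  sintC sigma s F = Cadd (sintC (punctured sigma s z0) s F) (Cmul (RtoC (mass sigma s z0)) (F z0)).
Proof.
intros LF HF. apply Cx_eq; simpl.
- rewrite (sint_split_mass sigma s z0 (fun z => Re (F z)) LF (integrableC_Re _ _ _ HF)). ring.
- rewrite (sint_split_mass sigma s z0 (fun z => Im (F z)) LF (integrableC_Im _ _ _ HF)). ring.
Qed.

Lemma mass_ge1 (sigma : nat -> R) (s : nat -> Cx) (z0 : Cx) (n : nat) :
  loc_finite sigma s -> sigma n = 1 -> s n = z0 -> (forall k, s k = z0 -> 0 <= sigma k) ->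
  1 <= mass sigma s z0.
Proof.
intros LF Hn Hs Hk.
assert (H : forall k, 0 <= sigma k * ind (s k = z0)).
{ intros k. destruct (classic (s k = z0)) as [E|E].
  - rewrite ind_true by exact E. specialize (Hk k E). lra.
  - rewrite ind_false by exact E. lra. }
apply Rle_trans with (psum (fun k => sigma k * ind (s k = z0)) (S n)).
- apply Rle_trans with (sigma n * ind (s n = z0)); [rewrite Hn, ind_true by exact Hs; lra|].
  apply (psum_term_le (fun k => sigma k * ind (s k = z0))); [exact H|lia].
- apply psum_le_Series; [exact H|]. apply ex_series_Rabs, (mass_integrable sigma s z0 LF).
Qed.

Section Order.

Context (sigma : nat -> R) (s : nat -> Cx) (LF : loc_finite sigma s) (Cb : R).
Context (Hcount : forall c, sint (absw sigma) s (fun z => ind (Cnorm (Csub z c) <= 1)) <= Cb).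
Context (H0 : forall z, supp sigma s z -> z <> Czero) (Hs : unit_weights sigma).
Context (alpha B : Cx).

(** The linear and quadratic parts of [Clog_rem] at z/z0 are moved into the two parameters. What
    remains of z0 is the bare logarithm of 1 - z/z0, times the multiplicity. *)
Lemma logF_split (z0 z : Cx) : z0 <> Czero ->
  logF sigma s alpha B z =
  Cadd (Cmul (RtoC (mass sigma s z0)) (Clog1m (Cdiv z z0)))
    (logF (punctured sigma s z0) s
       (Cadd alpha (Cdiv (RtoC (mass sigma s z0)) z0))
       (Csub B (Cdiv (RtoC (mass sigma s z0)) (Cmul z0 z0))) z).
Proof.
intros Hz0. unfold logF.
rewrite (sintC_split_mass sigma s z0 _ LF (Clog_rem_integrable sigma s LF Cb Hcount H0 z)).
unfold Clog_rem at 2. field. exact Hz0.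
Qed.

Lemma meroF_regular (z : Cx) : ~ supp sigma s z ->
  meroF sigma s alpha B z = Fin (Cexp (logF sigma s alpha B z)).
Proof.
intros Hz. unfold meroF, fin_value.
destruct excluded_middle_informative as [[n [Hn E]]|_].
- exfalso. apply Hz. exists n. split; [lra|exact E].
- destruct excluded_middle_informative; [contradiction|reflexivity].
Qed.

(** By [logF_split], near z0 the function is (1 - z/z0)^m times the exponential belonging to the
    punctured measure, which is differentiable and nonzero at z0 too. If z0 carries no point, then m
    = 0 and the exponential itself serves. *)
Lemma meroF_has_order (z0 : Cx) (m : Z) :
  (forall n k, sigma n = 1 -> sigma k = -1 -> s n <> s k) ->
  mass sigma s z0 = IZR m -> has_order_at (meroF sigma s alpha B) z0 m.
Proof.
intros Hsep Hm. destruct (dist_to_supp_pos sigma s z0 LF) as [d [Hd Hd']].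
assert (Hreg : forall z, Cnorm (Csub z z0) < d -> z <> z0 -> ~ supp sigma s z).
{ intros z Hz Hne E. assert (A := Hd' z E Hne). lra. }
exists d. split; [lra|].
destruct (classic (supp sigma s z0)) as [Hz0|Hz0].
- assert (Hn0 := H0 z0 Hz0).
  set (sigma' := punctured sigma s z0).
  set (G := fun z => Cexp (logF sigma' s (Cadd alpha (Cdiv (RtoC (mass sigma s z0)) z0))
     (Csub B (Cdiv (RtoC (mass sigma s z0)) (Cmul z0 z0))) z)).
  (* From 1 - z/z0 = (z - z0)(-1/z0): this constant turns the m-th power into that of z - z0. *)
  set (c := Cpowz (Copp (Cinv z0)) m).
  assert (Hreg' : forall z, Cnorm (Csub z z0) < d -> ~ supp sigma' s z).
  { intros z Hz E. apply supp_punctured in E. destruct E as [E1 E2]. apply (Hreg z); assumption. }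
  assert (Hi : Copp (Cinv z0) <> Czero).
  { apply Cnorm_neq0. rewrite Cnorm_opp, Cnorm_inv by exact Hn0. apply Rinv_0_lt_compat, Cnorm_pos, Hn0. }
  exists (fun z => Cmul c (G z)). split; [|split].
  + intros z Hz. apply C_differentiable_at_scal.
    apply (Cexp_logF_differentiable sigma' s) with (Cb := Cb).
    * intros r. destruct (LF r) as [N HN]. exists N. intros n Hn Hr. unfold sigma', punctured.
      rewrite (HN n Hn Hr). ring.
    * intros y. unfold sigma'. rewrite absw_punctured, sint_punctured.
      eapply Rle_trans; [|apply (Hcount y)]. apply sint_absw_mono; [|apply ball_integrable, LF].
      intros a _. pose proof (ind_bounds (a = z0)). pose proof (ind_bounds (Cnorm (Csub a y) <= 1)). nra.
    * intros y Hy. apply supp_punctured in Hy. apply H0, Hy.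
    * intros n. unfold sigma', punctured, ind. destruct excluded_middle_informative.
      -- left; ring.
      -- replace (sigma n * (1 - 0)) with (sigma n) by ring. apply Hs.
    * apply Hreg', Hz.
  + intros E. apply Cmul_eq0 in E. destruct E as [E|E]; [|exact (Cexp_neq0 _ E)].
    exact (Cpowz_neq0 _ m Hi E).
  + intros z Hz. unfold local_value. destruct (excluded_middle_informative (z = z0)) as [->|Hne].
    * unfold meroF, fin_value. destruct excluded_middle_informative as [[n [Hn E]]|Hnp].
      (* A pole sits at z0, so by separation no zero does; all weights there are nonpositive, m < 0,
         and [local_value] gives [Inf]. The other branch is the mirror case with m > 0 and value
         0. *)
      -- assert (A : 1 <= mass (fun n => - sigma n) s z0).
         { apply mass_ge1 with n; [apply loc_finite_opp, LF|lra|exact E|].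
           intros k Hk. destruct (Hs k) as [A|[A|A]]; try lra. exfalso. apply (Hsep k n A Hn). congruence. }
         unfold mass in A, Hm. rewrite sint_opp, Hm in A.
         assert (Q : (m < 0)%Z) by (apply lt_IZR; lra). destruct m; [lia|lia|reflexivity].
      -- destruct excluded_middle_informative as [_|]; [|contradiction].
         destruct Hz0 as [n [Hn E]].
         assert (Q1 : sigma n = 1).
         { destruct (Hs n) as [A|[A|A]]; [contradiction|exact A|]. exfalso. apply Hnp. exists n. auto. }
         assert (A : 1 <= mass sigma s z0).
         { apply mass_ge1 with n; [exact LF|exact Q1|exact E|].
           intros k Hk. destruct (Hs k) as [A|[A|A]]; try lra. exfalso. apply Hnp. exists k. auto. }
         rewrite Hm in A. assert (Q : (0 < m)%Z) by (apply lt_IZR; lra). destruct m; [lia|reflexivity|lia].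
    * rewrite (meroF_regular z (Hreg z Hz Hne)). f_equal.
      rewrite (logF_split z0 z Hn0), Cexp_add. fold sigma'. fold (G z).
      rewrite Hm, Cexp_IZR_mul, Cexp_Clog1m.
      -- replace (Csub Cone (Cdiv z z0)) with (Cmul (Csub z z0) (Copp (Cinv z0))) by (field; exact Hn0).
         rewrite Cpowz_mul. fold c. ring.
      -- intros E. apply Hne. replace z with (Cmul (Cdiv z z0) z0) by (field; exact Hn0). rewrite E. ring.
- assert (Em : m = 0%Z).
  { apply eq_IZR. rewrite <- Hm. unfold mass. rewrite (sint_ext _ _ _ (fun _ => 0 * 0)).
    - rewrite sint_scal. ring.
    - intros a Ha. rewrite ind_false; [ring|]. intros ->. contradiction. }
  subst m. exists (fun z => Cexp (logF sigma s alpha B z)).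
  assert (Hreg' : forall z, Cnorm (Csub z z0) < d -> ~ supp sigma s z).
  { intros z Hz. destruct (classic (z = z0)) as [->|Hne]; [exact Hz0|apply Hreg; assumption]. }
  split; [|split].
  + intros z Hz. apply (Cexp_logF_differentiable sigma s LF Cb Hcount H0 Hs). apply Hreg', Hz.
  + apply Cexp_neq0.
  + intros z Hz. rewrite (meroF_regular z (Hreg' z Hz)). unfold local_value.
    destruct (excluded_middle_informative (z = z0)); [reflexivity|]. f_equal. unfold Cpowz. ring.
Qed.

End Order.

(** * The signed measure of a divisor *)

Lemma ffold_upto_stable {A : Type} (op : A -> A -> A) (e : A) (P : nat -> Prop) (F : nat -> A) (N M : nat) :
  (forall x, op x e = x) -> (forall n, P n -> (n < N)%nat) -> (N <= M)%nat ->
  ffold_upto op e P F M = ffold_upto op e P F N.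
Proof.
intros He HP H. induction H as [|M HM IH]; [reflexivity|]. simpl. rewrite IH.
destruct excluded_middle_informative as [E|E]; [|apply He]. specialize (HP M E). lia.
Qed.

(** [ffold] uses a bound picked by choice. As e is neutral on the right, any bound on the indices
    yields the same result, so one N can serve several sums at once. *)
Lemma ffold_eq_upto {A : Type} (op : A -> A -> A) (e : A) (P : nat -> Prop) (F : nat -> A) (N : nat) :
  (forall x, op x e = x) -> (forall n, P n -> (n < N)%nat) ->
  ffold op e P F = ffold_upto op e P F N.
Proof.
intros He HP. unfold ffold. destruct excluded_middle_informative as [H|H].
- set (N' := proj1_sig _). assert (HN' : forall n, P n -> (n < N')%nat)
    by (exact (proj2_sig (constructive_indefinite_description _ H))).
  destruct (Nat.le_ge_cases N N') as [L|L].
  + apply ffold_upto_stable; assumption.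
  + symmetry. apply ffold_upto_stable; assumption.
- exfalso. apply H. exists N. exact HP.
Qed.

Lemma INR_fcard (P : nat -> Prop) (N : nat) : (forall n, P n -> (n < N)%nat) ->
  INR (fcard P) = psum (fun n => ind (P n)) N.
Proof.
intros H. unfold fcard. rewrite (ffold_eq_upto _ _ _ _ N); [|intros; apply Nat.add_0_r|exact H].
clear H. induction N as [|N IH]; [reflexivity|]. simpl ffold_upto. rewrite plus_INR, IH. simpl psum. f_equal.
unfold ind. destruct excluded_middle_informative; reflexivity.
Qed.

Lemma fsumC_psum (P : nat -> Prop) (F : nat -> Cx) (N : nat) : (forall n, P n -> (n < N)%nat) ->
  fsumC P F = mkCx (psum (fun n => ind (P n) * Re (F n)) N) (psum (fun n => ind (P n) * Im (F n)) N).
Proof.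
intros H. unfold fsumC. rewrite (ffold_eq_upto _ _ _ _ N); [|intros; cx|exact H].
clear H. induction N as [|N IH]; [reflexivity|]. simpl. rewrite IH.
unfold ind. destruct excluded_middle_informative; cx.
Qed.

Lemma fprodC_psum (P : nat -> Prop) (F G : nat -> Cx) (N : nat) : (forall n, P n -> (n < N)%nat) ->
  (forall n, P n -> F n = Cexp (G n)) ->
  fprodC P F = Cexp (mkCx (psum (fun n => ind (P n) * Re (G n)) N) (psum (fun n => ind (P n) * Im (G n)) N)).
Proof.
intros H HG. unfold fprodC. rewrite (ffold_eq_upto _ _ _ _ N); [|intros; cx|exact H].
clear H. induction N as [|N IH]; [symmetry; apply Cexp_0|]. simpl. rewrite IH.
unfold ind. destruct excluded_middle_informative as [E|E].
- rewrite (HG N E), <- Cexp_add. f_equal. cx.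
- transitivity (Cexp (mkCx (psum (fun n => ind (P n) * Re (G n)) N) (psum (fun n => ind (P n) * Im (G n)) N)));
    [unfold ind; ring|].
  f_equal. apply Cx_eq; simpl; unfold ind; ring.
Qed.

(* The zeros occupy the even indices with weight 1, the poles the odd ones with weight -1. *)
Definition comb_weight (Ia Ib : nat -> Prop) (k : nat) : R :=
  if Nat.even k then ind (Ia (Nat.div2 k)) else - ind (Ib (Nat.div2 k)).

Definition comb_point (a b : nat -> Cx) (k : nat) : Cx :=
  if Nat.even k then a (Nat.div2 k) else b (Nat.div2 k).

Lemma even_double (n : nat) : Nat.even (2 * n) = true.
Proof. rewrite Nat.even_mul. reflexivity. Qed.

Lemma even_double_S (n : nat) : Nat.even (S (2 * n)) = false.
Proof. rewrite Nat.even_succ, Nat.odd_mul. reflexivity. Qed.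

Lemma psum_interleave (x : nat -> R) (N : nat) :
  psum x (2 * N) = psum (fun n => x (2 * n)%nat + x (S (2 * n))) N.
Proof.
induction N as [|N IH]; [reflexivity|].
replace (2 * S N)%nat with (S (S (2 * N))) by lia. cbn [psum]. rewrite IH. ring.
Qed.

Section Combined.

Context (Ia : nat -> Prop) (a : nat -> Cx) (Ib : nat -> Prop) (b : nat -> Cx).
Context (Hfa : locally_finite Ia a) (Hfb : locally_finite Ib b).

Let sigma := comb_weight Ia Ib.
Let s := comb_point a b.

Lemma comb_even (n : nat) : sigma (2 * n) = ind (Ia n) /\ s (2 * n) = a n.
Proof. unfold sigma, s, comb_weight, comb_point. rewrite even_double, Nat.div2_double. split; reflexivity. Qed.

Lemma comb_odd (n : nat) : sigma (S (2 * n)) = - ind (Ib n) /\ s (S (2 * n)) = b n.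
Proof. unfold sigma, s, comb_weight, comb_point. rewrite even_double_S, Nat.div2_succ_double. split; reflexivity. Qed.

Lemma comb_cases (k : nat) : exists n, k = (2 * n)%nat \/ k = S (2 * n).
Proof.
destruct (Nat.Even_or_Odd k) as [[n Hn]|[n Hn]]; exists n; [left|right]; lia.
Qed.

Lemma comb_unit_weights : unit_weights sigma.
Proof.
intros k. destruct (comb_cases k) as [n [->| ->]].
- rewrite (proj1 (comb_even n)). unfold ind. destruct excluded_middle_informative; auto.
- rewrite (proj1 (comb_odd n)). unfold ind. destruct excluded_middle_informative; [right; right|left]; ring.
Qed.

Lemma comb_pos (k : nat) : sigma k = 1 <-> exists n, Ia n /\ k = (2 * n)%nat.
Proof.
split.
- intros H. destruct (comb_cases k) as [n [->| ->]].
  + rewrite (proj1 (comb_even n)) in H. exists n. split; [|reflexivity].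
    unfold ind in H. destruct excluded_middle_informative; [assumption|lra].
  + rewrite (proj1 (comb_odd n)) in H. pose proof (ind_bounds (Ib n)). lra.
- intros [n [Hn ->]]. rewrite (proj1 (comb_even n)). apply ind_true, Hn.
Qed.

Lemma comb_neg (k : nat) : sigma k = -1 <-> exists n, Ib n /\ k = S (2 * n).
Proof.
split.
- intros H. destruct (comb_cases k) as [n [->| ->]].
  + rewrite (proj1 (comb_even n)) in H. pose proof (ind_bounds (Ia n)). lra.
  + rewrite (proj1 (comb_odd n)) in H. exists n. split; [|reflexivity].
    unfold ind in H. destruct excluded_middle_informative; [assumption|lra].
- intros [n [Hn ->]]. rewrite (proj1 (comb_odd n)), ind_true by exact Hn. ring.
Qed.

Lemma comb_supp (z : Cx) : supp sigma s z <-> (exists n, Ia n /\ a n = z) \/ (exists n, Ib n /\ b n = z).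
Proof.
split.
- intros [k [Hk E]]. destruct (comb_unit_weights k) as [Q|[Q|Q]]; [contradiction| |].
  + apply comb_pos in Q. destruct Q as [n [Hn ->]]. left. exists n. rewrite (proj2 (comb_even n)) in E. auto.
  + apply comb_neg in Q. destruct Q as [n [Hn ->]]. right. exists n. rewrite (proj2 (comb_odd n)) in E. auto.
- intros [[n [Hn E]]|[n [Hn E]]].
  + exists (2 * n)%nat. rewrite (proj1 (comb_even n)), (proj2 (comb_even n)), ind_true by exact Hn. split; [lra|exact E].
  + exists (S (2 * n)). rewrite (proj1 (comb_odd n)), (proj2 (comb_odd n)), ind_true by exact Hn. split; [lra|exact E].
Qed.

Lemma comb_bound (r : R) : exists N, (forall n, Ia n -> Cnorm (a n) <= r -> (n < N)%nat) /\
  (forall n, Ib n -> Cnorm (b n) <= r -> (n < N)%nat).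
Proof.
destruct (Hfa r) as [N1 H1]. destruct (Hfb r) as [N2 H2]. exists (Nat.max N1 N2).
split; intros n Hn Hr; [specialize (H1 n Hn Hr)|specialize (H2 n Hn Hr)]; lia.
Qed.

Lemma comb_vanish (r : R) (N : nat) :
  (forall n, Ia n -> Cnorm (a n) <= r -> (n < N)%nat) ->
  (forall n, Ib n -> Cnorm (b n) <= r -> (n < N)%nat) ->
  forall k, (2 * N <= k)%nat -> Cnorm (s k) <= r -> sigma k = 0.
Proof.
intros H1 H2 k Hk Hr. destruct (comb_unit_weights k) as [Q|[Q|Q]]; [exact Q|exfalso..].
- apply comb_pos in Q. destruct Q as [n [Hn ->]]. rewrite (proj2 (comb_even n)) in Hr.
  specialize (H1 n Hn Hr). lia.
- apply comb_neg in Q. destruct Q as [n [Hn ->]]. rewrite (proj2 (comb_odd n)) in Hr.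
  specialize (H2 n Hn Hr). lia.
Qed.

Lemma comb_loc_finite : loc_finite sigma s.
Proof.
intros r. destruct (comb_bound r) as [N [H1 H2]]. exists (2 * N)%nat. apply comb_vanish; assumption.
Qed.

Lemma comb_sint (r : R) (N : nat) (F : Cx -> R) :
  (forall n, Ia n -> Cnorm (a n) <= r -> (n < N)%nat) ->
  (forall n, Ib n -> Cnorm (b n) <= r -> (n < N)%nat) ->
  (forall z, r < Cnorm z -> F z = 0) ->
  sint sigma s F = psum (fun n => ind (Ia n) * F (a n)) N - psum (fun n => ind (Ib n) * F (b n)) N /\
  sint (absw sigma) s F = psum (fun n => ind (Ia n) * F (a n)) N + psum (fun n => ind (Ib n) * F (b n)) N.
Proof.
intros H1 H2 HF.
assert (Hz : forall k, (2 * N <= k)%nat -> sigma k * F (s k) = 0 /\ absw sigma k * F (s k) = 0).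
{ intros k Hk. destruct (Rle_lt_dec (Cnorm (s k)) r) as [L|L].
  - unfold absw. rewrite (comb_vanish r N H1 H2 k Hk L), Rabs_R0. split; ring.
  - rewrite (HF _ L). split; ring. }
unfold sint. split.
- rewrite (is_series_unique _ _ (is_series_finite _ (2 * N) (fun k Hk => proj1 (Hz k Hk)))), psum_interleave.
  rewrite (psum_ext _ (fun n => ind (Ia n) * F (a n) + (-1) * (ind (Ib n) * F (b n)))).
  + rewrite psum_plus, psum_scal. ring.
  + intros n _. destruct (comb_even n) as [E1 E2]. destruct (comb_odd n) as [E3 E4].
    rewrite E1, E2, E3, E4. ring.
- rewrite (is_series_unique _ _ (is_series_finite _ (2 * N) (fun k Hk => proj2 (Hz k Hk)))), psum_interleave.
  rewrite (psum_ext _ (fun n => ind (Ia n) * F (a n) + ind (Ib n) * F (b n))).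
  + apply psum_plus.
  + intros n _. destruct (comb_even n) as [E1 E2]. destruct (comb_odd n) as [E3 E4]. unfold absw.
    rewrite E1, E2, E3, E4, Rabs_Ropp, !Rabs_right by (apply Rle_ge, ind_bounds). reflexivity.
Qed.

Lemma ind_and (P Q : Prop) : ind (P /\ Q) = ind P * ind Q.
Proof. unfold ind. repeat destruct excluded_middle_informative; try tauto; ring. Qed.

Lemma comb_fcard (P : Cx -> Prop) (r : R) : (forall z, P z -> Cnorm z <= r) ->
  INR (fcard (fun n => Ia n /\ P (a n))) - INR (fcard (fun n => Ib n /\ P (b n))) = sint sigma s (fun z => ind (P z)) /\
  INR (fcard (fun n => Ia n /\ P (a n))) + INR (fcard (fun n => Ib n /\ P (b n))) = sint (absw sigma) s (fun z => ind (P z)).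
Proof.
intros HP. destruct (comb_bound r) as [N [H1 H2]].
destruct (comb_sint r N (fun z => ind (P z)) H1 H2) as [E1 E2].
{ intros z Hz. apply ind_false. intros Q. specialize (HP z Q). lra. }
rewrite E1, E2.
rewrite (INR_fcard (fun n => Ia n /\ P (a n)) N) by (intros n [Hn Q]; auto).
rewrite (INR_fcard (fun n => Ib n /\ P (b n)) N) by (intros n [Hn Q]; auto).
rewrite (psum_ext (fun n => ind (Ia n /\ P (a n))) (fun n => ind (Ia n) * ind (P (a n)))) by (intros; apply ind_and).
rewrite (psum_ext (fun n => ind (Ib n /\ P (b n))) (fun n => ind (Ib n) * ind (P (b n)))) by (intros; apply ind_and).
split; reflexivity.
Qed.

Lemma comb_fsumC (P : Cx -> Prop) (G : Cx -> Cx) (r : R) : (forall z, P z -> Cnorm z <= r) ->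
  Csub (fsumC (fun n => Ia n /\ P (a n)) (fun n => G (a n))) (fsumC (fun n => Ib n /\ P (b n)) (fun n => G (b n)))
  = sintC sigma s (fun z => Cmul (RtoC (ind (P z))) (G z)).
Proof.
intros HP. destruct (comb_bound r) as [N [H1 H2]].
assert (HV : forall z, r < Cnorm z -> ind (P z) = 0).
{ intros z Hz. apply ind_false. intros Q. specialize (HP z Q). lra. }
rewrite (fsumC_psum (fun n => Ia n /\ P (a n)) _ N) by (intros n [Hn Q]; auto).
rewrite (fsumC_psum (fun n => Ib n /\ P (b n)) _ N) by (intros n [Hn Q]; auto).
apply Cx_eq; cbn [Re Im sintC Csub Cadd Copp].
- destruct (comb_sint r N (fun z => Re (Cmul (RtoC (ind (P z))) (G z))) H1 H2) as [E _].
  { intros z Hz. rewrite Re_RtoC_mul, HV by exact Hz. ring. }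
  rewrite E. unfold Rminus. f_equal; [|f_equal]; apply psum_ext; intros n _; rewrite ind_and, Re_RtoC_mul; ring.
- destruct (comb_sint r N (fun z => Im (Cmul (RtoC (ind (P z))) (G z))) H1 H2) as [E _].
  { intros z Hz. rewrite Im_RtoC_mul, HV by exact Hz. ring. }
  rewrite E. unfold Rminus. f_equal; [|f_equal]; apply psum_ext; intros n _; rewrite ind_and, Im_RtoC_mul; ring.
Qed.

Lemma comb_fprodC (P : Cx -> Prop) (F G : Cx -> Cx) (r : R) : (forall z, P z -> Cnorm z <= r) ->
  (forall z, supp sigma s z -> F z = Cexp (G z)) ->
  Cdiv (fprodC (fun n => Ia n /\ P (a n)) (fun n => F (a n))) (fprodC (fun n => Ib n /\ P (b n)) (fun n => F (b n)))
  = Cexp (sintC sigma s (fun z => Cmul (RtoC (ind (P z))) (G z))).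
Proof.
intros HP HF. rewrite <- (comb_fsumC P G r HP).
destruct (comb_bound r) as [N [H1 H2]].
rewrite (fsumC_psum (fun n => Ia n /\ P (a n)) _ N) by (intros n [Hn Q]; auto).
rewrite (fsumC_psum (fun n => Ib n /\ P (b n)) _ N) by (intros n [Hn Q]; auto).
rewrite (fprodC_psum (fun n => Ia n /\ P (a n)) _ (fun n => G (a n)) N).
2: { intros n [Hn Q]; auto. }
2: { intros n [Hn Q]. apply HF, comb_supp. left. exists n. auto. }
rewrite (fprodC_psum (fun n => Ib n /\ P (b n)) _ (fun n => G (b n)) N).
2: { intros n [Hn Q]; auto. }
2: { intros n [Hn Q]. apply HF, comb_supp. right. exists n. auto. }
unfold Csub, Cdiv. rewrite Cexp_add, Cexp_opp. reflexivity.
Qed.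

Lemma ball_bounded (c z : Cx) (t : R) : Cnorm (Csub z c) <= t -> Cnorm z <= Cnorm c + t.
Proof. intros H. pose proof (Cnorm_sub_ge z c). lra. Qed.

Lemma lnp_sum_at_1 (c : Cx) (g : Cx -> R) : sint sigma s (fun z => g z * lnp (rad c z) 1) = 0.
Proof.
rewrite (sint_ext _ _ _ (fun z => 0 * 0)).
- rewrite sint_scal. ring.
- intros z _. rewrite lnp_zero; [ring|apply rad_ge1].
Qed.

(** Hypotheses (d) and (e) speak about every proof of integrability; to apply them one such proof
    has to be exhibited, together with the value of its integral. *)
Lemma comb_RiemannInt (g : Cx -> R) (f : R -> R) (c : Cx) (r : R) : 1 < r ->
  (forall t, f t = sint sigma s (fun z => g z * ind (Cnorm (Csub z c) < t)) / t) ->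
  exists pr : Riemann_integrable f 1 r, RiemannInt pr = sint sigma s (fun z => g z * lnp (rad c z) r).
Proof.
intros Hr Hf.
assert (H := is_RInt_disc_sum sigma s comb_loc_finite c g r ltac:(lra)).
assert (E : f = (fun t => sint sigma s (fun z => g z * ind (Cnorm (Csub z c) < t)) / t)).
{ apply functional_extensionality. exact Hf. }
rewrite <- E in H.
exists (ex_RInt_Reals_0 f 1 r (ex_intro _ _ H)).
rewrite <- RInt_Reals. apply is_RInt_unique, H.
Qed.

End Combined.

Theorem mainTheorem3
  (Ia : nat -> Prop) (a : nat -> Cx) (Ib : nat -> Prop) (b : nat -> Cx)
  (* D = ((a_n),(b_n)) is a divisor: discrete support *)
  (Hfa : locally_finite Ia a) (Hfb : locally_finite Ib b)
  (Ha0 : forall n, Ia n -> a n <> Czero) (Hb0 : forall n, Ib n -> b n <> Czero)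
  (* (a) *)
  (Ha : exists delta, delta > 0 /\
          forall n k, Ia n -> Ib k -> delta <= Cnorm (Csub (a n) (b k)))
  (* (b) *)
  (Hb : exists Cst, forall c : Cx,
          INR (fcard (fun n => Ia n /\ Cnorm (Csub (a n) c) <= 1)) +
          INR (fcard (fun n => Ib n /\ Cnorm (Csub (b n) c) <= 1)) < Cst)
  (* (d) *)
  (Hd : exists Cst, forall (c : Cx) (r : R), r > 1 ->
          forall pr : Riemann_integrable
            (fun t => (INR (fcard (fun n => Ia n /\ Cnorm (Csub (a n) c) < t)) -
                       INR (fcard (fun n => Ib n /\ Cnorm (Csub (b n) c) < t))) / t) 1 r,
          Rabs (RiemannInt pr) < Cst)
  (* (e) *)
  (He : exists Cst, forall (c : Cx) (r : R), r > 1 ->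
          forall (pre : Riemann_integrable
            (fun t => Re (Csub (fsumC (fun n => Ia n /\ Cnorm (Csub (a n) c) < t)
                                      (fun n => Csub (a n) c))
                               (fsumC (fun n => Ib n /\ Cnorm (Csub (b n) c) < t)
                                      (fun n => Csub (b n) c))) / t) 1 r)
                 (pim : Riemann_integrable
            (fun t => Im (Csub (fsumC (fun n => Ia n /\ Cnorm (Csub (a n) c) < t)
                                      (fun n => Csub (a n) c))
                               (fsumC (fun n => Ib n /\ Cnorm (Csub (b n) c) < t)
                                      (fun n => Csub (b n) c))) / t) 1 r),
          Cnorm (mkCx (RiemannInt pre / r) (RiemannInt pim / r)) < Cst)
  (* (f) *)
  (Hf : exists L : Cx, Clim_infty
          (fun r => Csub (fsumC (fun n => Ia n /\ 1 <= Cnorm (a n) < r)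
                                (fun n => Cinv (Cpow (a n) 2)))
                         (fsumC (fun n => Ib n /\ 1 <= Cnorm (b n) < r)
                                (fun n => Cinv (Cpow (b n) 2)))) L) :
  exists alpha : Cx,
    Clim_infty
      (fun r => Csub
         (fsumC (fun n => Ib n /\ Cnorm (b n) < r)
                (fun n => Csub (Cinv (b n)) (Cdiv (Cconj (b n)) (RtoC (r * r)))))
         (fsumC (fun n => Ia n /\ Cnorm (a n) < r)
                (fun n => Csub (Cinv (a n)) (Cdiv (Cconj (a n)) (RtoC (r * r))))))
      alpha /\
    exists f : Cx -> Cext,
      (forall z, (forall n, Ia n -> a n <> z) -> (forall n, Ib n -> b n <> z) ->
         exists w : Cx,
           Clim_infty
             (fun r => Cdiv
                (fprodC (fun n => Ia n /\ Cnorm (a n) < r)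
                   (fun n => Cmul (Csub Cone (Cdiv z (a n))) (Cexp (Cdiv z (a n)))))
                (fprodC (fun n => Ib n /\ Cnorm (b n) < r)
                   (fun n => Cmul (Csub Cone (Cdiv z (b n))) (Cexp (Cdiv z (b n))))))
             w /\
           f z = Fin (Cmul (Cexp (Cmul alpha z)) w)) /\
      meromorphic_on_C f /\
      has_divisor f (divisor_of Ia a Ib b) /\
      normal_function f.
Proof.
set (sigma := comb_weight Ia Ib). set (s := comb_point a b).
assert (LF : loc_finite sigma s) by (apply comb_loc_finite; assumption).
assert (Hs : unit_weights sigma) by apply (comb_unit_weights Ia a Ib b).
assert (H0 : forall z, supp sigma s z -> z <> Czero).
{ intros z Hz. apply comb_supp in Hz. destruct Hz as [[n [Hn <-]]|[n [Hn <-]]]; auto. }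
destruct Ha as [delta [Hdelta Ha]]. destruct Hb as [Cb Hb]. destruct Hd as [Cd Hd].
destruct He as [Ce He]. destruct Hf as [B1 HB1].

(* Translation of the hypotheses to the signed measure *)
assert (Hsep : forall n k, sigma n = 1 -> sigma k = -1 -> delta <= Cnorm (Csub (s n) (s k))).
{ intros n k Hn Hk. apply (comb_pos Ia a Ib b) in Hn. apply (comb_neg Ia a Ib b) in Hk.
  destruct Hn as [n' [Hn ->]]. destruct Hk as [k' [Hk ->]].
  unfold s. rewrite (proj2 (comb_even Ia a Ib b n')), (proj2 (comb_odd Ia a Ib b k')). auto. }
assert (Hcount : forall c, sint (absw sigma) s (fun z => ind (Cnorm (Csub z c) <= 1)) <= Cb).
{ intros c. left.
  destruct (comb_fcard Ia a Ib b Hfa Hfb (fun z => Cnorm (Csub z c) <= 1) (Cnorm c + 1)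
     (fun z => ball_bounded c z 1)) as [_ E]. fold sigma s in E. rewrite <- E. apply Hb. }
assert (HD : forall c t, 1 <= t -> Rabs (sint sigma s (fun z => lnp (rad c z) t)) <= Cd).
{ intros c t Ht.
  assert (W : forall r, 1 < r -> Rabs (sint sigma s (fun z => 1 * lnp (rad c z) r)) < Cd).
  { intros r Hr.
    destruct (comb_RiemannInt Ia a Ib b Hfa Hfb (fun _ => 1)
      (fun t => (INR (fcard (fun n => Ia n /\ Cnorm (Csub (a n) c) < t)) -
                 INR (fcard (fun n => Ib n /\ Cnorm (Csub (b n) c) < t))) / t) c r Hr) as [pr E].
    { intros u. f_equal.
      rewrite (proj1 (comb_fcard Ia a Ib b Hfa Hfb (fun z => Cnorm (Csub z c) < u) (Cnorm c + u)
        (fun z Hz => ball_bounded c z u (Rlt_le _ _ Hz)))). apply sint_ext. intros; ring. }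
    fold sigma s in E. rewrite <- E. apply Hd, Hr. }
  rewrite (sint_ext _ _ _ (fun z => 1 * lnp (rad c z) t)) by (intros; ring).
  (* Hypothesis (d) covers r > 1 only. At t = 1 all weights vanish, and [Cd] > 0 follows from the
     case r = 2. *)
  destruct Ht as [Ht|<-]; [left; apply W, Ht|].
  unfold sigma, s. rewrite (lnp_sum_at_1 Ia a Ib b c (fun _ => 1)), Rabs_R0.
  left. eapply Rle_lt_trans; [apply Rabs_pos|]. apply (W 2). lra. }
assert (HE : forall c t, 1 <= t ->
   Rabs (sint sigma s (fun z => Re (Csub z c) * lnp (rad c z) t)) <= Ce * t /\
   Rabs (sint sigma s (fun z => Im (Csub z c) * lnp (rad c z) t)) <= Ce * t).
{ intros c.
  assert (W : forall r, 1 < r -> Cnorm (mkCx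
     (sint sigma s (fun z => Re (Csub z c) * lnp (rad c z) r) / r)
     (sint sigma s (fun z => Im (Csub z c) * lnp (rad c z) r) / r)) < Ce).
  { intros r Hr.
    destruct (comb_RiemannInt Ia a Ib b Hfa Hfb (fun z => Re (Csub z c))
            (fun t => Re (Csub (fsumC (fun n => Ia n /\ Cnorm (Csub (a n) c) < t)
                                      (fun n => Csub (a n) c))
                               (fsumC (fun n => Ib n /\ Cnorm (Csub (b n) c) < t)
                                      (fun n => Csub (b n) c))) / t) c r Hr) as [pre E1].
    { intros u. f_equal. rewrite (comb_fsumC Ia a Ib b Hfa Hfb (fun z => Cnorm (Csub z c) < u) (fun z => Csub z c) (Cnorm c + u)
        (fun z Hz => ball_bounded c z u (Rlt_le _ _ Hz))).
      apply sint_ext. intros z _. rewrite Re_RtoC_mul. apply Rmult_comm. }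
    destruct (comb_RiemannInt Ia a Ib b Hfa Hfb (fun z => Im (Csub z c))
            (fun t => Im (Csub (fsumC (fun n => Ia n /\ Cnorm (Csub (a n) c) < t)
                                      (fun n => Csub (a n) c))
                               (fsumC (fun n => Ib n /\ Cnorm (Csub (b n) c) < t)
                                      (fun n => Csub (b n) c))) / t) c r Hr) as [pim E2].
    { intros u. f_equal. rewrite (comb_fsumC Ia a Ib b Hfa Hfb (fun z => Cnorm (Csub z c) < u) (fun z => Csub z c) (Cnorm c + u)
        (fun z Hz => ball_bounded c z u (Rlt_le _ _ Hz))).
      apply sint_ext. intros z _. rewrite Im_RtoC_mul. apply Rmult_comm. }
    fold sigma s in E1, E2. rewrite <- E1, <- E2. apply He, Hr. }
  assert (HCe : 0 <= Ce).
  { left. eapply Rle_lt_trans; [apply Cnorm_ge0|]. apply (W 2). lra. }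
  assert (V : forall x r, 1 < r -> Rabs (x / r) < Ce -> Rabs x <= Ce * r).
  { intros x r Hr Hx. unfold Rdiv in Hx. rewrite Rabs_mult, Rabs_inv, (Rabs_right r) in Hx by lra.
    left. apply Rlt_div_l in Hx; lra. }
  intros t [Ht|<-].
  - assert (A := W t Ht). split; apply V; try exact Ht; (eapply Rle_lt_trans; [|exact A]).
    + apply (Re_le_Cnorm (mkCx _ _)).
    + apply (Im_le_Cnorm (mkCx _ _)).
  - unfold sigma, s. rewrite (lnp_sum_at_1 Ia a Ib b c (fun z => Re (Csub z c))).
    rewrite (lnp_sum_at_1 Ia a Ib b c (fun z => Im (Csub z c))). rewrite Rabs_R0. lra. }
assert (HB : exists B, Clim_infty (fun r => sintC sigma s (fun z => Cmul (RtoC (disc r z)) (Cinv (Cmul z z)))) B).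
(* (f) sums over |a| >= 1 only; the finitely many points of the open unit disc are added to its
   limit. *)
{ exists (Cadd B1 (sintC sigma s (fun z => Cmul (RtoC (disc 1 z)) (Cinv (Cmul z z))))).
  apply (Clim_infty_eventually_eq _ (fun r => Cadd
     (Csub (fsumC (fun n => Ia n /\ 1 <= Cnorm (a n) < r) (fun n => Cinv (Cpow (a n) 2)))
           (fsumC (fun n => Ib n /\ 1 <= Cnorm (b n) < r) (fun n => Cinv (Cpow (b n) 2))))
     (sintC sigma s (fun z => Cmul (RtoC (disc 1 z)) (Cinv (Cmul z z))))) _ 1).
  - intros r Hr.
    rewrite (comb_fsumC Ia a Ib b Hfa Hfb (fun z => 1 <= Cnorm z < r) (fun z => Cinv (Cpow z 2)) r) by (intros; lra).
    fold sigma s. rewrite <- sintC_add.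
    + apply sintC_ext. intros z _. replace (Cpow z 2) with (Cmul z z) by (simpl; ring).
      unfold disc. destruct (Rlt_le_dec (Cnorm z) 1) as [L|L].
      * rewrite (ind_true (Cnorm z < r)), (ind_true (Cnorm z < 1)), ind_false by lra. cx.
      * rewrite (ind_false (_ < 1)) by lra. rewrite (ind_iff (1 <= Cnorm z < r) (Cnorm z < r)) by (split; intros; lra). cx.
    + apply integrableC_compact with r; [exact LF|]. intros z Hz. rewrite ind_false by lra. cx.
    + apply disc_integrableC, LF.
  - apply Clim_infty_add; [exact HB1|apply Clim_infty_const]. }
destruct HB as [B HB].
assert (HE1 := fun c t Ht => proj1 (HE c t Ht)). assert (HE2 := fun c t Ht => proj2 (HE c t Ht)).

(* The constant alpha, the divisor, the product formula and normality *)
destruct (disc_moment_0_converges sigma s LF Ce H0 HE1 HE2) as [alpha Halpha].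
exists alpha. split.
{ apply (Clim_infty_eventually_eq _ (fun r => Cmul (Copp Cone) (disc_moment sigma s Czero r)) _ 0).
  - intros r _. unfold disc_moment.
    rewrite (sintC_ext _ _ _ (fun z => Cmul (RtoC (ind (Cnorm z < r))) (disc_kernel r z))).
    + unfold sigma, s. rewrite <- (comb_fsumC Ia a Ib b Hfa Hfb (fun z => Cnorm z < r) (disc_kernel r) r) by (intros; lra).
      unfold disc_kernel. ring.
    + intros z _. replace (Csub z Czero) with z by ring. reflexivity.
  - replace alpha with (Cmul (Copp Cone) (Copp alpha)) by ring. apply Clim_infty_mul_l, Halpha. }
assert (Hdiv : has_divisor (meroF sigma s alpha B) (divisor_of Ia a Ib b)).
{ intros z0. apply (meroF_has_order sigma s LF Cb Hcount H0 Hs).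
  - intros n k Hn Hk E. assert (A := Hsep n k Hn Hk). rewrite E in A.
    replace (Csub (s k) (s k)) with Czero in A by ring. rewrite Cnorm_0 in A. lra.
  - unfold mass, divisor_of. rewrite minus_IZR, <- !INR_IZR_INZ. symmetry.
    apply (comb_fcard Ia a Ib b Hfa Hfb (fun z => z = z0) (Cnorm z0)). intros z ->. lra. }
exists (meroF sigma s alpha B). split; [|split; [|split]].
- intros z Hza Hzb.
  assert (Hz : ~ supp sigma s z).
  { intros E. apply comb_supp in E. destruct E as [[n [Hn E]]|[n [Hn E]]]; [apply (Hza n)|apply (Hzb n)]; assumption. }
  (* The limit of the quotient of products carries no factor e^(alpha z), so alpha z is subtracted
     from the logarithm. *)
  exists (Cexp (Csub (logF sigma s alpha B z) (Cmul alpha z))). split.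
  + apply (Clim_infty_eventually_eq _ (fun r => Cexp (Cadd (Copp (Cmul alpha z)) (Cadd (Cmul alpha z)
      (sintC sigma s (fun w => Cmul (RtoC (disc r w)) (Cadd (Clog1m (Cdiv z w)) (Cdiv z w))))))) _ 0).
    * intros r _.
      rewrite (comb_fprodC Ia a Ib b Hfa Hfb (fun w => Cnorm w < r)
         (fun w => Cmul (Csub Cone (Cdiv z w)) (Cexp (Cdiv z w)))
         (fun w => Cadd (Clog1m (Cdiv z w)) (Cdiv z w)) r).
      -- f_equal. fold sigma s. unfold disc. ring.
      -- intros; lra.
      -- intros w Hw. assert (Hw0 := H0 w Hw). rewrite Cexp_add, Cexp_Clog1m; [reflexivity|].
         intros E. apply Hz. replace z with (Cmul (Cdiv z w) w) by (field; exact Hw0). rewrite E.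
         replace (Cmul Cone w) with w by ring. exact Hw.
    * apply Clim_infty_exp.
      replace (Csub (logF sigma s alpha B z) (Cmul alpha z)) with
        (Cadd (Copp (Cmul alpha z)) (logF sigma s alpha B z)) by ring.
      apply Clim_infty_add; [apply Clim_infty_const|].
      apply (logF_tends sigma s LF Cb Hcount H0 alpha B z HB).
  + rewrite <- Cexp_add.
    replace (Cadd (Cmul alpha z) (Csub (logF sigma s alpha B z) (Cmul alpha z))) with (logF sigma s alpha B z) by ring.
    apply meroF_regular, Hz.
- right. intros z0. exists (divisor_of Ia a Ib b z0). apply Hdiv.
- exact Hdiv.
(* The constants come from [Re_logF_bound] and from [dlogF_bound], whose right-hand side 2 (16 Ce +
   2 x), x the inverse distance sum, is 32 Ce + 4 x. *)
- destruct (meroF_lipschitz sigma s Cb (2 * (Cd + Cb) + Rabs (log_dist_sum sigma s Czero)) (32 * Ce) delta alpha B)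
    as [L [eta [HL [Heta HLip]]]]; try assumption.
  + intros c Hc. apply (Re_logF_bound sigma s LF Cb Cd Hcount H0 HD alpha B Halpha HB c Hc).
  + intros c Hc. eapply Rle_trans; [apply (dlogF_bound sigma s LF Cb Cd Ce Hcount H0 HD HE1 HE2 alpha B Halpha HB c Hc)|].
    right. ring.
  + apply (lipschitz_normal _ L eta HL Heta HLip).
Qed.
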